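(* Let $L_1<L_2$ be real numbers, $\mathbb{T}=\mathbb{R}/\mathbb{Z}$, $\Omega_1=\mathbb{T}\times(-\infty,L_2)$, $\Omega_2=\mathbb{T}\times(L_1,\infty)$. Let $f\in L^\infty(0,\infty,L^2(\mathbb{T},H^1(\mathbb{R})))\cap L^\infty((0,\infty)\times\mathbb{T}\times\mathbb{R})$ and $u_0\in L^2(\mathbb{T},H^1(\mathbb{R}))\cap L^\infty(\mathbb{T}\times\mathbb{R})$. Let $u$ be the solution of $$\frac{\partial u}{\partial t}+v\frac{\partial u}{\partial x}-\frac{\partial^2 u}{\partial v^2}=f \text{ in }(0,\infty)\times\mathbb{T}\times\mathbb{R},\qquad u(0,x,v)=u_0(x,v)\text{ on }\mathbb{T}\times\mathbb{R},$$ and let $(u_1^n,u_2^n)_{n\ge1}$ be the iterates of the classical Schwarz waveform relaxation algorithm (defined in the context), started from initial guesses that belong to $L^\infty(0,\infty,L^\infty(\mathbb{T}))$ and satisfy the compatibility conditions stated in the context. Then for every $T>0$, $$\lim_{n\to\infty}\|u_1^n-u\|_{L^\infty((0,T)\times\Omega_1)}=0\qquad\text{and}\qquad \lim_{n\to\infty}\|u_2^n-u\|_{L^\infty((0,T)\times\Omega_2)}=0.$$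
   Context: The classical Schwarz waveform relaxation algorithm is, for $n\ge1$: $u_1^n$ solves $$\frac{\partial u_1^n}{\partial t}+v\frac{\partial u_1^n}{\partial x}-\frac{\partial^2 u_1^n}{\partial v^2}=f \text{ in }(0,\infty)\times\Omega_1,\quad u_1^n(0,x,v)=u_0(x,v)\text{ on }\Omega_1,\quad u_1^n(t,x,L_2)=u_2^{n-1}(t,x,L_2)\text{ on }(0,\infty)\times\mathbb{T},$$ and $u_2^n$ solves $$\frac{\partial u_2^n}{\partial t}+v\frac{\partial u_2^n}{\partial x}-\frac{\partial^2 u_2^n}{\partial v^2}=f \text{ in }(0,\infty)\times\Omega_2,\quad u_2^n(0,x,v)=u_0(x,v)\text{ on }\Omega_2,\quad u_2^n(t,x,L_1)=u_1^{n-1}(t,x,L_1)\text{ on }(0,\infty)\times\mathbb{T}.$$ For $n=1$ the right-hand sides of the transmission conditions are given boundary functions (initial guesses) $u_2^0(t,x)$ at $v=L_2$ and $u_1^0(t,x)$ at $v=L_1$, chosen in $L^\infty(0,\infty,L^\infty(\mathbb{T}))$ with the compatibility conditions $u_2^0(0,x)=u_0(x,L_2)$ and $u_1^0(0,x)=u_0(x,L_1)$ on $\mathbb{T}$. Solutions are understood in the classes $L^\infty_{loc}(0,\infty,L^2(\mathbb{T},H^2(a,b)))$, with $(a,b)=\mathbb{R}$ for $u$, $(a,b)=(-\infty,L_2)$ for $u_1^n$, and $(a,b)=(L_1,\infty)$ for $u_2^n$, in which the paper asserts that these problems are uniquely solvable; here $H^2(a,b)$ refers to the variable $v$. *)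

(* Defs.v *)
From HB Require Import structures.
From mathcomp Require Import all_boot all_order all_algebra.
From mathcomp Require Import all_classical all_reals all_analysis.

Set Implicit Arguments.
Unset Strict Implicit.
Unset Printing Implicit Defensive.

Import Order.TTheory GRing.Theory Num.Theory.
Import numFieldNormedType.Exports.

Local Open Scope classical_set_scope.
Local Open Scope ring_scope.

(* A function on the torus T = R/Z is represented by its values on the          *)
(* fundamental domain [0, 1[ and its values elsewhere are ignored. The topology *)
(* of T enters only through test functions, which are 1-periodic in x.          *)
(* Points (t, x, v) are elements of R * R * R = (R * R) * R.                    *)
(* Intervals I for the variable v are always open below.                        *)

Section defs.
Variable R : realType.

(* R with its Borel sigma-algebra, the carrier of lebesgue_measure. *)
Local Notation mR := (measurableTypeR R).

Definition leb : {sigma_finite_measure set mR -> \bar R} :=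
  @lebesgue_measure R.
Definition leb2 := (leb \x leb)%E.
Definition leb3 := (leb2 \x leb)%E.

Definition torus : set R := `[0, 1[%classic.
Definition time : set R := `]0, +oo[%classic.

(* C^n functions on V (V = R or R * R * R below). *)
Fixpoint Cn (V : normedModType R) (n : nat) (phi : V -> R) : Prop :=
  if n is m.+1 then
    [/\ continuous phi, forall z w, derivable phi z w
      & forall w, Cn m ('D_w phi)]
  else continuous phi.

Definition smooth (V : normedModType R) (phi : V -> R) :=
  forall n, Cn n phi.

Definition Linf_norm d (X : measurableType d) (mu : {measure set X -> \bar R})
    (D : set X) (h : X -> R) : \bar R :=
  'N[mu]_+oo%E[(EFin \o h) \_ D]%E.

Definition Linf d (X : measurableType d) (mu : {measure set X -> \bar R})
    (D : set X) (h : X -> R) :=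
  measurable_fun D h /\ (Linf_norm mu D h < +oo)%E.

(* h is the distributional derivative of g on the open interval I. *)
Definition weak_deriv (I : interval R) (g h : R -> R) :=
  forall phi : R -> R, smooth phi ->
    (exists c d, [/\ c \in I, d \in I &
       forall v, phi v != 0 -> c <= v <= d]) ->
    (\int[leb]_(v in [set` I]) (g v * derive1 phi v)%:E =
     - (\int[leb]_(v in [set` I]) (h v * phi v)%:E))%E.

Definition square_integrable d (X : measurableType d) (mu : {measure set X -> \bar R})
    (D : set X) (h : X -> R) :=
  measurable_fun D h /\ (\int[mu]_(z in D) ((h z) ^+ 2)%:E < +oo)%E.

(* L^2(T, H^k(I)), for functions of (x, v); w i is the i-th derivative of h in  *)
(* the variable v.                                                              *)
Definition L2_Hk (k : nat) (I : interval R) (h : R * R -> R) :=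
  exists w : nat -> R * R -> R,
    [/\ w 0%N = h,
        forall i, (i <= k)%N ->
          square_integrable leb2 (torus `*` [set` I]) (w i) &
        forall i, (i < k)%N -> \forall x \ae leb, torus x ->
          weak_deriv I (fun v => w i (x, v)) (fun v => w i.+1 (x, v))].

(* L^oo(J, L^2(T, H^k(I))), for functions of (t, x, v). *)
Definition Linf_L2_Hk (k : nat) (J : set R) (I : interval R)
    (h : R * R * R -> R) :=
  exists w : nat -> R * R * R -> R,
    [/\ w 0%N = h,
        forall i, (i <= k)%N ->
          measurable_fun (T := (mR * mR * mR)%type)
            (J `*` torus `*` [set` I]) (w i),
        exists C : R, forall i, (i <= k)%N -> \forall t \ae leb, J t ->
          (\int[leb2]_(y in torus `*` [set` I])
             ((w i (t, y.1, y.2)) ^+ 2)%:E <= C%:E)%E &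
        forall i, (i < k)%N -> \forall y \ae leb2, (J `*` torus) y ->
          weak_deriv I (fun v => w i (y, v)) (fun v => w i.+1 (y, v))].

(* L^oo_loc(0, oo, L^2(T, H^k(I))): "loc" refers to compact subsets of the open *)
(* half-line ]0, oo[.                                                           *)
Definition Linf_loc_L2_Hk (k : nat) (I : interval R) (h : R * R * R -> R) :=
  forall s r : R, 0 < s -> Linf_L2_Hk k `[s, r]%classic I h.

(* C_c^oo (]0, oo[ x T x I). *)
Definition test_fun (I : interval R) (phi : R * R * R -> R) :=
  [/\ smooth phi,
      forall t x v, phi (t, x + 1, v) = phi (t, x, v) &
      exists s r c d, [/\ 0 < s, c \in I, d \in I &
        forall t x v, phi (t, x, v) != 0 -> s <= t <= r /\ c <= v <= d]].

(* u_t + v u_x - u_vv = f in the sense of distributions on ]0, oo[ x T x I. *)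
Definition kolmogorov_eq (I : interval R) (f u : R * R * R -> R) :=
  forall phi, test_fun I phi ->
    let et : R * R * R := (1, 0, 0) in
    let ex : R * R * R := (0, 1, 0) in
    let ev : R * R * R := (0, 0, 1) in
    (\int[leb3]_(z in time `*` torus `*` [set` I])
        (u z * (- 'D_et phi z - z.2 * 'D_ex phi z
                - 'D_ev ('D_ev phi) z))%:E =
     \int[leb3]_(z in time `*` torus `*` [set` I]) (f z * phi z)%:E)%E.

(* u(0, ., .) = u0 on T x I: u(t, ., .) tends to u0 in L^2(T x I) as t -> 0+,   *)
(* up to a null set of times t.                                                 *)
Definition initial_value (I : interval R) (u0 : R * R -> R)
    (u : R * R * R -> R) :=
  forall e : R, 0 < e -> exists2 del : R, 0 < del &
    \forall t \ae leb, 0 < t < del ->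
      (\int[leb2]_(y in torus `*` [set` I])
         ((u (t, y.1, y.2) - u0 y) ^+ 2)%:E <= e%:E)%E.

Definition solution (I : interval R) (f : R * R * R -> R) (u0 : R * R -> R)
    (u : R * R * R -> R) :=
  [/\ Linf_loc_L2_Hk 2 I u, kolmogorov_eq I f u & initial_value I u0 u].

(* The value at c, a point of the closure of I, of the continuous               *)
(* representative of the function h in H^k(I), k >= 1, is y.                    *)
Definition value_at (I : interval R) (h : R -> R) (c y : R) :=
  exists h' : R -> R,
    [/\ {within closure [set` I], continuous h'},
        \forall v \ae leb, v \in I -> h v = h' v & h' c = y].

(* u(t, x, c) = g(t, x) on ]0, oo[ x T. *)
Definition trace_eq (I : interval R) (c : R) (u : R * R * R -> R)
    (g : R * R -> R) :=
  \forall y \ae leb2, (time `*` torus) y ->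
    value_at I (fun v => u (y, v)) c (g y).

(* u(t, x, c) = w(t, x, c) on ]0, oo[ x T, with u defined for v in I and w for  *)
(* v in J.                                                                      *)
Definition same_trace (c : R) (I : interval R) (u : R * R * R -> R)
    (J : interval R) (w : R * R * R -> R) :=
  \forall y \ae leb2, (time `*` torus) y -> exists b : R,
    value_at I (fun v => u (y, v)) c b /\ value_at J (fun v => w (y, v)) c b.

(* g(0, x) = u0(x, c) on T. Since g is only an L^oo function, its value at      *)
(* t = 0 is the limit of g(t, .) as t -> 0+ in the weakest sense, that of       *)
(* distributions on T; r is the trace of u0 at v = c.                           *)
Definition compatible (c : R) (u0 : R * R -> R) (g : R * R -> R) :=
  exists r : R -> R,
    [/\ measurable_fun (T := mR) torus r,
        \forall x \ae leb, torus x ->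
          value_at `]-oo, +oo[ (fun v => u0 (x, v)) c (r x) &
        forall chi : R -> R, smooth chi -> (forall x, chi (x + 1) = chi x) ->
        forall e : R, 0 < e -> exists2 del : R, 0 < del &
          \forall t \ae leb, 0 < t < del ->
            (`| \int[leb]_(x in torus) ((g (t, x) - r x) * chi x)%:E |
               <= e%:E)%E].

(* (u1 n, u2 n), n >= 1, are the iterates started from the initial guesses g2   *)
(* (for u_2^0 at v = L2) and g1 (for u_1^0 at v = L1); u1 0 and u2 0 are unused. *)
Definition schwarz_iterates (L1 L2 : R) (f : R * R * R -> R)
    (u0 : R * R -> R) (g2 g1 : R * R -> R) (u1 u2 : nat -> R * R * R -> R) :=
  let I1 : interval R := (`]-oo, L2[) in
  let I2 : interval R := (`]L1, +oo[) in
  [/\ (forall n, (1 <= n)%N ->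
         solution I1 f u0 (u1 n) /\ solution I2 f u0 (u2 n)),
      trace_eq I1 L2 (u1 1%N) g2,
      trace_eq I2 L1 (u2 1%N) g1 &
      (forall n, (1 <= n)%N ->
         same_trace L2 I1 (u1 n.+1) I2 (u2 n) /\
         same_trace L1 I2 (u2 n.+1) I1 (u1 n))].

End defs.

(* Main.v *)
(* Comparison argument along characteristics. In the coordinates (y, v), x = y + t v,
   a weak solution has, for almost every (y, v), an absolutely continuous
   representative in time with derivative u_vv + f. Multiplying by the positive part
   of u - w, for a barrier w = M exp(t + k (v - c)) with k in {-1, 0, 1}, and
   integrating by parts in v shows that the L^2 norm of (u - w)_+ is nonincreasing,
   hence zero: u <= w as soon as this holds at t = 0 and on the lateral boundary.
   With k = 0 this bounds u itself. The errors of the iterates solve the homogeneous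
   problem, so barriers with k = 1 and c = L2 (resp. k = -1 and c = L1) propagate the
   boundary bound M exp(t) to M exp(t + v - L2) (resp. M exp(t - v + L1)); read on the
   other interface it has been multiplied by exp(- (L2 - L1)) < 1. *)
Require Import Defs.
From HB Require Import structures.
From mathcomp Require Import all_boot all_order all_algebra.
From mathcomp Require Import all_classical all_reals all_analysis.
From mathcomp Require Import measurable_realfun ess_sup_inf ring lra.
Set Implicit Arguments.
Unset Strict Implicit.
Unset Printing Implicit Defensive.
Import Order.TTheory GRing.Theory Num.Theory.
Import numFieldNormedType.Exports.
Local Open Scope classical_set_scope.
Local Open Scope ring_scope.

(** The equation controls neither [u_t] nor [u_x] separately, only the sum [u_t + v u_x], so
    [(u - w)_+] cannot be used directly as a test function. Testing with [a(t) b(x - t v) c(v)]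
    removes this obstacle: the transport operator differentiates [a] alone. Two groupings of the
    variables then meet: absolute continuity in time holds for a fixed label [(y, v)], whereas
    integration by parts in [v] is done at fixed [(t, x)]. The shear between them preserves the
    measure, which allows passing from one to the other under the integral sign. The barrier need
    not be square integrable in [v], but [(u - w)_+ <= |u|] because [w >= 0]; at an infinite end the
    boundary terms vanish along a sequence since [u] and [u_v] are square integrable. Solutions are
    controlled only on time intervals away from 0, so the energy is compared on []s, r[] and the
    initial condition enters as [s] tends to 0. *)

Lemma product_measure_sigma_finite d1 d2 (T1 : measurableType d1) (T2 : measurableType d2)
    (R : realType) (m1 : {sigma_finite_measure set T1 -> \bar R})
    (m2 : {sigma_finite_measure set T2 -> \bar R}) :
  sigma_finite setT (m1 \x m2)%E.
Proof.
have /sigma_finiteP[F [TF ndF Foo]] := sigma_finiteT m1.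
have /sigma_finiteP[G [TG ndG Goo]] := sigma_finiteT m2.
exists (fun n => F n `*` G n).
  rewrite -setXTT TF TG predeqE => -[x y]; split.
    move=> [/= [n _ Fnx] [k _ Gky]]; exists (maxn n k) => //; split.
    - by move: x Fnx; exact/subsetPset/ndF/leq_maxl.
    - by move: y Gky; exact/subsetPset/ndG/leq_maxr.
  by move=> [n _ []/= ? ?]; split; exists n.
move=> k; have [? ?] := Foo k; have [? ?] := Goo k.
split; first exact: measurableX.
by rewrite product_measure1E// lte_mul_pinfty// ge0_fin_numE.
Qed.

Section lebesgue_products.
Variable R : realType.
(** With these structures [leb2] can itself be a factor in the Fubini theorems, which require
    sigma-finite factors. *)
HB.instance Definition _ := Measure.copy (@leb2 R) (@leb R \x @leb R)%E.
HB.instance Definition _ := Measure_isSigmaFinite.Build _ _ _ (@leb2 R)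
  (product_measure_sigma_finite (@leb R) (@leb R)).
HB.instance Definition _ := Measure.copy (@leb3 R) (@leb2 R \x @leb R)%E.
HB.instance Definition _ := Measure_isSigmaFinite.Build _ _ _ (@leb3 R)
  (product_measure_sigma_finite (@leb2 R) (@leb R)).
End lebesgue_products.

(** * Primitives *)

Lemma integrableD_EFin d (T : measurableType d) (R : realType)
    (mu : {measure set T -> \bar R}) (D : set T) (f g : T -> R) :
  measurable D -> mu.-integrable D (EFin \o f) -> mu.-integrable D (EFin \o g) ->
  mu.-integrable D (EFin \o (fun x => f x + g x)).
Proof.
move=> mD fi gi; have := integrableD mD fi gi.
by apply: eq_integrable => // x _ /=; rewrite EFinD.
Qed.

Lemma integrableB_EFin d (T : measurableType d) (R : realType)
    (mu : {measure set T -> \bar R}) (D : set T) (f g : T -> R) :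
  measurable D -> mu.-integrable D (EFin \o f) -> mu.-integrable D (EFin \o g) ->
  mu.-integrable D (EFin \o (fun x => f x - g x)).
Proof.
move=> mD fi gi; have := integrableB mD fi gi.
by apply: eq_integrable => // x _ /=; rewrite EFinB.
Qed.

Lemma integrableZ_EFin d (T : measurableType d) (R : realType)
    (mu : {measure set T -> \bar R}) (D : set T) (k : R) (f : T -> R) :
  measurable D -> mu.-integrable D (EFin \o f) ->
  mu.-integrable D (EFin \o (fun x => k * f x)).
Proof.
move=> mD fi; have := integrableZl mD k fi.
by apply: eq_integrable => // x _ /=; rewrite EFinM.
Qed.

Section primitives.
Variable R : realType.
Local Notation mR := (measurableTypeR R).
Implicit Types (f g F G h : R -> R) (a b c e : R).

Definition locint f := forall a b, (@leb R).-integrable `[a, b]%classic (EFin \o f).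

(** Absolute continuity in integral form. Regularity in [v] and along characteristics is expressed
    this way, so that products and positive parts are treated without pointwise derivatives. *)
Definition primitive F f := forall a b, a <= b ->
  F b - F a = \int[@leb R]_(x in `[a, b]%classic) f x.

Lemma locint_split f a b c : locint f -> a <= b -> b <= c ->
  \int[@leb R]_(x in `[a, c]%classic) f x =
  \int[@leb R]_(x in `[a, b]%classic) f x + \int[@leb R]_(x in `[b, c]%classic) f x.
Proof.
move=> lf ab bc.
have <- : \int[@leb R]_(x in `]b, c]%classic) f x = \int[@leb R]_(x in `[b, c]%classic) f x.
  apply: Rintegral_itv_obnd_cbnd; apply: integrableS (lf b c) => //.
  exact: subset_itv_oc_cc.
by rewrite -(Rintegral_itvB (lf a c)) ?bnd_simp// addrC subrK.
Qed.

Lemma locint_continuous h : continuous h -> locint h.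
Proof.
move=> ch a b; apply: continuous_compact_integrable; first exact: segment_compact.
by apply: continuous_subspaceT.
Qed.

Lemma continuous_bounded_itv h a b : continuous h ->
  exists2 M, 0 <= M & forall x, a <= x <= b -> `|h x| <= M.
Proof.
move=> ch; have [ab|ba] := leP a b; last first.
  by exists 0 => // x /andP[ax xb]; move: (le_lt_trans (le_trans ax xb) ba); rewrite ltxx.
have [] := @EVT_max R (fun x => `|h x|) a b ab.
  apply: continuous_subspaceT => x.
  exact: (continuous_comp (ch x) (@norm_continuous _ _ _)).
move=> c _ hc; exists `|h c| => // x xab; apply: hc; by rewrite in_itv.
Qed.

Lemma locintM h f : continuous h -> locint f -> locint (fun x => h x * f x).
Proof.
move=> ch lf a b.
apply: (@integrableMr _ _ _ (@leb R) `[a, b]%classic (measurable_itv _) h (EFin \o f)).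
- by apply: measurable_funTS; exact: continuous_measurable_fun.
- have [M M0 hM] := @continuous_bounded_itv h a b ch.
  exists M; split; first exact: num_real.
  by move=> N MN x /= xab; apply: le_trans (ltW MN); apply: hM; rewrite in_itv in xab.
- exact: (lf _ _).
Qed.

Lemma locintD f g : locint f -> locint g -> locint (fun x => f x + g x).
Proof. by move=> lf lg a b; apply: integrableD_EFin. Qed.

Lemma locintZ k f : locint f -> locint (fun x => k * f x).
Proof. by move=> lf; apply: locintM => // x; exact: cvg_cst. Qed.

Lemma locint_norm f : locint f -> locint (fun x => `|f x|).
Proof. by move=> lf a b; exact: integrable_norm. Qed.

Lemma primitive_exists f c y : locint f -> exists2 F, primitive F f & F c = y.
Proof.
move=> lf.
pose F x := y + (if c <= x then \int[@leb R]_(z in `[c, x]%classic) f z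
                 else - \int[@leb R]_(z in `[x, c]%classic) f z).
exists F; last by rewrite /F lexx set_itv1 Rintegral_set1 addr0.
move=> a b ab; rewrite /F opprD addrACA subrr add0r.
have [ca|ac] := leP c a.
  rewrite (le_trans ca ab) (locint_split lf ca ab); lra.
have [cb|bc] := leP c b.
  rewrite opprK addrC [RHS](locint_split lf (ltW ac) cb) //.
rewrite (locint_split lf ab (ltW bc)); lra.
Qed.

Lemma primitive_uniform F f a b e : locint f -> primitive F f -> 0 < e ->
  exists2 d, 0 < d & forall x y, a <= x <= b -> a <= y <= b -> `|x - y| < d ->
    `|F x - F y| < e.
Proof.
move=> lf Ff e0.
pose fab := f \_ `[a, b]%classic.
have ifab : (@leb R).-integrable setT (EFin \o fab).
  by rewrite -restrict_EFin; apply/integrable_restrict => //=; rewrite setTI; exact: (lf _ _).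
have [d [d0 hd]] := integral_normr_continuous ifab e0.
exists d => //.
suff H x y : a <= x -> y <= b -> x <= y -> y - x < d -> `|F y - F x| < e.
  move=> x y /andP[ax xb] /andP[ay yb] xyd.
  have [xy|yx] := leP x y.
    by rewrite distrC H// (le_lt_trans _ xyd)// distrC ler_norm.
  by rewrite H//; [exact: ltW|rewrite (le_lt_trans _ xyd)// ler_norm].
move=> ax yb xy xyd; rewrite (Ff _ _ xy).
have hn := @le_normr_Rintegral _ _ _ (@leb R) _ f (measurable_itv `[x, y]) (lf x y).
apply: (le_lt_trans hn) => {hn}.
rewrite (_ : Rintegral _ _ _ = \int[@leb R]_(z in `[x, y]%classic) `|fab z|).
  apply: hd; first exact: measurable_itv.
  have : (lebesgue_measure (`[x, y]%classic : set R) < d%:E)%E; last by [].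
  by rewrite lebesgue_measure_itv/= lte_fin; case: ifPn => // _; rewrite -EFinD lte_fin.
apply: eq_Rintegral => z; rewrite inE/= in_itv/= => /andP[xz zy].
by rewrite /fab patchE mem_set//= in_itv/= (le_trans ax xz) (le_trans zy yb).
Qed.

Lemma primitive_continuous F f : locint f -> primitive F f -> continuous F.
Proof.
move=> lf Ff x; apply/cvgrPdist_lt => e e0.
have [d d0 hd] := @primitive_uniform F f (x - 1) (x + 1) e lf Ff e0.
near=> y; apply: hd; [lra| |by near: y; exact: cvgr_dist_lt].
have : `|x - y| < 1 by near: y; exact: cvgr_dist_lt.
by rewrite ltr_norml => /andP[? ?]; lra.
Unshelve. all: by end_near. Qed.

Lemma primitive_derive F f : continuous F -> continuous f ->
  (forall x, derivable F x 1) -> (forall x, derive1 F x = f x) -> primitive F f.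
Proof.
move=> cF cf dF Ff a b; rewrite le_eqVlt => /predU1P[->|ab].
  by rewrite subrr set_itv1 Rintegral_set1.
have := @continuous_FTC2 R f F a b ab.
rewrite /Rintegral => ->//; first exact: continuous_subspaceT.
  split; first by move=> x _; exact: dF.
    by apply: cvg_at_right_filter; exact: cF.
  by apply: cvg_at_left_filter; exact: cF.
Qed.

Lemma derive_primitive F f x : continuous f -> primitive F f ->
  derivable F x 1 /\ derive1 F x = f x.
Proof.
move=> cf Ff; pose a := x - 1; pose b := x + 1.
pose G y := \int[@leb R]_(t in `[a, y]%classic) f t.
have xb : x < b by rewrite /b; lra.
have ax : a < x by rewrite /a; lra.
have [dG G'] := continuous_FTC1_closed xb (locint_continuous cf a b) ax (cf x).
have FG : {near x, (fun y => G y + F a) =1 F}.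
  near=> y; rewrite /G -Ff ?subrK// ltW//; near: y; apply: lt_nbhsr; rewrite /a; lra.
have FG' : {near x, (G + cst (F a)) =1 F} by [].
have dGc := derivableD dG (@derivable_cst _ _ _ (F a) x 1).
split; first exact: (near_eq_derivable FG' dGc).
rewrite derive1E -(near_eq_derive _ FG') (deriveD dG (@derivable_cst _ _ _ (F a) x 1)).
by rewrite derive_cst addr0 -derive1E.
Unshelve. all: by end_near. Qed.

Lemma primitiveD F G f g : locint f -> locint g -> primitive F f -> primitive G g ->
  primitive (fun x => F x + G x) (fun x => f x + g x).
Proof.
move=> lf lg Ff Gg a b ab; rewrite (RintegralD _ (lf a b) (lg a b))// -Ff// -Gg//; lra.
Qed.

Lemma primitiveZ F f k : locint f -> primitive F f ->
  primitive (fun x => k * F x) (fun x => k * f x).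
Proof. by move=> lf Ff a b ab; rewrite (RintegralZl _ _ (lf a b))// -Ff// mulrBr. Qed.

Lemma locintB f g : locint f -> locint g -> locint (fun x => f x - g x).
Proof. by move=> lf lg a b; apply: integrableB_EFin. Qed.

Lemma primitiveB F G f g : locint f -> locint g -> primitive F f -> primitive G g ->
  primitive (fun x => F x - G x) (fun x => f x - g x).
Proof.
move=> lf lg Ff Gg; have := primitiveD lf (locintZ (-1) lg) Ff (primitiveZ (-1) lg Gg).
by congr primitive; apply/funext => x; rewrite mulN1r.
Qed.

(** Local to global principle: an inequality between increments that holds on all short intervals,
    up to [e] times a fixed density [k], is summed over a uniform subdivision, and then [e] tends to
    0. It stands in for almost everywhere differentiation in the product rule and in the rules for
    [pos]. *)
Lemma creep F g k a b : a <= b -> locint g -> locint k ->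
  (forall e, 0 < e -> exists2 d, 0 < d & forall x y, a <= x -> x <= y -> y <= b ->
     y - x < d -> F y - F x <= \int[@leb R]_(z in `[x, y]%classic) (g z + e * k z)) ->
  F b - F a <= \int[@leb R]_(z in `[a, b]%classic) g z.
Proof.
move=> ab lg lk H.
have [G Gg _] := primitive_exists 0 0 lg.
have [K Kk _] := primitive_exists 0 0 lk.
rewrite -Gg//.
suff H1 e : 0 < e -> F b - F a <= G b - G a + e * (K b - K a).
  apply/ler_addgt0Pr => e e0.
  (* The accumulated error [e * (K b - K a)] drops below [e] once [e] is divided by [N]; the [+ 1]
     keeps [N] positive. *)
  pose N := `|K b - K a| + 1.
  have N0 : 0 < N by rewrite /N ltr_wpDl.
  apply: (le_trans (H1 (e / N) _)); first by rewrite divr_gt0.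
  rewrite lerD2l mulrAC ler_pdivrMr// ler_wpM2l// ?(ltW e0)// ltW//.
  by rewrite /N (le_lt_trans (ler_norm _))// ltrDl.
move=> e0; have [d d0 hd] := H e e0.
pose N := (Num.trunc ((b - a) / d)).+1.
have N0 : 0 < N%:R :> R by rewrite ltr0n.
have dN : (b - a) / N%:R < d.
  rewrite ltr_pdivrMr// mulrC -ltr_pdivrMr// /N.
  by rewrite Num.Theory.truncnS_gt.
pose t (i : nat) := a + (b - a) / N%:R * i%:R.
have tS i : t i.+1 - t i = (b - a) / N%:R by rewrite /t -natr1; ring.
have st : 0 <= (b - a) / N%:R by rewrite divr_ge0 ?(ltW N0)// subr_ge0.
(* [Q] is the surplus of the right-hand side; its increments over the subdivision are nonnegative
   and telescope. *)
pose Q x := G x + e * K x - F x.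
suff : 0 <= Q (t N) - Q (t 0%N).
  by rewrite /Q /t mulr0 addr0 divfK ?gt_eqF// [a + _]addrC subrK; lra.
rewrite -(telescope_sumr (fun i => Q (t i)))// big_nat; apply: sumr_ge0 => i /andP[_ iN].
have := hd (t i) (t i.+1).
have lge := locintZ e lk.
rewrite -(primitiveD lg lge Gg (primitiveZ e lk Kk)); last first.
  by rewrite -subr_ge0 tS.
rewrite tS /Q => /(_ _ _ _ dN) hh.
suff : F (t i.+1) - F (t i) <= G (t i.+1) + e * K (t i.+1) - (G (t i) + e * K (t i)) by lra.
apply: hh.
- by rewrite /t lerDl mulr_ge0.
- by rewrite -subr_ge0 tS.
- rewrite /t -lerBrDl mulrAC ler_pdivrMr// ler_wpM2l ?subr_ge0// ler_nat//.
Qed.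
End primitives.

(** * Product rule and positive parts for primitives *)

Section convexity_inequalities.
Variable R : realType.
Implicit Types (f g F G B Y Z : R -> R) (a b x y z e : R).

Definition pos x : R := Num.max x 0.

Lemma pos_ge0 x : 0 <= pos x.
Proof. by rewrite /pos le_max lexx orbT. Qed.

Lemma le_pos x : x <= pos x.
Proof. by rewrite /pos le_max lexx. Qed.

Lemma pos_le0 x : x <= 0 -> pos x = 0.
Proof. by move=> x0; rewrite /pos max_r. Qed.

Lemma pos_gt0E x : 0 <= x -> pos x = x.
Proof. by move=> x0; rewrite /pos max_l. Qed.

Lemma pos_lip x y : `|pos x - pos y| <= `|x - y|.
Proof.
rewrite /pos; case: (leP x 0) => x0; case: (leP y 0) => y0;
  rewrite ?subrr ?normr0// ?sub0r ?subr0 ?normrN.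
  by rewrite distrC !ger0_norm; lra.
by rewrite !ger0_norm; lra.
Qed.

(** Tangent inequality at [y] for the convex function [(pos x)^2], whose derivative is [2 pos x]. *)
Lemma pos_sqr_convex x y : (pos y) ^+ 2 - (pos x) ^+ 2 <= 2 * pos y * (y - x).
Proof.
rewrite /pos; case: (leP x 0) => x0; case: (leP y 0) => y0; rewrite ?expr0n /=; [lra|nra|nra|].
have -> : 2 * y * (y - x) = y ^+ 2 - x ^+ 2 + (y - x) ^+ 2 by ring.
by rewrite lerDl sqr_ge0.
Qed.

Lemma pos_continuous : continuous pos.
Proof.
move=> x; apply: (@continuous_max R R id (cst 0)); first exact: cvg_id.
exact: cvg_cst.
Qed.

Lemma primitive_id : primitive id (cst (1 : R)).
Proof.
move=> a b ab; rewrite Rintegral_cst// mul1r.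
have /= E := @lebesgue_measure_itv R `[a, b].
have {}E : leb R `[a, b]%classic = (if (a%:E < b%:E)%E then b%:E - a%:E else 0)%E by exact: E.
rewrite E lte_fin; case: ltP => [_|ba]; first by [].
by rewrite /=; lra.
Qed.

Lemma le_locint f g a b : locint f -> locint g ->
  (forall z, a <= z <= b -> f z <= g z) ->
  \int[@leb R]_(z in `[a, b]%classic) f z <= \int[@leb R]_(z in `[a, b]%classic) g z.
Proof.
move=> lf lg fg; apply: (@le_Rintegral _ _ _ (@leb R) _ f g (measurable_itv `[a, b]) (lf a b) (lg a b)).
by move=> z /=; rewrite in_itv; exact: fg.
Qed.

Lemma primitiveM_le F G f g a b : locint f -> locint g -> primitive F f ->
  primitive G g -> a <= b ->
  F b * G b - F a * G a <=
  \int[@leb R]_(z in `[a, b]%classic) (f z * G z + F z * g z).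
Proof.
move=> lf lg Ff Gg ab.
have cF := primitive_continuous lf Ff; have cG := primitive_continuous lg Gg.
have lFg : locint (fun z => f z * G z + F z * g z).
  apply: locintD; last exact: locintM.
  by under eq_fun do rewrite mulrC; exact: locintM.
have lk : locint (fun z => `|f z| + `|g z|) by apply: locintD; exact: locint_norm.
apply: (@creep R (fun x => F x * G x) _ _ a b ab lFg lk) => e e0.
have [d d0 hF] := primitive_uniform a b lf Ff e0.
have [d' d'0 hG] := primitive_uniform a b lg Gg e0.
exists (Num.min d d'); first by rewrite lt_min d0.
move=> x y ax xy yb; rewrite lt_min => /andP[xyd xyd'].
have -> : F y * G y - F x * G x =
    \int[@leb R]_(z in `[x, y]%classic) (G y * f z + F x * g z).
  rewrite -(primitiveD (locintZ (G y) lf) (locintZ (F x) lg) (primitiveZ _ lf Ff)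
     (primitiveZ _ lg Gg) xy); ring.
apply: le_locint.
- by apply: locintD; exact: locintZ.
- by apply: locintD => //; exact: locintZ.
move=> z /andP[xz zy].
have hz1 : `|G y - G z| < e.
  by apply: hG; [lra|lra|rewrite ger0_norm; lra].
have hz2 : `|F x - F z| < e.
  by apply: hF; [lra|lra|rewrite ler0_norm; lra].
suff : (G y - G z) * f z + (F x - F z) * g z <= e * (`|f z| + `|g z|) by lra.
rewrite mulrDr lerD// (le_trans (ler_norm _))// normrM ler_wpM2r//; exact: ltW.
Qed.

(** The reverse inequality is [primitiveM_le] applied to [-F] and [G]. *)
Lemma primitiveM F G f g : locint f -> locint g -> primitive F f -> primitive G g ->
  primitive (fun x => F x * G x) (fun z => f z * G z + F z * g z).
Proof.
move=> lf lg Ff Gg a b ab; apply/eqP; rewrite eq_le primitiveM_le//=.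
have := primitiveM_le (locintZ (-1) lf) lg (primitiveZ (-1) lf Ff) Gg ab.
have cF := primitive_continuous lf Ff; have cG := primitive_continuous lg Gg.
have lFg : locint (fun z => f z * G z + F z * g z).
  apply: locintD; last exact: locintM.
  by under eq_fun do rewrite mulrC; exact: locintM.
under eq_Rintegral do rewrite -!mulrA -mulrDr.
rewrite (RintegralZl _ _ (lFg a b))//; lra.
Qed.

(** Convexity bounds each increment with [pos (B y)] frozen at the right end, and [creep] lets it
    run. An energy estimate asks for this direction of the chain rule only. *)
Lemma primitive_pos_sqr B f a b : locint f -> primitive B f -> a <= b ->
  (pos (B b)) ^+ 2 - (pos (B a)) ^+ 2 <=
  \int[@leb R]_(z in `[a, b]%classic) (2 * pos (B z) * f z).
Proof.
move=> lf Bf ab; have cB := primitive_continuous lf Bf.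
have cpB : continuous (fun z => 2 * pos (B z)).
  move=> x; apply: cvgM; first exact: cvg_cst.
  by apply: continuous_comp; [exact: cB|exact: pos_continuous].
have lpf : locint (fun z => 2 * pos (B z) * f z) by exact: locintM.
have lk := locint_norm lf.
apply: (@creep R (fun x => (pos (B x)) ^+ 2) _ _ a b ab lpf lk) => e e0.
have e20 : 0 < e / 2 by lra.
have [d d0 hB] := primitive_uniform a b lf Bf e20.
exists d => // x y ax xy yb xyd.
apply: (le_trans (pos_sqr_convex _ _)).
have -> : 2 * pos (B y) * (B y - B x) =
    \int[@leb R]_(z in `[x, y]%classic) (2 * pos (B y) * f z).
  by rewrite (RintegralZl _ _ (lf x y))// -Bf.
apply: le_locint; [exact: locintZ|by apply: locintD => //; exact: locintZ|].
move=> z /andP[xz zy].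
have hz : `|B y - B z| < e / 2 by apply: hB; [lra|lra|rewrite ger0_norm; lra].
suff : 2 * (pos (B y) - pos (B z)) * f z <= e * `|f z| by lra.
rewrite (le_trans (ler_norm _))// normrM ler_wpM2r// normrM ger0_norm//.
have := pos_lip (B y) (B z); lra.
Qed.

(* Both factors [Y y] and [pos (Z y) - pos (Z x)] have the sign of the slope of
   [Z] up to a small error: this is the weak form of [(pos Z)' Z' >= 0]. *)
Lemma primitive_pos_mul Z Y f a b : locint f -> primitive Y f -> primitive Z Y ->
  a <= b ->
  \int[@leb R]_(z in `[a, b]%classic) (pos (Z z) * f z) <=
  pos (Z b) * Y b - pos (Z a) * Y a.
Proof.
move=> lf Yf ZY ab; have cY := primitive_continuous lf Yf.
have lY := locint_continuous cY.
have cZ := primitive_continuous lY ZY.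
have cpZ : continuous (fun z => pos (Z z)).
  by move=> x; apply: continuous_comp; [exact: cZ|exact: pos_continuous].
have lpf : locint (fun z => pos (Z z) * f z) by exact: locintM.
have [M M0 hM] := continuous_bounded_itv a b cY.
have lM : locint (cst M) by apply: locint_continuous => x; exact: cvg_cst.
have lk : locint (fun z => `|f z| + M) by apply: locintD => //; exact: locint_norm.
suff : - (pos (Z b) * Y b) - - (pos (Z a) * Y a) <=
    \int[@leb R]_(z in `[a, b]%classic) (- 1 * (pos (Z z) * f z)).
  rewrite (RintegralZl _ _ (lpf a b))//; lra.
apply: (@creep R (fun x => - (pos (Z x) * Y x)) _ _ a b ab (locintZ (-1) lpf) lk) => e e0.
have [d d0 hY] := primitive_uniform a b lf Yf e0.
have [d' d'0 hZ] := primitive_uniform a b lY ZY e0.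
exists (Num.min d d'); first by rewrite lt_min d0.
move=> x y ax xy yb; rewrite lt_min => /andP[xyd xyd'].
have hslope : `|Z y - Z x - (y - x) * Y y| <= e * (y - x).
  have lc : locint (cst (1 : R)) by apply: locint_continuous => t; exact: cvg_cst.
  have hcst c : c * (y - x) = \int[@leb R]_(z in `[x, y]%classic) (c * 1).
    by rewrite (RintegralZl _ _ (lc x y))// -primitive_id.
  have hz z : x <= z <= y -> `|Y y - Y z| < e.
    by move=> /andP[xz zy]; apply: hY; [lra|lra|rewrite ger0_norm; lra].
  rewrite ler_norml; apply/andP; split.
    suff : (Y y - e) * (y - x) <= Z y - Z x by lra.
    rewrite (ZY _ _ xy) hcst; apply: le_locint => //; first exact: locintZ.
    by move=> z /hz; rewrite ltr_norml; lra.
  suff : Z y - Z x <= (Y y + e) * (y - x) by lra.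
  rewrite (ZY _ _ xy) hcst; apply: le_locint => //; first exact: locintZ.
  by move=> z /hz; rewrite ltr_norml; lra.
have hYy : `|Y y| <= M by apply: hM; lra.
have hmain : - (e * M * (y - x)) <= Y y * (pos (Z y) - pos (Z x)).
  move: hslope hYy; rewrite !ler_norml => /andP[s1 s2] /andP[y1 y2].
  have eM : 0 <= e * (y - x) by rewrite mulr_ge0 ?(ltW e0)// subr_ge0.
  have [Yp|Yn] := leP 0 (Y y).
    have YY : 0 <= (y - x) * Y y by rewrite mulr_ge0// subr_ge0.
    have hD : - (e * (y - x)) <= pos (Z y) - pos (Z x).
      by rewrite /pos; case: (leP (Z x) 0) => ?; case: (leP (Z y) 0) => ?; lra.
    nra.
  have YY : (y - x) * Y y <= 0 by rewrite mulr_ge0_le0 ?subr_ge0// ltW.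
  have hD : pos (Z y) - pos (Z x) <= e * (y - x).
    by rewrite /pos; case: (leP (Z x) 0) => ?; case: (leP (Z y) 0) => ?; lra.
  nra.
have lc : locint (cst (1 : R)) by apply: locint_continuous => t; exact: cvg_cst.
(* The increment of [pos Z * Y] is [pos (Z x) (Y y - Y x) + Y y (pos (Z y) - pos (Z x))]: the first
   term is an integral of [f], the second is bounded by [hmain]. *)
have : - (pos (Z y) * Y y) - - (pos (Z x) * Y x) <=
   \int[@leb R]_(z in `[x, y]%classic) (- pos (Z x) * f z + e * M * 1).
  rewrite -(primitiveD (locintZ _ lf) (locintZ _ lc) (primitiveZ _ lf Yf)
     (primitiveZ _ lc primitive_id) xy) /=.
  lra.
move=> /le_trans; apply; apply: le_locint.
- by apply: locintD; exact: locintZ.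
- by apply: locintD; exact: locintZ.
move=> z /andP[xz zy].
have hz : `|Z x - Z z| < e by apply: hZ; [lra|lra|rewrite ler0_norm; lra].
suff : (pos (Z z) - pos (Z x)) * f z <= e * `|f z| by lra.
rewrite (le_trans (ler_norm _))// normrM ler_wpM2r//.
have := pos_lip (Z z) (Z x); rewrite distrC in hz; lra.
Qed.
End convexity_inequalities.

(** * Smooth functions *)

Section smooth_calculus.
Variable R : realType.

Lemma derive_curve (V : normedModType R) (f : V -> R) z w :
  'D_w f z = derive1 (fun h : R => f (h *: w + z)) 0.
Proof.
rewrite derive1E /derive; set g1 := fun h => h^-1 *: _; set g2 := fun h => h^-1 *: _.
suff -> : g1 = g2 by [].
by rewrite funeqE /g1 /g2 => h /=; rewrite addr0 scale0r add0r [_%:A]mulr1.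
Qed.

Lemma derive_comp (V : normedModType R) (p : V -> R) (h : R -> R) z w :
  derivable p z w -> derivable h (p z) 1 ->
  derivable (h \o p) z w /\ 'D_w (h \o p) z = 'D_1 h (p z) * 'D_w p z.
Proof.
move=> /derivable1P dp dh.
have dh0 : derivable h ((fun k : R => p (k *: w + z)) 0) 1 by rewrite /= scale0r add0r.
split.
  have Dp := (derivable1_diffP _ _).1 dp; have Dh := (derivable1_diffP _ _).1 dh0.
  exact/derivable1P/derivable1_diffP/(differentiable_comp Dp Dh).
rewrite [LHS]derive_curve [X in _ * X]derive_curve.
have := derive1_comp dp dh0; rewrite /= scale0r add0r => ->.
by rewrite derive1E.
Qed.

Lemma derive_1D (f : R -> R) x w : derivable f x 1 ->
  derivable f x w /\ 'D_w f x = w * derive1 f x.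
Proof.
move=> df; have dff : differentiable f x by exact/derivable1_diffP.
split; first exact: diff_derivable.
by rewrite deriveE// deriv1E.
Qed.

Lemma CnSP (V : normedModType R) n (f : V -> R) : Cn n.+1 f <-> [/\ continuous f, forall z w, derivable f z w
  & forall w, Cn n ('D_w f)].
Proof. by []. Qed.

Section Cn.
Variable V : normedModType R.
Implicit Types (f g p : V -> R) (n : nat).

Lemma CnW n f : Cn n.+1 f -> Cn n f.
Proof.
elim: n f => [|n IH] f; first by case.
by move=> [cf df Df]; split=> // w; exact: IH.
Qed.

Lemma Cn_cst n (c : R) : Cn n (fun _ : V => c).
Proof.
elim: n c => [|n IH] c; first by move=> x; exact: cvg_cst.
apply/CnSP; split; [by move=> x; exact: cvg_cst|by move=> *; exact: derivable_cst|].
move=> w; rewrite (_ : 'D_w _ = fun=> 0); first exact: IH.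
by apply/funext => z; exact: derive_cst.
Qed.

Lemma CnD n f g : Cn n f -> Cn n g -> Cn n (fun z => f z + g z).
Proof.
elim: n f g => [|n IH] f g; first by move=> cf cg x; exact: cvgD (cf x) (cg x).
move=> /CnSP[cf df Df] /CnSP[cg dg Dg]; apply/CnSP; split.
- by move=> x; exact: cvgD (cf x) (cg x).
- by move=> z w; exact: derivableD.
- move=> w; rewrite (_ : 'D_w _ = fun z => 'D_w f z + 'D_w g z); first exact: IH.
  by apply/funext => z; exact: deriveD.
Qed.

Lemma CnM n f g : Cn n f -> Cn n g -> Cn n (fun z => f z * g z).
Proof.
elim: n f g => [|n IH] f g; first by move=> cf cg x; exact: cvgM (cf x) (cg x).
move=> Cf Cg; have /CnSP[cf df Df] := Cf; have /CnSP[cg dg Dg] := Cg; apply/CnSP; split.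
- by move=> x; exact: cvgM (cf x) (cg x).
- by move=> z w; exact: derivableM.
- move=> w; rewrite (_ : 'D_w _ = fun z => f z * 'D_w g z + g z * 'D_w f z).
    by apply: CnD; apply: IH; [exact: CnW|exact: Dg|exact: CnW|exact: Df].
  by apply/funext => z; exact: deriveM.
Qed.

Lemma Cn_comp n (h : R -> R) p : Cn n h -> Cn n p -> Cn n (fun z => h (p z)).
Proof.
elim: n h p => [|n IH] h p; first by move=> ch cp x; exact: continuous_comp (cp x) (ch _).
move=> Ch Cp; have /CnSP[ch dh Dh] := Ch; have /CnSP[cp dp Dp] := Cp; apply/CnSP; split.
- by move=> x; exact: continuous_comp (cp x) (ch _).
- by move=> z w; have [] := derive_comp (dp z w) (dh (p z) 1).
- move=> w; rewrite (_ : 'D_w _ = fun z => 'D_1 h (p z) * 'D_w p z).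
    by apply: CnM; [apply: (IH ('D_1 h)); [exact: (Dh 1)|exact: CnW]|exact: Dp].
  by apply/funext => z; have [] := derive_comp (dp z w) (dh (p z) 1).
Qed.

Lemma derive_linear (l : V -> R) z w : (forall k x y, l (k *: x + y) = k * l x + l y) ->
  derivable l z w /\ 'D_w l z = l w.
Proof.
move=> ll; have E : \forall h \near (0 : R)^', h^-1 *: ((l \o shift z) (h *: w) - l z) = l w.
  near=> h; have h0 : h != 0 by near: h; exact: nbhs_dnbhs_neq.
  by rewrite /= ll addrK [_ *: _]mulrA mulVf// mul1r.
split; first exact: is_cvg_near_cst E.
exact: lim_near_cst E.
Unshelve. all: by end_near. Qed.

Lemma smooth_linear (l : V -> R) : (forall k x y, l (k *: x + y) = k * l x + l y) ->
  continuous l -> smooth l.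
Proof.
move=> ll cl [//|n]; apply/CnSP; split=> //.
  by move=> z w; have [] := derive_linear z w ll.
move=> w; rewrite (_ : 'D_w l = fun=> l w); first exact: Cn_cst.
by apply/funext => z; have [] := derive_linear z w ll.
Qed.

Lemma smooth_cst (c : R) : smooth (fun _ : V => c).
Proof. by move=> n; exact: Cn_cst. Qed.

Lemma smoothD f g : smooth f -> smooth g -> smooth (fun z => f z + g z).
Proof. by move=> sf sg n; exact: CnD. Qed.

Lemma smoothM f g : smooth f -> smooth g -> smooth (fun z => f z * g z).
Proof. by move=> sf sg n; exact: CnM. Qed.

Lemma smooth_comp (h : R -> R) p : smooth h -> smooth p -> smooth (fun z => h (p z)).
Proof. by move=> sh sp n; exact: Cn_comp. Qed.

Lemma smooth_derivable f z w : smooth f -> derivable f z w.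
Proof. by move=> /(_ 1%N) []. Qed.

Lemma smooth_continuous f : smooth f -> continuous f.
Proof. by move=> /(_ 0%N). Qed.

Lemma smooth_derive f w : smooth f -> smooth ('D_w f).
Proof. by move=> sf n; have /CnSP[] := sf n.+1. Qed.

End Cn.

Lemma smooth_derive1 (f : R -> R) : smooth f -> smooth (derive1 f).
Proof.
move=> sf; have := smooth_derive (1 : R) sf; congr smooth.
by apply/funext => x; rewrite derive1E.
Qed.

(** [Cn] asks for derivatives in all directions; on the line they are multiples of the derivative in
    direction 1. *)
Lemma Cn_derive1 n (f : R -> R) : (forall x, derivable f x 1) ->
  Cn n (derive1 f) -> Cn n.+1 f.
Proof.
move=> df Cf; apply/CnSP; split.
- by move=> x; exact/differentiable_continuous/derivable1_diffP.
- by move=> z w; have [] := derive_1D w (df z).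
- move=> w; rewrite (_ : 'D_w f = fun z => w * derive1 f z).
    by apply: CnM => //; exact: Cn_cst.
  by apply/funext => z; have [] := derive_1D w (df z).
Qed.

Lemma smooth_id : smooth (fun x : R => x).
Proof. by apply: smooth_linear => // x; exact: cvg_id. Qed.

Lemma smooth_primitive (F f : R -> R) : smooth f -> primitive F f -> smooth F.
Proof.
move=> sf Ff.
have cf := smooth_continuous sf.
have d x := derive_primitive x cf Ff.
move=> [|n]; first exact: primitive_continuous (locint_continuous cf) Ff.
apply: Cn_derive1 => [x|]; first by have [] := d x.
rewrite (_ : derive1 F = f)//; by apply/funext => x; have [] := d x.
Qed.

(* The functions [x^-k exp(-1/x)], [x > 0], span a space closed under differentiation. *)
Definition flat k (x : R) : R := if 0 < x then x^-1 ^+ k * expR (- x^-1) else 0.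

(** With [y = 1/x], the Taylor bound [exp y >= y^(k+1) / (k+1)!] gives
    [y^k exp(-y) <= (k+1)! / y]. *)
Lemma flat_bound k x : `|flat k x| <= (k.+1)`!%:R * `|x|.
Proof.
rewrite /flat; case: ltP => x0; last by rewrite normr0 mulr_ge0.
have y0 : 0 < x^-1 by rewrite invr_gt0.
rewrite ger0_norm ?mulr_ge0 ?exprn_ge0 ?expR_ge0 ?(ltW y0)// gtr0_norm//.
have h := expR_ge1Dxn k (ltW y0).
rewrite expRN ler_pdivrMr ?expR_gt0// mulrAC.
rewrite -ler_pdivrMr// -ler_pdivrMl ?ltr0n ?fact_gt0//.
rewrite -exprSr mulrC; apply: le_trans h; by rewrite lerDr.
Qed.

Lemma flat_ge0 k x : 0 <= flat k x.
Proof.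
by rewrite /flat; case: ltP => // x0; rewrite mulr_ge0 ?expR_ge0// exprn_ge0// invr_ge0 ltW.
Qed.

Lemma flat_continuous0 k : {for 0, continuous (flat k)}.
Proof.
have f0 : flat k 0 = 0 by rewrite /flat ltxx.
rewrite /prop_for /continuous_at f0; apply/cvgr0Pnorm_le => e e0.
have M0 : 0 < (k.+1)`!%:R :> R by rewrite ltr0n fact_gt0.
near=> x; apply: (le_trans (flat_bound k x)).
rewrite -ler_pdivlMl//; near: x.
have : \forall x \near (0 : R), `|0 - x| < (k.+1)`!%:R^-1 * e.
  have := @cvgr_dist_lt _ _ _ (nbhs (0 : R)) _ id 0 (@cvg_id _ _).
  by apply; rewrite mulr_gt0// invr_gt0.
by apply: filterS => x; rewrite sub0r normrN; exact: ltW.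
Unshelve. all: by end_near. Qed.

Lemma flat_derive k (x : R) :
  is_derive x (1 : R) (flat k) (flat k.+2 x - k%:R * flat k.+1 x).
Proof.
have [x0|x0|->] := ltgtP x 0.
- have E : {near x, (cst 0 : R -> R) =1 flat k}.
    near=> y; rewrite /flat ltNge ltW//=; near: y; exact: lt_nbhsl.
  rewrite /flat !ltNge !(ltW x0)/= mulr0 subr0.
  exact: (@near_eq_is_derive _ _ _ (cst 0)).
- have E : {near x, (fun y => y^-1 ^+ k * expR (- y^-1)) =1 flat k}.
    near=> y; rewrite /flat ifT//; near: y; exact: lt_nbhsr.
  have x0' : x != 0 by rewrite gt_eqF.
  apply: (near_eq_is_derive E).
  pose q (y : R) := y ^+ k * expR (- y).
  have dN : derivable (fun y : R => - y) x^-1 1 by apply: derivableN; exact: derivable_id.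
  have [de De] := derive_comp dN (@derivable_expR R (- x^-1)).
  have dX : derivable (fun y : R => y ^+ k) x^-1 1 by exact: exprn_derivable.
  have dq : derivable q x^-1 1 := derivableM dX de.
  have dV : derivable (fun y : R => y^-1) x 1 := derivableV x0' (@derivable_id _ _ x 1).
  have [dc Dc] := derive_comp dV dq.
  split; first exact: dc.
  have Dexp (y : R) : 'D_1 expR y = expR y by exact: (congr1 (@^~ y) (@derive_expR R)).
  have DX : 'D_1 (fun y : R => y ^+ k) x^-1 = k%:R * x^-1 ^+ k.-1.
    by rewrite exp_derive [_ *: 1]mulr1.
  have DN : 'D_1 (fun y : R => - y) x^-1 = -1.
    by rewrite (deriveN (@derivable_id _ _ _ _)) derive_id.
  have DV : 'D_1 (fun y : R => y^-1) x = - x ^- 2.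
    by rewrite (deriveV x0' (@derivable_id _ _ _ _)) derive_id [_ *: 1]mulr1.
  have Dq : 'D_1 q x^-1 = x^-1 ^+ k * (expR (- x^-1) * - 1) +
      expR (- x^-1) * (k%:R * x^-1 ^+ k.-1).
    by rewrite (deriveM dX de) De Dexp DX DN.
  rewrite [LHS]Dc Dq DV /flat x0 -exprVn.
  case: (k) => [|k'] /=; rewrite !exprS ?expr0; ring.
- have -> : flat k.+2 0 - k%:R * flat k.+1 0 = 0 by rewrite /flat ltxx mulr0 subr0.
  have E : (fun h : R => h^-1 *: (((flat k) \o shift 0) (h *: 1) - flat k 0)) @ 0^' --> (0 : R).
    (* At 0 the difference quotient of [flat k] is exactly [flat k.+1], which is continuous there
       with value 0. *)
    rewrite (_ : (fun h : R => _) = flat k.+1).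
      have := @flat_continuous0 k.+1; rewrite /prop_for /continuous_at {2}/flat ltxx.
      by apply: cvg_trans; apply: cvg_app; exact: cvg_within.
    apply/funext => h /=; rewrite addr0 [_%:A]mulr1 {2}/flat ltxx subr0 /flat.
    case: ifP => h0; last by rewrite scaler0.
    by rewrite exprS -mulrA.
  apply: DeriveDef; first by apply/cvg_ex; exists 0.
  exact/cvg_lim.
Unshelve. all: by end_near. Qed.

Lemma Cn_flat n k : Cn n (flat k).
Proof.
have d k' x : derivable (flat k') x 1 by have [] := flat_derive k' x.
elim: n k => [|n IH] k.
  by move=> x; exact/differentiable_continuous/derivable1_diffP.
apply: Cn_derive1 => //.
rewrite (_ : derive1 _ = fun x => flat k.+2 x + (- k%:R) * flat k.+1 x).
  by apply: CnD => //; apply: CnM => //; exact: Cn_cst.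
by apply/funext => x; rewrite derive1E; have [_ ->] := flat_derive k x; rewrite mulNr.
Qed.

Definition step (x : R) : R := flat 0 x.

Lemma smooth_step : smooth step.
Proof. by move=> n; exact: Cn_flat. Qed.

Lemma step_le0 x : x <= 0 -> step x = 0.
Proof. by move=> x0; rewrite /step /flat ltNge x0. Qed.

Lemma step_gt0 x : 0 < x -> 0 < step x.
Proof. by move=> x0; rewrite /step /flat x0 expr0 mul1r expR_gt0. Qed.

Lemma step_ge0 x : 0 <= step x.
Proof. exact: flat_ge0. Qed.

Lemma step_le1 x : step x <= 1.
Proof.
rewrite /step /flat; case: ltP => // x0; rewrite expr0 mul1r expR_le1.
by rewrite oppr_le0 invr_ge0 ltW.
Qed.

(** Composed with a smooth [p], this gives smooth functions with values in [[0, 1]] that tend to the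
    indicator of the set where [p > 0]; all passages from test functions to indicators rest on
    it. *)
Lemma step_cvg (x : R) : step ((n.+1%:R : R) * x) @[n --> \oo] --> (if 0 < x then 1 else 0 : R).
Proof.
have [x0|x0] := leP x 0.
  apply: cvg_near_cst; near=> n; rewrite step_le0//.
  by rewrite mulr_ge0_le0.
have -> : (fun n => step (n.+1%:R * x)) = (fun n => expR (- (harmonic n * x^-1))).
  by apply/funext => n; rewrite /step /flat mulr_gt0// expr0 mul1r invfM.
rewrite -expR0 -oppr0 -(mul0r x^-1).
apply: (@cvg_comp _ _ _ (fun n => - (harmonic n * x^-1)) (@expR R)); last exact: continuous_expR.
by apply: cvgN; apply: cvgMl; exact: cvg_harmonic.
Unshelve. all: by end_near. Qed.

Lemma Cn_sincos n : Cn n (@sin R) /\ Cn n (@cos R).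
Proof.
elim: n => [|n [IHs IHc]]; first by split; [exact: continuous_sin|exact: continuous_cos].
split; apply: Cn_derive1.
- by move=> x; exact: derivable_sin.
- rewrite (_ : derive1 _ = cos)//; apply/funext => x; rewrite derive1E.
  by rewrite derive_val.
- by move=> x; exact: derivable_cos.
- rewrite (_ : derive1 _ = fun x => -1 * sin x); first by apply: CnM => //; exact: Cn_cst.
  by apply/funext => x; rewrite derive1E derive_val mulN1r.
Qed.

End smooth_calculus.

(** * The fundamental lemma of the calculus of variations *)

Lemma aeS d (X : measurableType d) (R : realType) (mu : {measure set X -> \bar R})
    (P Q : X -> Prop) : (forall x, P x -> Q x) ->
  (\forall x \ae mu, P x) -> \forall x \ae mu, Q x.
Proof. by move=> PQ; apply: filterS. Qed.

Lemma aeI d (X : measurableType d) (R : realType) (mu : {measure set X -> \bar R})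
    (P Q : X -> Prop) : (\forall x \ae mu, P x) -> (\forall x \ae mu, Q x) ->
  \forall x \ae mu, P x /\ Q x.
Proof. by move=> hP hQ; apply: filterI. Qed.

Lemma ae_forall_countable d (X : measurableType d) (R : realType)
    (mu : {measure set X -> \bar R}) (I : countType) (P : I -> X -> Prop) :
  (forall i, \forall x \ae mu, P i x) -> \forall x \ae mu, forall i, P i x.
Proof.
move=> H; pose Q n x := if unpickle n is Some i then P i x else True.
have : \forall x \ae mu, forall n, Q n x.
  apply: ae_foralln => n; rewrite /Q; case: unpickle => [i|]; first exact: H.
  exact: aeW.
by apply: filterS => x Qx i; have := Qx (pickle i); rewrite /Q pickleK.
Qed.

Lemma Rintegral_bounded_cvg d (X : measurableType d) (R : realType)
    (mu : {measure set X -> \bar R}) (D : set X) (K : X -> R)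
    (h_ : nat -> X -> R) (h : X -> R) :
  measurable D -> mu.-integrable D (EFin \o K) ->
  (forall n, measurable_fun D (h_ n)) -> (forall n x, D x -> `|h_ n x| <= 1) ->
  (forall x, D x -> h_ n x @[n --> \oo] --> h x) ->
  \int[mu]_(x in D) (K x * h_ n x) @[n --> \oo] --> \int[mu]_(x in D) (K x * h x).
Proof.
move=> mD iK mh hb hc.
have mK : measurable_fun D K by apply/measurable_EFinP; exact: measurable_int iK.
have mlim : measurable_fun D h by exact: measurable_fun_cvg hc.
have [] := @dominated_convergence _ _ _ mu D mD (fun n x => (K x * h_ n x)%:E)
  (fun x => (K x * h x)%:E) (fun x => `|(K x)%:E|%E).
- by move=> n; apply/measurable_EFinP; exact: measurable_funM.
- by apply/measurable_EFinP; exact: measurable_funM.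
- by apply: aeW => x Dx; apply: cvg_EFin; [exact: nearW|apply: cvgMr; exact: hc].
- exact: integrable_abse.
- apply: aeW => x n Dx /=; rewrite lee_fin normrM -[leRHS]mulr1 ler_wpM2l//; exact: hb.
move=> i1 _ cv; apply: fine_cvg; rewrite fineK//.
exact: integrable_fin_num.
Qed.

Lemma Rintegral_eq0 d (X : measurableType d) (R : realType)
    (mu : {measure set X -> \bar R}) (D : set X) (f : X -> R) :
  (forall x, D x -> f x = 0) -> \int[mu]_(x in D) f x = 0.
Proof. by move=> f0; rewrite /Rintegral integral0_eq// => x Dx; rewrite f0. Qed.

Section fundamental_lemma.
Variable R : realType.
Implicit Types (f g h F H K V : R -> R) (a b c d x y v : R).

(** Lebesgue differentiation on each half-line starting at [-n], collected over the countably many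
    [n]. *)
Lemma primitive_ae_derive H h : locint h -> primitive H h ->
  \forall x \ae @leb R, derivable H x 1 /\ derive1 H x = h x.
Proof.
move=> lh Hh.
have loc : locally_integrable [set: R] h.
  split; [|exact: openT|].
    have : forall n : nat, measurable_fun (`[- n%:R, n%:R]%classic : set R) h.
      by move=> n; apply/measurable_EFinP; exact: measurable_int (lh _ _).
    move=> mh; rewrite (_ : setT = \bigcup_n (`[- n%:R, n%:R]%classic : set R)).
      apply/measurable_fun_bigcup => // n; exact: mh.
    apply/seteqP; split => // x _; exists (Num.trunc `|x|).+1 => //=.
    rewrite in_itv/= -ler_norml ltW//; exact: Num.Theory.truncnS_gt.
  move=> K _ cK; have [M [_ HM]] := compact_bounded cK.
  have KM : K `<=` `[- (`|M| + 1), `|M| + 1].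
    move=> x Kx /=; rewrite in_itv/= -ler_norml; apply: HM => //.
    by rewrite (le_lt_trans (ler_norm _))// ltrDl.
  have mK : measurable K by apply: closed_measurable; exact: compact_closed.
  have lK := lh (- (`|M| + 1)) (`|M| + 1).
  have /integrableP[_] := @integrableS _ _ _ (@leb R) _ K (EFin \o h) (measurable_itv _) mK KM lK.
  by [].
have P (n : nat) : \forall x \ae @leb R, - n%:R < x -> derivable H x 1 /\ derive1 H x = h x.
  have := @FTC1 R h (BLeft (- n%:R)) (fun y => lh _ _) loc.
  apply: (@aeS _ _ _ (@leb R)) => x FTC nx.
  have [|dF eF] := FTC; first exact: nx.
  pose F x := \int[@leb R]_(t in `[- n%:R, x]%classic) h t.
  have E : {near x, (F + cst (H (- n%:R))) =1 H}.
    near=> y; rewrite /F /= fctE -Hh ?subrK//.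
    by apply: ltW; near: y; exact: lt_nbhsr.
  have dc := @derivable_cst _ _ _ (H (- n%:R)) x 1.
  split; first exact: (near_eq_derivable E (derivableD dF dc)).
  by rewrite derive1E -(near_eq_derive _ E) (deriveD dF dc) derive_cst addr0 -derive1E.
apply: aeS (ae_foralln P) => x /(_ (Num.trunc `|x|).+1); apply.
rewrite ltrNl; apply: le_lt_trans (Num.Theory.truncnS_gt _).
by rewrite -normrN ler_norm.
Unshelve. all: by end_near. Qed.

(** A primitive of [h] is constant on []c, d[], so its derivative, which is [h] almost everywhere,
    vanishes there. *)
Lemma locint_ae0 h c d : locint h ->
  (forall x y, c < x -> x < y -> y < d -> \int[@leb R]_(z in `[x, y]%classic) h z = 0) ->
  \forall x \ae @leb R, c < x < d -> h x = 0.
Proof.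
move=> lh h0; have [H Hh _] := primitive_exists 0 0 lh.
apply: aeS (primitive_ae_derive lh Hh) => x [dH <-] /andP[cx xd].
have E : {near x, cst (H x) =1 H}.
  near=> y; have cy : c < y by near: y; exact: lt_nbhsr.
  have yd : y < d by near: y; exact: lt_nbhsl.
  apply/esym; have [xy|yx|->//] := ltgtP x y; apply/eqP; rewrite -subr_eq0.
    by rewrite Hh ?h0// ltW.
  by rewrite -opprB oppr_eq0 Hh ?h0// ltW.
by rewrite derive1E -(near_eq_derive _ E) derive_cst.
Unshelve. all: by end_near. Qed.

Definition bump c d n x := step ((n.+1%:R : R) * ((x - c) * (d - x))).

Lemma smooth_bump c d n : smooth (bump c d n).
Proof.
apply: (smooth_comp (@smooth_step R)); apply: smoothM; first exact: smooth_cst.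
apply: smoothM; apply: smoothD.
- exact: smooth_id.
- exact: smooth_cst.
- exact: smooth_cst.
- rewrite (_ : -%R = fun x : R => -1 * x); last by apply/funext => x; rewrite mulN1r.
  by apply: smoothM; [exact: smooth_cst|exact: smooth_id].
Qed.

Lemma bump_supp c d n x : c < d -> bump c d n x != 0 -> c < x < d.
Proof.
move=> cd; apply: contraNT; rewrite negb_and -!leNgt => xcd.
rewrite /bump step_le0// mulr_ge0_le0//.
by case/orP : xcd => ?; nra.
Qed.

Lemma bump_ge0 c d n x : 0 <= bump c d n x.
Proof. exact: step_ge0. Qed.

Lemma bump_le1 c d n x : `|bump c d n x| <= 1.
Proof. by rewrite ger0_norm ?bump_ge0// step_le1. Qed.

Lemma bump_cvg c d x : c < d ->
  bump c d n x @[n --> \oo] --> (if c < x < d then 1 else 0 : R).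
Proof.
move=> cd; have := @step_cvg R ((x - c) * (d - x)); rewrite /bump.
suff -> : (0 < (x - c) * (d - x)) = (c < x < d) by [].
apply/idP/idP => [|/andP[? ?]]; last by rewrite mulr_gt0// subr_gt0.
by move=> h; apply/andP; split; nra.
Qed.

Lemma derive1_supp (phi : R -> R) c d x : (forall v, phi v != 0 -> c <= v <= d) ->
  ~~ (c <= x <= d) -> derive1 phi x = 0.
Proof.
move=> sp ncd; have E : {near x, cst 0 =1 phi}.
  have : \forall y \near x, ~~ (c <= y <= d).
    move: ncd; rewrite negb_and -!ltNge => /orP[xc|dx]; near=> y.
      by rewrite negb_and -!ltNge; apply/orP; left; near: y; exact: lt_nbhsl.
    by rewrite negb_and -!ltNge; apply/orP; right; near: y; exact: lt_nbhsr.
  by apply: filterS => y; apply: contraNeq; rewrite eq_sym; exact: sp.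
by rewrite derive1E -(near_eq_derive _ E) derive_cst.
Unshelve. all: by end_near. Qed.

Lemma integral_supp (I : interval R) f c d : c \in I -> d \in I ->
  (forall v, f v != 0 -> c <= v <= d) ->
  (\int[@leb R]_(v in [set` I]) (f v)%:E = \int[@leb R]_(v in `[c, d]%classic) (f v)%:E)%E.
Proof.
move=> cI dI sf; rewrite [LHS]integral_mkcond [RHS]integral_mkcond; congr integral.
apply/funext => v; rewrite !patchE.
have cdI : c <= v <= d -> v \in I.
  by move=> /andP[cv vd]; apply: (@interval_is_interval _ I c d) => //; rewrite cv vd.
case: ifPn; case: ifPn; rewrite ?inE/= ?in_itv//= => h1 h2.
  have [->//|/sf] := eqVneq (f v) 0.
  by move=> h; exfalso; move: h1; rewrite notin_setE/= in_itv/=.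
by exfalso; move: h2; rewrite notin_setE/=; apply; exact: cdI.
Qed.



Lemma Rintegral_supp (f : R -> R) C D c d : C <= c -> d <= D -> c <= d ->
  (forall v, f v != 0 -> c <= v <= d) ->
  \int[@leb R]_(v in `[C, D]%classic) f v = \int[@leb R]_(v in `[c, d]%classic) f v.
Proof.
move=> Cc dD cd sf; rewrite /Rintegral; congr fine; apply: (@integral_supp `[C, D]) => //.
  by rewrite in_itv /= Cc (le_trans cd dD).
by rewrite in_itv /= dD (le_trans Cc cd).
Qed.

Lemma weak_deriv_Rintegral (I : interval R) g h (phi : R -> R) c d :
  weak_deriv I g h -> smooth phi -> c \in I -> d \in I ->
  (forall v, phi v != 0 -> c <= v <= d) ->
  \int[@leb R]_(v in `[c, d]%classic) (g v * derive1 phi v) =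
  - \int[@leb R]_(v in `[c, d]%classic) (h v * phi v).
Proof.
move=> gh sphi cI dI sp; have := gh phi sphi (ex_intro _ c (ex_intro _ d (And3 cI dI sp))).
rewrite (@integral_supp _ _ c d)//; last first.
  move=> v; apply: contraNT => /(derive1_supp sp) ->; by rewrite mulr0.
rewrite (@integral_supp _ (fun v => h v * phi v) c d)//; last first.
  by move=> v hv; apply: sp; apply: contraNneq hv => ->; rewrite mulr0.
by rewrite /Rintegral => ->; rewrite fineN.
Qed.

Lemma bump_continuous c d n : continuous (bump c d n).
Proof. exact/smooth_continuous/smooth_bump. Qed.

(** If the integral were 0, the nondecreasing primitive would be constant on []c, d[] and the bump
    would vanish at the midpoint. *)
Lemma bump_integral_gt0 c d : c < d -> 0 < \int[@leb R]_(v in `[c, d]%classic) bump c d 0 v.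
Proof.
move=> cd; have lb := locint_continuous (@bump_continuous c d 0).
have [B Bb _] := primitive_exists 0 0 lb.
rewrite lt_neqAle Rintegral_ge0 ?andbT; last by move=> x _; exact: bump_ge0.
rewrite -Bb ?ltW//; apply/eqP => /esym B0.
pose m := (c + d) / 2.
have cm : c < m by rewrite /m; lra.
have md : m < d by rewrite /m; lra.
have mono x y : x <= y -> B x <= B y.
  by move=> xy; rewrite -subr_ge0 Bb// Rintegral_ge0// => z _; exact: bump_ge0.
have E : {near m, cst (B m) =1 B}.
  near=> y; have cy : c < y by near: y; exact: lt_nbhsr.
  have yd : y < d by near: y; exact: lt_nbhsl.
  have := mono _ _ (ltW cy); have := mono _ _ (ltW yd).
  have := mono _ _ (ltW cm); have := mono _ _ (ltW md); rewrite /=; lra.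
have [_] := derive_primitive m (@bump_continuous c d 0) Bb.
rewrite derive1E -(near_eq_derive _ E) derive_cst => /esym/eqP; apply/negP.
by rewrite gt_eqF// /bump step_gt0// mulr_gt0// mulr_gt0// subr_gt0.
Unshelve. all: by end_near. Qed.

Lemma locint_oo f c d : (@leb R).-integrable `[c, d]%classic (EFin \o f) ->
  \int[@leb R]_(v in `[c, d]%classic) f v = \int[@leb R]_(v in `]c, d[%classic) f v.
Proof.
move=> fi; transitivity (\int[@leb R]_(v in `]c, d]%classic) f v).
  apply/esym; apply: Rintegral_itv_obnd_cbnd.
  by apply: integrableS fi => //; exact: subset_itv_oc_cc.
apply/esym; apply: Rintegral_itv_bndo_bndc.
by apply: integrableS fi => //; exact: subset_itv_oo_cc.
Qed.

Lemma Rintegral_bump_lim K c d C D : locint K -> c < d -> C <= c -> d <= D ->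
  \int[@leb R]_(v in `[C, D]%classic) (K v * bump c d n v) @[n --> \oo] -->
  \int[@leb R]_(v in `[c, d]%classic) K v.
Proof.
move=> lK cd Cc dD.
have -> : \int[@leb R]_(v in `[c, d]%classic) K v =
    \int[@leb R]_(v in `[C, D]%classic) (K v * (if c < v < d then 1 else 0)).
  rewrite locint_oo; last exact: lK.
  have -> : (`]c, d[%classic : set R) = `[C, D]%classic `&` `]c, d[%classic.
    rewrite setIidr// => v /=; rewrite !in_itv/= => /andP[cv vd].
    by rewrite (le_trans Cc (ltW cv)) (le_trans (ltW vd) dD).
  rewrite Rintegral_mkcondr; apply: eq_Rintegral => v _; rewrite patchE.
  by rewrite mem_setE in_itv/=; case: ifP; rewrite ?mulr1 ?mulr0.
have := @Rintegral_bounded_cvg _ _ _ (@leb R) `[C, D]%classic K (bump c d)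
  (fun v => if c < v < d then 1 else 0) (measurable_itv _) (lK C D).
apply.
- by move=> n; apply: measurable_funTS; apply: continuous_measurable_fun; exact: bump_continuous.
- by move=> n x _; exact: bump_le1.
- by move=> x _; exact: bump_cvg.
Qed.

Definition open_itv (I : interval R) := forall v, v \in I ->
  exists c d, [/\ c < v, v < d, c \in I & d \in I].

(** The du Bois-Reymond lemma: [g - V0] has zero weak derivative, hence is constant. A bump is the
    derivative of a test function only if its mean is 0, so every bump [a] is corrected by a
    multiple of one fixed bump [b]. *)
Lemma weak_deriv_primitive (I : interval R) g h : open_itv I -> locint g -> locint h ->
  weak_deriv I g h ->
  exists2 V, primitive V h & \forall v \ae @leb R, v \in I -> g v = V v.
Proof.
move=> oI lg lh gh.
have [V0 V0h _] := primitive_exists 0 0 lh.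
have [[v0 v0I]|nI] := pselect (exists v0, v0 \in I); last first.
  by exists V0 => //; apply: aeW => v vI; exfalso; apply: nI; exists v.
have [p [q [pv vq pI qI]]] := oI v0 v0I.
have pq : p < q by exact: lt_trans vq.
have lV0 := locint_continuous (primitive_continuous lh V0h).
pose K v := g v + -1 * V0 v.
have lK : locint K by apply: locintD => //; exact: locintZ.
pose b := bump p q 0.
pose mb := \int[@leb R]_(v in `[p, q]%classic) b v.
have mb0 : 0 < mb by exact: bump_integral_gt0.
have cb : continuous b by exact: bump_continuous.
have sb v : b v != 0 -> p < v < q by exact: bump_supp.
(* The only possible value of the constant [g - V0]: its mean against the fixed bump [b]. *)
pose k := (\int[@leb R]_(v in `[p, q]%classic) (b v * K v)) / mb.
have l1 : locint (cst (1 : R)) by apply: locint_continuous => x; exact: cvg_cst.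
pose L v := K v + - k * 1.
have lL : locint L by apply: locintD => //; exact: locintZ.
have key c d : c < d -> c \in I -> d \in I -> \int[@leb R]_(v in `[c, d]%classic) L v = 0.
  move=> cd cI dI.
  pose C := Num.min c p; pose D := Num.max d q.
  have CI : C \in I by rewrite /C; case: leP.
  have DI : D \in I by rewrite /D; case: leP.
  have Cc : C <= c by rewrite /C ge_min lexx.
  have Cp : C <= p by rewrite /C ge_min lexx orbT.
  have dD : d <= D by rewrite /D le_max lexx.
  have qD : q <= D by rewrite /D le_max lexx orbT.
  have CD : C <= D by lra.
  have mCD : measurable (`[C, D]%classic : set (measurableTypeR R)) by exact: measurable_itv.
  have lim := Rintegral_bump_lim lL cd Cc dD.
  suff lim0 n : \int[@leb R]_(v in `[C, D]%classic) (L v * bump c d n v) = 0.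
    rewrite -(cvg_lim (@Rhausdorff R) lim).
    rewrite (_ : (fun n => _) = fun=> 0); last by apply/funext => n; exact: lim0.
    exact: (@lim_cst _ (@Rhausdorff R) _ \oo).
  pose a := bump c d n.
  have ca : continuous a by exact: bump_continuous.
  have sa v : a v != 0 -> c < v < d by exact: bump_supp.
  have la := locint_continuous ca; have lb := locint_continuous cb.
  pose m := \int[@leb R]_(v in `[C, D]%classic) a v.
  (* The coefficient gives [f] zero integral, so its primitive [phi] vanishes outside [[C, D]] and
     is an admissible test function. *)
  pose f v := a v + - (m / mb) * b v.
  have sf : smooth f.
    apply: smoothD; first exact: smooth_bump.
    by apply: smoothM; [exact: smooth_cst|exact: smooth_bump].
  have lf := locint_continuous (smooth_continuous sf).
  have [phi phif phiC] := primitive_exists C 0 lf.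
  have f0 v : (v <= C) || (D <= v) -> f v = 0.
    move=> vCD; rewrite /f.
    have -> : a v = 0.
      by apply: contraTeq vCD => /sa /andP[? ?]; rewrite negb_or -!ltNge; lra.
    have -> : b v = 0.
      by apply: contraTeq vCD => /sb /andP[? ?]; rewrite negb_or -!ltNge; lra.
    by rewrite mulr0 addr0.
  have phiD : phi D = 0.
    have := phif C D CD; rewrite phiC subr0 => ->.
    rewrite /f (RintegralD mCD (la C D) (locintZ _ lb C D)).
    rewrite (RintegralZl _ mCD (lb C D)) -/m.
    rewrite [X in _ * X](@Rintegral_supp _ C D p q) ?(ltW pq)//; last first.
      by move=> v /sb /andP[/ltW -> /ltW ->].
    by rewrite -/mb mulNr divfK ?subrr// gt_eqF.
  have sphi v : phi v != 0 -> C <= v <= D.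
    apply: contraNT; rewrite negb_and -!ltNge => /orP[vC|Dv].
      have := phif v C (ltW vC); rewrite phiC sub0r => /eqP.
      rewrite eqr_oppLR => /eqP ->; apply/eqP/eqP; rewrite oppr_eq0.
      apply/eqP/Rintegral_eq0 => x /=.
      by rewrite in_itv/= => /andP[_ xC]; rewrite f0// xC.
    have := phif D v (ltW Dv); rewrite phiD subr0 => ->.
    apply/eqP/Rintegral_eq0 => x /=.
    by rewrite in_itv/= => /andP[xC _]; rewrite f0// xC orbT.
  have dphi : derive1 phi = f.
    by apply/funext => x; have [] := derive_primitive x (smooth_continuous sf) phif.
  have smphi := smooth_primitive sf phif.
  have := weak_deriv_Rintegral gh smphi CI DI sphi; rewrite dphi.
  have := primitiveM lh lf V0h phif CD; rewrite phiC phiD !mulr0 subrr.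
  have cphi := smooth_continuous smphi.
  have cV0 := primitive_continuous lh V0h.
  have cf := smooth_continuous sf.
  have lhphi : locint (fun v => h v * phi v).
    by under eq_fun do rewrite mulrC; exact: locintM.
  have lVf : locint (fun v => V0 v * f v) by exact: locintM.
  have lgf : locint (fun v => g v * f v) by under eq_fun do rewrite mulrC; exact: locintM.
  have lKa : locint (fun v => a v * K v) by exact: locintM.
  have lKb : locint (fun v => b v * K v) by exact: locintM.
  rewrite (RintegralD mCD (lhphi C D) (lVf C D)) => E1 E2.
  have E3 : \int[@leb R]_(v in `[C, D]%classic) (g v * f v + -1 * (V0 v * f v)) = 0.
    rewrite (RintegralD mCD (lgf C D) (locintZ (-1) lVf C D)) (RintegralZl _ mCD (lVf C D)).
    rewrite E2; lra.
  have E4 : \int[@leb R]_(v in `[C, D]%classic) (b v * K v) = mb * k.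
    rewrite mulrC /k divfK ?gt_eqF//; apply: Rintegral_supp => //; first exact: ltW.
    move=> v hv; have /sb/andP[? ?] : b v != 0 by apply: contraNneq hv => ->; rewrite mul0r.
    lra.
  have E5 : \int[@leb R]_(v in `[C, D]%classic) (a v * K v + - (m / mb) * (b v * K v)) = 0.
    rewrite -[RHS]E3; apply: eq_Rintegral => v _; rewrite /f /K; ring.
  have E6 : \int[@leb R]_(v in `[C, D]%classic) (a v * K v) = m * k.
    move: E5; rewrite (RintegralD mCD (lKa C D) (locintZ _ lKb C D)).
    rewrite (RintegralZl _ mCD (lKb C D)) E4 mulNr => /eqP.
    rewrite subr_eq0 => /eqP ->; field; by rewrite gt_eqF.
  transitivity (\int[@leb R]_(v in `[C, D]%classic) (a v * K v + - k * a v)).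
    by apply: eq_Rintegral => v _; rewrite /L -/a; ring.
  rewrite (RintegralD mCD (lKa C D) (locintZ _ la C D)) (RintegralZl _ mCD (la C D)) E6 -/m.
  by ring.
exists (fun v => V0 v + k * 1).
  by move=> x y xy; rewrite opprD addrACA subrr addr0; exact: V0h.
(* Subintervals with rational ends cover the open [I], and only countably many null sets are
   joined. *)
have : forall r : rat * rat, \forall v \ae @leb R, ratr r.1 \in I -> ratr r.2 \in I ->
    ratr r.1 < v < ratr r.2 -> L v = 0.
  move=> [r1 r2] /=.
  have [r1I|r1I] := boolP (ratr r1 \in I); last by apply: aeW.
  have [r2I|r2I] := boolP (ratr r2 \in I); last by apply: aeW.
  apply: aeS (@locint_ae0 L (ratr r1) (ratr r2) lL _); first by move=> x h1 _ _; exact: h1.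
  move=> x y r1x xy yr2; apply: key => //.
    apply: (@interval_is_interval _ I _ _ r1I r2I); lra.
  apply: (@interval_is_interval _ I _ _ r1I r2I); lra.
move=> /ae_forall_countable; apply: aeS => v Hv vI.
have [c [d [cv vd cI dI]]] := oI v vI.
have [r1] := rat_in_itvoo cv; rewrite in_itv/= => /andP[cr1 r1v].
have [r2] := rat_in_itvoo vd; rewrite in_itv/= => /andP[vr2 r2d].
have := Hv (r1, r2); rewrite /= r1v vr2 => /(_ _ _ isT).
rewrite /L /K => H; suff: g v + -1 * V0 v + - k * 1 = 0 by lra.
apply: H; apply: (@interval_is_interval _ I _ _ cI dI); lra.
Qed.
End fundamental_lemma.

(** * Product measures and the torus *)

Section product_ae.
Context d1 d2 (X : measurableType d1) (Y : measurableType d2) (R : realType).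
Variables (m1 : {sigma_finite_measure set X -> \bar R})
  (m2 : {sigma_finite_measure set Y -> \bar R}).

Lemma ae_eq0_integral d (Z : measurableType d) (mu : {measure set Z -> \bar R})
    (F : Z -> \bar R) :
  measurable_fun setT F -> (forall z, 0 <= F z)%E ->
  (\int[mu]_z F z = 0)%E <-> \forall z \ae mu, F z = 0%E.
Proof.
move=> mF F0; have := ae_eq_integral_abs mu measurableT mF.
rewrite (eq_integral F) => [H|z _]; last by rewrite gee0_abs.
split => [/H|H1]; first by apply: aeS => z; exact.
by apply/H; apply: aeS H1 => z.
Qed.

Lemma ae_prod (P : X * Y -> Prop) :
  (\forall z \ae (m1 \x m2)%E, P z) -> \forall x \ae m1, \forall y \ae m2, P (x, y).
Proof.
move=> [N [mN N0 PN]].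
have mx := measurable_fun_xsection m2 mN.
have : (\int[m1]_x (m2 \o xsection N) x = 0)%E by exact: N0.
move=> /(ae_eq0_integral _ mx (fun x => measure_ge0 m2 _)); apply: aeS => x /= Nx.
exists (xsection N x); split => //; first exact: measurable_xsection.
by move=> y nP; rewrite /xsection /= inE; exact: PN.
Qed.

Lemma ae_prod_swap (P : X * Y -> Prop) :
  (\forall z \ae (m1 \x m2)%E, P z) -> \forall y \ae m2, \forall x \ae m1, P (x, y).
Proof.
move=> [N [mN N0 PN]].
have my := measurable_fun_ysection m1 mN.
have : (\int[m2]_y (m1 \o ysection N) y = 0)%E.
  have mI : measurable_fun setT (EFin \o (\1_N : X * Y -> R)).
    by apply/measurable_EFinP; exact: measurable_indic.
  have I0 z : (0 <= (EFin \o (\1_N : X * Y -> R)) z)%E by rewrite lee_fin.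
  have := @fubini_tonelli2 _ _ _ _ _ m1 m2 _ mI I0.
  rewrite integral_indic// setIT => E.
  rewrite -[RHS](_ : product_measure1 m1 m2 N = 0%E)// [RHS]E; apply: eq_integral => y _ /=; rewrite /fubini_G /=.
  rewrite -[in LHS](setIT (ysection N y)) -integral_indic//; last exact: measurable_ysection.
  by apply: eq_integral => x _; rewrite /= !indicE mem_ysection.
move=> /(ae_eq0_integral _ my (fun x => measure_ge0 m1 _)); apply: aeS => y /= Ny.
exists (ysection N y); split => //; first exact: measurable_ysection.
by move=> x nP; rewrite /ysection /= inE; exact: PN.
Qed.

(** A converse to [ae_prod] needs joint measurability, hence the form with the zero set of a
    nonnegative measurable function, to which Tonelli applies. *)
Lemma ae_prod_inv (F : X * Y -> \bar R) : measurable_fun setT F -> (forall z, 0 <= F z)%E ->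
  (\forall x \ae m1, \forall y \ae m2, F (x, y) = 0%E) -> \forall z \ae (m1 \x m2)%E, F z = 0%E.
Proof.
move=> mF F0 H; apply/ae_eq0_integral => //.
rewrite fubini_tonelli1//; apply/ae_eq0_integral.
- exact: measurable_fun_fubini_tonelli_F.
- by move=> x; exact: integral_ge0.
apply: aeS H => x Hx; apply/ae_eq0_integral => //.
exact: measurableT_comp.
Qed.

(** Carries Fubini from extended to real integrals: an integrable function is finite almost
    everywhere, so [fine] does not change its integral. *)
Lemma Rintegrable_fine d (Z : measurableType d) (mu : {measure set Z -> \bar R})
    (F : Z -> \bar R) : mu.-integrable setT F ->
  mu.-integrable setT (EFin \o (fine \o F)) /\
  \int[mu]_z fine (F z) = fine (\int[mu]_z F z).
Proof.
move=> iF; have mF := measurable_int _ iF.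
have mfF : measurable_fun setT (EFin \o (fine \o F)).
  by apply/measurable_EFinP; exact: (measurableT_comp (fine_measurable measurableT) mF).
split.
  apply: (le_integrable measurableT mfF _ iF) => z _ /=.
  by case: (F z) => [r| |]//=; rewrite normr0 leey.
rewrite /Rintegral; congr fine; apply: ae_eq_integral => //.
by apply: aeS (integrable_ae measurableT iF) => z /(_ I) Fz _; rewrite /= fineK.
Qed.

Variable f : X * Y -> R.
Hypothesis intf : (m1 \x m2)%E.-integrable setT (EFin \o f).

Lemma Rfubini_ae1 : \forall x \ae m1, m2.-integrable setT (EFin \o (fun y => f (x, y))).
Proof. exact: ae_integrable1 intf. Qed.

Lemma Rfubini_ae2 : \forall y \ae m2, m1.-integrable setT (EFin \o (fun x => f (x, y))).
Proof. exact: ae_integrable2 intf. Qed.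

Lemma Rfubini_integrable1 : m1.-integrable setT (EFin \o (fun x => \int[m2]_y f (x, y))).
Proof. by have [] := Rintegrable_fine (integrable_fubini_F intf). Qed.

Lemma integrable_fubini_G : m2.-integrable setT (fubini_G m1 (EFin \o f)).
Proof.
have mf := measurable_int _ intf.
apply/integrableP; split; first exact: (measurable_fubini_G intf).
have := (@integrable21ltyP _ _ _ _ _ m1 m2 _ mf).1 intf; apply: le_lt_trans.
have mabs : measurable_fun setT (abse \o (EFin \o f)) by exact: measurableT_comp.
apply: ge0_le_integral => //.
- by apply: measurableT_comp => //; exact: (measurable_fubini_G intf).
- by apply: (measurable_fun_fubini_tonelli_G _ mabs) => z; exact: abse_ge0.
- move=> y _; apply: le_abse_integral => //.
  exact: (measurable_fun_pair1 y mf).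
Qed.

Lemma Rfubini_integrable2 : m2.-integrable setT (EFin \o (fun y => \int[m1]_x f (x, y))).
Proof. by have [] := Rintegrable_fine integrable_fubini_G. Qed.

Lemma Rfubini1 : \int[m1]_x \int[m2]_y f (x, y) = \int[(m1 \x m2)%E]_z f z.
Proof.
have [_] := Rintegrable_fine (integrable_fubini_F intf).
by rewrite (integral12_prod_meas1 intf).
Qed.

Lemma Rfubini2 : \int[m2]_y \int[m1]_x f (x, y) = \int[(m1 \x m2)%E]_z f z.
Proof.
have [_] := Rintegrable_fine integrable_fubini_G.
by rewrite (integral21_prod_meas1 intf).
Qed.

End product_ae.

Section torus.
Variable R : realType.
Local Notation mR := (measurableTypeR R).

Definition frac (x : R) : R := x - (Num.floor x)%:~R.

Lemma frac_itv x : 0 <= frac x < 1.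
Proof.
rewrite /frac subr_ge0 Num.Theory.floor_le /= ltrBlDr addrC.
by have := Num.Theory.floorD1_gt x; rewrite intrD.
Qed.

Lemma frac_id x : 0 <= x < 1 -> frac x = x.
Proof.
move=> /andP[x0 x1]; rewrite /frac (_ : Num.floor x = 0) ?subr0//.
by apply: Num.Theory.floor_def; rewrite x0 add0r.
Qed.

Lemma frac_eq y (k : int) : 0 <= y < 1 -> frac (y + k%:~R) = y.
Proof.
move=> /andP[y0 y1]; rewrite /frac (_ : Num.floor _ = k) ?addrK//.
by apply: Num.Theory.floor_def; rewrite intrD; lra.
Qed.

Lemma fracDz x (k : int) : frac (x + k%:~R) = frac x.
Proof.
have {1}-> : x = frac x + (Num.floor x)%:~R by rewrite /frac subrK.
by rewrite -addrA -intrD frac_eq// frac_itv.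
Qed.

Lemma measurable_frac : measurable_fun setT (frac : mR -> mR).
Proof.
have H (k : int) : measurable_fun (`[k%:~R, k%:~R + 1[%classic : set mR) (frac : mR -> mR).
  apply: (@eq_measurable_fun _ _ _ _ _ (fun x : mR => x - k%:~R)).
    move=> x; rewrite inE/= in_itv/= => kx.
    rewrite -[x in RHS](subrK (k%:~R : R)) frac_eq//; lra.
  by apply: measurable_funTS; apply: measurable_funB => //; exact: measurable_cst.
rewrite (_ : setT = \bigcup_(n : nat)
  ((`[n%:R, n%:R + 1[%classic : set mR) `|` `[(- (n : int))%:~R, (- (n : int))%:~R + 1[%classic)).
  apply/measurable_fun_bigcup => n; first exact: measurableU.
  apply/measurable_funU => //; split; first exact: (H (n : int)).
  exact: (H (- (n : int))).
apply/seteqP; split => // x _; exists `|Num.floor x|%N => //.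
have := frac_itv x; rewrite /frac => fx.
case: (lerP 0 (Num.floor x)) => k0.
  by left; rewrite /= in_itv/= pmulrn gez0_abs//; lra.
right; rewrite /= in_itv/= (_ : - (`|Num.floor x|%N : int) = Num.floor x); first by lra.
by rewrite lez0_abs ?opprK// ltW.
Qed.

(** Lebesgue measure is determined by its values on half-open intervals, and the translated measure
    has the same ones. *)
Lemma leb_shift (s : R) (A : set mR) : measurable A ->
  (leb R A = leb R ((fun x => x + s)%R @^-1` A))%E.
Proof.
move=> mA.
have ms : measurable_fun setT (fun x : mR => x + s : mR).
  by apply: measurable_funD => //; exact: measurable_cst.
have H := @lebesgue_measure_unique R (pushforward (@leb R) (fun x : mR => x + s : mR)).
apply: H mA => X [[a b] /= _ <-].
rewrite /pushforward.
rewrite (_ : _ @^-1` _ = `]a - s, b - s]%classic); last first.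
  by apply/seteqP; split => x /=; rewrite !in_itv/= ltrBlDr lerBrDr.
rewrite lebesgue_measure_itv/= [RHS](@lebesgue_measure_itv R `]a - s, b - s])/=.
rewrite !lte_fin ltrD2r; case: ifP => // _; rewrite -!EFinD; congr EFin; ring.
Qed.

Lemma ge0_integral_shift (h : mR -> \bar R) s : measurable_fun setT h ->
  (forall x, 0 <= h x)%E ->
  (\int[@leb R]_x h (x + s)%R = \int[@leb R]_x h x)%E.
Proof.
move=> mh h0.
have ms : measurable_fun setT (fun x : mR => x + s : mR).
  by apply: measurable_funD => //; exact: measurable_cst.
have := @ge0_integral_pushforward _ _ _ _ R _ ms (@leb R) setT h measurableT mh (fun y _ => h0 y).
rewrite preimage_setT => <-; apply: eq_measure_integral => A mA _.
exact/esym/leb_shift.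
Qed.

Lemma measurable_mem_itv (i : interval R) : measurable_fun setT (fun x : mR => x \in i).
Proof.
apply: (measurable_fun_bool true); rewrite setTI.
by rewrite (_ : _ @^-1` _ = [set` i])//; exact: measurable_itv.
Qed.

Definition T1 (x : R) := 0 <= x < 1.

Lemma measurable_T1 : measurable_fun setT (T1 : mR -> bool).
Proof.
exact: (@measurable_mem_itv `[0, 1[).
Qed.

(** Rotations preserve the measure of the torus: translation modulo 1 cuts [[0, 1[] into two pieces,
    moved by [sg] and by [sg - 1], which land on [[sg, 1[] and [[0, sg[]. *)
Lemma ge0_integral_frac (h : mR -> \bar R) s : measurable_fun setT h ->
  (forall x, 0 <= h x)%E ->
  (\int[@leb R]_x (if T1 x then h (frac (x + s)) else 0) =
   \int[@leb R]_x (if T1 x then h x else 0))%E.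
Proof.
move=> mh h0.
have [s1 s2] := andP (frac_itv s).
set sg := frac s in s1 s2 *.
have E x : frac (x + s) = frac (x + sg).
  by rewrite -(fracDz (x + sg) (Num.floor s)) -addrA /sg /frac subrK.
have N1 (x : R) : x + sg + (-1)%:~R = x + (sg - 1) by rewrite mulrN1z -addrA.
pose g1 (x : mR) : \bar R := (if (0 <= x) && (x + sg < 1) then h (x + sg)%R else 0%E).
pose g2 (x : mR) : \bar R := (if (x < 1) && (1 <= x + sg) then h (x + (sg - 1))%R else 0%E).
have mx (c : R) : measurable_fun setT (fun x : mR => x + c : mR).
  by apply: measurable_funD => //; exact: measurable_cst.
have mg1 : measurable_fun setT g1.
  apply: measurable_fun_ifT; last exact: measurable_cst.
    have := @measurable_mem_itv `[0, 1 - sg[; congr measurable_fun.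
    by apply/funext => x; rewrite in_itv/= ltrBrDr.
  exact: (measurableT_comp mh (mx sg)).
have mg2 : measurable_fun setT g2.
  apply: measurable_fun_ifT; last exact: measurable_cst.
    have := @measurable_mem_itv `[1 - sg, 1[; congr measurable_fun.
    by apply/funext => x; rewrite in_itv/= lerBlDr andbC.
  exact: (measurableT_comp mh (mx (sg - 1))).
have g10 x : (0 <= g1 x)%E by rewrite /g1; case: ifP.
have g20 x : (0 <= g2 x)%E by rewrite /g2; case: ifP.
transitivity (\int[@leb R]_x (g1 x + g2 x))%E.
  apply: eq_integral => x _; rewrite /T1 E /g1 /g2.
  case: (lerP 0 x) => x0 /=; case: (ltrP x 1) => x1 /=.
  - case: (ltrP (x + sg) 1) => xs /=; rewrite ?adde0 ?add0e.
      by rewrite frac_id// xs andbT addr_ge0.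
    rewrite -(fracDz (x + sg) (-1)) frac_id; last by rewrite mulrN1z; lra.
    by rewrite N1.
  - by rewrite adde0; case: ltrP => // xs; exfalso; lra.
  - by rewrite add0e; case: lerP => // xs; exfalso; lra.
  - by rewrite adde0.
rewrite ge0_integralD//.
pose k1 (y : mR) : \bar R := (if (sg <= y) && (y < 1) then h y else 0%E).
pose k2 (y : mR) : \bar R := (if (0 <= y) && (y < sg) then h y else 0%E).
have mk1 : measurable_fun setT k1.
  apply: measurable_fun_ifT => //.
  exact: (@measurable_mem_itv `[sg, 1[).
have mk2 : measurable_fun setT k2.
  apply: measurable_fun_ifT => //.
  exact: (@measurable_mem_itv `[0, sg[).
have k10 x : (0 <= k1 x)%E by rewrite /k1; case: ifP.
have k20 x : (0 <= k2 x)%E by rewrite /k2; case: ifP.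
rewrite (_ : (\int[@leb R]_x g1 x = \int[@leb R]_x k1 x)%E); last first.
  rewrite -[RHS](ge0_integral_shift sg mk1 k10); apply: eq_integral => x _.
  by rewrite /g1 /k1 lerDr.
rewrite (_ : (\int[@leb R]_x g2 x = \int[@leb R]_x k2 x)%E); last first.
  rewrite -[RHS](ge0_integral_shift (sg - 1) mk2 k20); apply: eq_integral => x _.
  rewrite /g2 /k2; have -> : (0 <= x + (sg - 1)) && (x + (sg - 1) < sg) = (x < 1) && (1 <= x + sg) by apply/andP/andP => -[? ?]; split; lra.
  by [].
rewrite -ge0_integralD//; apply: eq_integral => x _; rewrite /k1 /k2 /T1.
case: (lerP 0 x) => x0 /=; case: (ltrP x sg) => xs /=; rewrite ?add0e ?adde0//.
  by rewrite (lt_trans xs s2).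
by move: (lt_le_trans x0 s1); rewrite ltNge xs.
Qed.

(* For fixed time [k] the characteristics of [d/dt + v d/dx] act on the torus by
   the shear [(y, v) |-> (y + k v, v)], which preserves the measure. *)
Definition shear (k : R) (q : R * R) : R * R := (frac (q.1 + k * q.2), q.2).

Lemma measurable_shear k :
  measurable_fun (T := (mR * mR)%type) (U := (mR * mR)%type) setT (shear k).
Proof.
apply/measurable_fun_pairP; split; last exact: measurable_snd.
apply: (measurableT_comp measurable_frac).
apply: measurable_funD; first exact: measurable_fst.
by apply: measurable_funM => //; exact: measurable_cst.
Qed.

(** For each fixed [v] the shear is the rotation by [k v] of the torus. *)
Lemma ge0_integral_shear (k : R) (h : mR * mR -> \bar R) : measurable_fun setT h ->
  (forall x, 0 <= h x)%E ->
  (\int[@leb2 R]_q (if T1 q.1 then h (shear k q) else 0) =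
   \int[@leb2 R]_q (if T1 q.1 then h q else 0))%E.
Proof.
move=> mh h0.
have mT : measurable_fun (T := (mR * mR)%type) setT (fun q => T1 q.1).
  by apply: (measurableT_comp measurable_T1); exact: measurable_fst.
have mL : measurable_fun (T := (mR * mR)%type) setT
    (fun q => if T1 q.1 then h (shear k q) else 0)%E.
  apply: measurable_fun_ifT => //.
  exact: (measurableT_comp mh (measurable_shear k)).
have mRh : measurable_fun (T := (mR * mR)%type) setT
    (fun q => if T1 q.1 then h q else 0)%E.
  by apply: measurable_fun_ifT.
have L0 q : (0 <= if T1 q.1 then h (shear k q) else 0)%E by case: ifP.
have R0 q : (0 <= if T1 q.1 then h q else 0)%E by case: ifP.
rewrite [LHS](@fubini_tonelli2 _ _ _ _ _ (@leb R) (@leb R) _ mL L0).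
rewrite [RHS](@fubini_tonelli2 _ _ _ _ _ (@leb R) (@leb R) _ mRh R0).
apply: eq_integral => v _; rewrite /fubini_G /=.
apply: (@ge0_integral_frac (fun x => h (x, v)) (k * v)) => //.
exact: (measurableT_comp mh).
Qed.

End torus.

(** * Change of variables in space-time and vanishing integrals over boxes *)

Section spacetime.
Variable R : realType.
Local Notation mR := (measurableTypeR R).
Local Notation mR2 := (mR * mR)%type.

(** Groups the variables as [(t, (x, v))], where [leb3] has [((t, x), v)]: the first grouping
    isolates a time or a characteristic, the second a velocity slice. *)
Definition leb12 := (@leb R \x @leb2 R)%E.
HB.instance Definition _ := Measure.copy leb12 (@leb R \x @leb2 R)%E.
HB.instance Definition _ := Measure_isSigmaFinite.Build _ _ _ leb12
  (product_measure_sigma_finite (@leb R) (@leb2 R)).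

Definition assoc3 (z : R * (R * R)) : R * R * R := (z.1, z.2.1, z.2.2).

Lemma measurable_assoc3 :
  measurable_fun (T := (mR * (mR * mR))%type) (U := (mR * mR * mR)%type) setT assoc3.
Proof.
apply/measurable_fun_pairP; split => /=; last first.
  exact: (measurableT_comp measurable_snd measurable_snd).
apply/measurable_fun_pairP; split => /=; first exact: measurable_fst.
exact: (measurableT_comp measurable_fst measurable_snd).
Qed.

Lemma ge0_integral_assoc3 (F : mR * mR * mR -> \bar R) : measurable_fun setT F ->
  (forall z, 0 <= F z)%E ->
  (\int[@leb3 R]_z F z = \int[leb12]_z F (assoc3 z))%E.
Proof.
move=> mF F0; rewrite /leb3 fubini_tonelli1//.
rewrite (@fubini_tonelli1 _ _ _ _ _ (@leb R) (@leb R) (fubini_F (@leb R) F))//; last 2 first.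
- by apply: measurable_fun_fubini_tonelli_F.
- by move=> x; apply: integral_ge0.
have mFa : measurable_fun setT (F \o assoc3) := measurableT_comp mF measurable_assoc3.
rewrite (@fubini_tonelli1 _ _ _ _ _ (@leb R) (@leb2 R) (F \o assoc3))//.
apply: eq_integral => t _; rewrite /fubini_F /=.
rewrite (@fubini_tonelli1 _ _ _ _ _ (@leb R) (@leb R) (fun q : mR2 => F (t, q.1, q.2)))//.
  exact: (measurable_fun_pair2 t mFa).
by move=> z; exact: F0.
Qed.

Lemma integral_assoc3 (F : mR * mR * mR -> \bar R) : measurable_fun setT F ->
  (\int[@leb3 R]_z F z = \int[leb12]_z F (assoc3 z))%E.
Proof.
move=> mF; rewrite integralE [RHS]integralE.
rewrite !ge0_integral_assoc3//; last 2 first.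
- exact: measurable_funeneg.
- exact: measurable_funepos.
congr (_ - _)%E; apply: eq_integral => z _; by rewrite ?funeposE ?funenegE.
Qed.

Lemma integral_shear12 (H : mR * mR2 -> \bar R) : measurable_fun setT H ->
  (forall t q, ~~ T1 q.1 -> H (t, q) = 0%E) ->
  (\int[leb12]_z H z =
   \int[leb12]_z (if T1 z.2.1 then H (z.1, shear z.1 z.2) else 0))%E.
Proof.
move=> mH H0.
have msh : measurable_fun (T := (mR * mR2)%type) (U := (mR * mR2)%type) setT
    (fun z => (z.1, shear z.1 z.2)).
  apply/measurable_fun_pairP; split; first exact: measurable_fst.
  apply/measurable_fun_pairP; split => /=; last first.
    exact: (measurableT_comp measurable_snd measurable_snd).
  apply: (measurableT_comp (@measurable_frac R)); apply: measurable_funD.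
    exact: (measurableT_comp measurable_fst measurable_snd).
  apply: measurable_funM; first exact: measurable_fst.
  exact: (measurableT_comp measurable_snd measurable_snd).
have mT : measurable_fun (T := (mR * mR2)%type) setT (fun z => T1 z.2.1).
  apply: (measurableT_comp (@measurable_T1 R)).
  exact: (measurableT_comp measurable_fst measurable_snd).
have key (F : mR * mR2 -> \bar R) : measurable_fun setT F -> (forall z, 0 <= F z)%E ->
  (forall t q, ~~ T1 q.1 -> F (t, q) = 0%E) ->
  (\int[leb12]_z F z =
   \int[leb12]_z (if T1 z.2.1 then F (z.1, shear z.1 z.2) else 0))%E.
  move=> mF F0 FT.
  have mS : measurable_fun (T := (mR * mR2)%type) setT
      (fun z => if T1 z.2.1 then F (z.1, shear z.1 z.2) else 0)%E.
    by apply: measurable_fun_ifT => //; exact: (measurableT_comp mF msh).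
  have S0 z : (0 <= if T1 z.2.1 then F (z.1, shear z.1 z.2) else 0)%E by case: ifP.
  rewrite [LHS](@fubini_tonelli1 _ _ _ _ _ (@leb R) (@leb2 R) _ mF F0).
  rewrite [RHS](@fubini_tonelli1 _ _ _ _ _ (@leb R) (@leb2 R) _ mS S0).
  apply: eq_integral => t _; rewrite /fubini_F /=.
  rewrite [RHS](@ge0_integral_shear R t (fun q => F (t, q)))//; last first.
    exact: (measurable_fun_pair2 t mF).
  by apply: eq_integral => q _; case: ifPn => // /FT ->.
rewrite integralE [RHS]integralE; congr (_ - _)%E.
  rewrite key//; last 2 first.
  - exact: measurable_funepos.
  - by move=> t q /H0 Htq; rewrite funeposE Htq maxxx.
  by apply: eq_integral => z _; rewrite !funeposE; case: ifP => //; rewrite maxxx.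
rewrite key//; last 2 first.
- exact: measurable_funeneg.
- by move=> t q /H0 Htq; rewrite funenegE Htq oppe0 maxxx.
by apply: eq_integral => z _; rewrite !funenegE; case: ifP => //; rewrite oppe0 maxxx.
Qed.

(** Rational intervals suffice by continuity of the primitive, so each of them may come with its own
    exceptional null set. *)
Lemma locint_ae0_rat h (c d : R) : locint h ->
  (forall p q : rat, c < ratr p -> (ratr p : R) < ratr q -> ratr q < d ->
     \int[@leb R]_(z in `[ratr p, ratr q]%classic) h z = 0) ->
  \forall x \ae @leb R, c < x < d -> h x = 0.
Proof.
move=> lh h0; apply: locint_ae0 => // x y cx xy yd.
have [H Hh _] := primitive_exists 0 0 lh.
rewrite -Hh ?ltW//; apply/eqP; rewrite -normr_le0; apply/ler_addgt0Pr => e e0.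
have e2 : 0 < e / 2 by lra.
have [dl dl0 hd] := primitive_uniform x y lh Hh e2.
have [p] : exists p : rat, ratr p \in `]x, Num.min (x + dl) y[.
  by apply: rat_in_itvoo; rewrite lt_min xy andbT ltrDl.
rewrite in_itv/= lt_min => /and3P[xp pxd py].
have [q] : exists q : rat, ratr q \in `]Num.max (y - dl) (ratr p), y[.
  by apply: rat_in_itvoo; rewrite gt_max py andbT ltrBlDr ltrDl.
rewrite in_itv/= gt_max => /andP[/andP[ydq pq] qy].
have E : H (ratr q) - H (ratr p) = 0.
  rewrite Hh ?ltW//; apply: h0; lra.
have h1 : `|H y - H (ratr q)| < e / 2 by apply: hd; [lra|lra|rewrite ger0_norm; lra].
have h2 : `|H (ratr p) - H x| < e / 2 by apply: hd; [lra|lra|rewrite ger0_norm; lra].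
have -> : H y - H x = (H y - H (ratr q)) + (H (ratr q) - H (ratr p)) + (H (ratr p) - H x).
  by ring.
rewrite E addr0 add0r (le_trans (ler_normD _ _))//; lra.
Qed.

Definition box (a b c d : R) (q : R * R) := (a < q.1 < b) && (c < q.2 < d).

Lemma integrable_if d (X : measurableType d) (mu : {measure set X -> \bar R})
    (p : X -> bool) (f : X -> R) : measurable_fun setT p ->
  mu.-integrable setT (EFin \o f) ->
  mu.-integrable setT (EFin \o (fun x => if p x then f x else 0)).
Proof.
move=> mp fi; apply: (le_integrable measurableT _ _ fi).
  apply/measurable_EFinP; apply: measurable_fun_ifT => //.
  by apply/measurable_EFinP; exact: measurable_int fi.
by move=> x _; rewrite /= lee_fin; case: ifP => // _; rewrite normr0.
Qed.

Lemma integrable_locint (f : R -> R) : (@leb R).-integrable setT (EFin \o f) -> locint f.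
Proof. by move=> fi a b; apply: integrableS fi. Qed.

Lemma Rintegral_itv_if (f : R -> R) a b : (@leb R).-integrable setT (EFin \o f) ->
  \int[@leb R]_(x in `[a, b]%classic) f x = \int[@leb R]_x (if a < x < b then f x else 0).
Proof.
move=> fi; rewrite locint_oo; last exact: (integrable_locint fi).
rewrite Rintegral_mkcond; apply: eq_Rintegral => x _.
by rewrite patchE mem_setE in_itv.
Qed.

(** Two passes of [locint_ae0_rat]: for each rational interval in the second variable the partial
    integral vanishes for almost every value of the first one, and then almost every section
    vanishes. *)
Lemma box_ae0 (D : R * R -> R) (a b c d : R) :
  (@leb2 R).-integrable setT (EFin \o (fun q => if box a b c d q then D q else 0)) ->
  (forall p q i j : rat, a < ratr p -> (ratr p : R) < ratr q -> ratr q < b ->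
     c < ratr i -> (ratr i : R) < ratr j -> ratr j < d ->
     \int[@leb2 R]_z (if box (ratr p) (ratr q) (ratr i) (ratr j) z then D z else 0) = 0) ->
  \forall q \ae @leb2 R, box a b c d q -> D q = 0.
Proof.
move=> iE D0.
pose E z := if box a b c d z then D z else 0.
have mE : measurable_fun (T := mR2) setT E by apply/measurable_EFinP; exact: measurable_int iE.
have mi (i j : R) : measurable_fun setT (fun x : mR => i < x < j).
  exact: (@measurable_mem_itv R `]i, j[).
pose Eij (i j : R) (z : R * R) := if i < z.2 < j then E z else 0.
have iEij i j : (@leb2 R).-integrable setT (EFin \o Eij i j).
  apply: integrable_if => //; exact: (measurableT_comp (mi i j) (@measurable_snd _ _ mR mR)).
pose h (i j : R) y := \int[@leb R]_v Eij i j (y, v).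
have ih i j : (@leb R).-integrable setT (EFin \o h i j) by exact: Rfubini_integrable1 (iEij i j).
have h0 (ij : rat * rat) : \forall y \ae @leb R, c < ratr ij.1 -> (ratr ij.1 : R) < ratr ij.2 ->
    ratr ij.2 < d -> a < y < b -> h (ratr ij.1) (ratr ij.2) y = 0.
  case: ij => i j /=.
  have [ci|] := boolP (c < ratr i); last by move=> ci; apply: aeW.
  have [ij|] := boolP ((ratr i : R) < ratr j); last by move=> ij; apply: aeW.
  have [jd|] := boolP (ratr j < d); last by move=> jd; apply: aeW.
  have := @locint_ae0_rat (h (ratr i) (ratr j)) a b (integrable_locint (ih _ _)) _.
  move=> H; apply: aeS (H _) => [y hy _ _ _|p q ap pq qb]; first exact: hy.
  rewrite Rintegral_itv_if//.
  have mp : measurable_fun (T := mR2) setT (fun z => ratr p < z.1 < (ratr q : R)).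
    exact: (measurableT_comp (mi _ _) (@measurable_fst _ _ mR mR)).
  have iB := integrable_if mp (iEij (ratr i) (ratr j)).
  transitivity (\int[@leb R]_y \int[@leb R]_v
      (if ratr p < (y, v).1 < ratr q then Eij (ratr i) (ratr j) (y, v) else 0)).
    apply: eq_Rintegral => y _ /=; case: ifP => // _.
    by rewrite Rintegral_eq0.
  rewrite (Rfubini1 iB) -[RHS](D0 p q i j)//; apply: eq_Rintegral => z _.
  rewrite /Eij /E /box; case: ifP => //= /andP[h1 h2]; case: ifP => // /andP[h3 h4].
  by rewrite (lt_trans ap h1) (lt_trans h2 qb) (lt_trans ci h3) (lt_trans h4 jd).
have ae1 := Rfubini_ae1 iE.
have mF : measurable_fun (T := mR2) setT (fun z => `|(E z)%:E|%E).
  by apply: measurableT_comp => //; apply/measurable_EFinP.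
have : \forall z \ae @leb2 R, `|(E z)%:E|%E = 0%E.
  apply: (ae_prod_inv mF) => //.
  apply: aeS (aeI ae1 (ae_forall_countable h0)) => y [iy hy].
  have [yab|yab] := boolP (a < y < b); last first.
    by apply: aeW => v; rewrite /E /box /= (negbTE yab) normr0.
  have H := @locint_ae0_rat (fun v => E (y, v)) c d (integrable_locint iy) _.
  apply: aeS (H _) => [v Hv|i j ci ij jd].
    have [/Hv ->|cd] := boolP (c < v < d); first by rewrite abse0.
    by rewrite /E /box /= (negbTE cd) andbF normr0.
  by rewrite Rintegral_itv_if//; have := hy (i, j) ci ij jd yab.
apply: aeS => q /eqP; rewrite abse_eq0 eqe /E => /eqP + bq.
by rewrite bq.
Qed.

End spacetime.

(** * Characteristics *)

Section characteristics.
Variable R : realType.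
Local Notation mR := (measurableTypeR R).
Local Notation mR2 := (mR * mR)%type.
Implicit Types (a b c : R -> R).

Definition periodic b := forall x : R, b (x + 1) = b x.

Lemma periodicDz b x (k : int) : periodic b -> b (x + k%:~R) = b x.
Proof.
move=> pb.
have pn (n : nat) y : b (y + n%:R) = b y.
  elim: n y => [|n IH] y; first by rewrite addr0.
  by rewrite -natr1 addrA pb IH.
case: k => n; first by rewrite -pmulrn pn.
by rewrite -[in RHS](subrK (n.+1%:R) x) pn NegzE intrN.
Qed.

Lemma periodic_frac b x y : periodic b -> b (frac (x + y) - y) = b x.
Proof.
move=> pb; rewrite /frac -(periodicDz x (- Num.floor (x + y)) pb) intrN.
by congr b; ring.
Qed.

(* On [0 <= y < 1] the product of the sines is positive exactly for [p < y < q], and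
   it is 1-periodic in [y]. *)
Definition pbump (p q : R) n (y : R) := step ((n.+1%:R : R) * (sin (pi * (y - p)) * sin (pi * (q - y)))).

Lemma smooth_sin : smooth (@sin R). Proof. by move=> n; have [] := Cn_sincos R n. Qed.

Lemma smooth_affine (k l : R) : smooth (fun x : R => k * x + l).
Proof.
apply: smoothD; last exact: smooth_cst.
by apply: smoothM; [exact: smooth_cst|exact: smooth_id].
Qed.

Lemma smooth_pbump p q n : smooth (pbump p q n).
Proof.
apply: (smooth_comp (@smooth_step R)); apply: smoothM; first exact: smooth_cst.
apply: smoothM; apply: (smooth_comp smooth_sin).
  rewrite (_ : (fun z => _) = (fun z => pi * z + - (pi * p))); first exact: smooth_affine.
  by apply/funext => z; ring.
rewrite (_ : (fun z => _) = (fun z => - pi * z + (pi * q))); first exact: smooth_affine.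
by apply/funext => z; ring.
Qed.

Lemma periodic_pbump p q n : periodic (pbump p q n).
Proof.
move=> x; rewrite /pbump.
have -> : pi * (x + 1 - p) = pi * (x - p) + pi by ring.
have -> : pi * (q - (x + 1)) = - (pi * (x - q) + pi) by ring.
have -> : pi * (q - x) = - (pi * (x - q)) by ring.
by rewrite sinN !sinDpi !sinN opprK mulrN mulNr.
Qed.

Lemma pbump_sign (p q y : R) : 0 < p -> p < q -> q < 1 -> T1 y ->
  (0 < sin (pi * (y - p)) * sin (pi * (q - y))) = (p < y < q).
Proof.
move=> p0 pq q1 /andP[y0 y1].
have pi0 := pi_gt0 R.
have sp (x : R) : 0 < x -> x < 1 -> 0 < sin (pi * x).
  by move=> x0 x1; apply: sin_gt0_pi; rewrite mulr_gt0//= -[ltRHS]mulr1 ltr_pM2l.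
have sn (x : R) : - 1 < x -> x <= 0 -> sin (pi * x) <= 0.
  move=> x1 x0; have [->|x00] := eqVneq x 0; first by rewrite mulr0 sin0.
  have xn : x < 0 by rewrite lt_neqAle x00.
  have h1 : 0 < - x by lra.
  have h2 : - x < 1 by lra.
  by have := sp (- x) h1 h2; rewrite mulrN sinN oppr_gt0 => /ltW.
have [yp|py] := leP y p.
  have s1 : sin (pi * (y - p)) <= 0 by apply: sn; lra.
  have s2 : 0 < sin (pi * (q - y)) by apply: sp; lra.
  by apply/negbTE; rewrite -leNgt mulr_le0_ge0// ltW.
have s1 : 0 < sin (pi * (y - p)) by apply: sp; lra.
rewrite /= pmulr_rgt0//; have [qy|yq] := leP q y.
  by apply/negbTE; rewrite -leNgt; apply: sn; lra.
by apply: sp; lra.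
Qed.

(* [H] read along the characteristics: [q = (y, v)] labels the curve
   [t |-> (y + t v, v)]. *)
Definition sh (H : R * (R * R) -> R) (z : R * (R * R)) : R :=
  if T1 z.2.1 then H (z.1, shear z.1 z.2) else 0.

Lemma measurable_sh (H : mR * mR2 -> R) : measurable_fun setT H ->
  measurable_fun (T := (mR * mR2)%type) setT (sh H).
Proof.
move=> mH; apply: measurable_fun_ifT => //.
  apply: (measurableT_comp (@measurable_T1 R)).
  exact: (measurableT_comp measurable_fst measurable_snd).
apply: (measurableT_comp mH).
apply/measurable_fun_pairP; split; first exact: measurable_fst.
apply/measurable_fun_pairP; split => /=; last first.
  exact: (measurableT_comp measurable_snd measurable_snd).
apply: (measurableT_comp (@measurable_frac R)); apply: measurable_funD.
  exact: (measurableT_comp measurable_fst measurable_snd).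
apply: measurable_funM; first exact: measurable_fst.
exact: (measurableT_comp measurable_snd measurable_snd).
Qed.

Lemma integral_sh (H : mR * mR2 -> R) (F : R -> \bar R) : measurable_fun setT H ->
  (forall t q, ~~ T1 q.1 -> H (t, q) = 0) -> measurable_fun (T := mR) setT F -> F 0 = 0%E ->
  (\int[@leb12 R]_z F (sh H z) = \int[@leb12 R]_z F (H z))%E.
Proof.
move=> mH H0 mF F0; rewrite [RHS]integral_shear12.
- by apply: eq_integral => z _; rewrite /sh; case: ifP.
- exact: (measurableT_comp mF mH).
- by move=> t q /H0 ->.
Qed.

Variables (I : interval R) (s r : R).
Hypothesis oI : open_itv I.

Definition supported (H : R * (R * R) -> R) := forall t q,
  ~~ [&& s < t < r, T1 q.1 & q.2 \in I] -> H (t, q) = 0.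

Definition L2 (H : mR * mR2 -> R) :=
  [/\ measurable_fun setT H, supported H &
     (\int[@leb12 R]_z ((H z) ^+ 2)%:E < +oo)%E].

(** On a set of finite measure, [|H| <= 1 + H^2] turns square integrability into integrability. *)
Lemma integrable_sqr_supp d (X : measurableType d) (mu : {measure set X -> \bar R})
    (B : set X) (H : X -> R) : measurable B -> (mu B < +oo)%E -> measurable_fun setT H ->
  (\int[mu]_z ((H z) ^+ 2)%:E < +oo)%E -> (forall z, ~ B z -> H z = 0) ->
  mu.-integrable setT (EFin \o H).
Proof.
move=> mB finB mH iH sH.
have iS : mu.-integrable setT (EFin \o (fun z => (H z) ^+ 2)).
  apply/integrableP; split.
    by apply/measurable_EFinP; apply: measurable_funX.
  by under eq_integral do rewrite /= ger0_norm ?sqr_ge0//.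
have iB : mu.-integrable setT (EFin \o (\1_B : _ -> R)).
  apply/integrableP; split.
    by apply/measurable_EFinP; exact: measurable_indic.
  have -> : (\int[mu]_z `|(EFin \o (\1_B : X -> R)) z| = mu B)%E.
    have h := @integral_indic _ _ _ mu setT measurableT B mB.
    rewrite setIT in h; rewrite -h; apply: eq_integral => z _.
    by rewrite /= ger0_norm// indicE.
  exact: finB.
apply: (le_integrable measurableT _ _ (integrableD_EFin measurableT iB iS)).
  exact/measurable_EFinP.
move=> z _ /=; rewrite lee_fin [leRHS]ger0_norm; last first.
  by rewrite addr_ge0// ?sqr_ge0// indicE.
have [zB|zB] := pselect (B z); last by rewrite sH// normr0 addr_ge0// ?sqr_ge0// indicE.
rewrite indicE mem_set//= -[(H z) ^+ 2]real_normK ?num_real//.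
set x := `|_|; have : 0 <= x by exact: normr_ge0.
nra.
Qed.

Lemma leb_itv_fin (i j : R) (u0 u1 : bool) :
  (@leb R [set` Interval (BSide u0 i) (BSide u1 j)] < +oo)%E.
Proof.
have : (lebesgue_measure ([set` Interval (BSide u0 i) (BSide u1 j)] : set R) < +oo)%E.
  by rewrite lebesgue_measure_itv /=; case: ifP => _; rewrite -?EFinD ?ltry.
by [].
Qed.

(** The velocity is cut to []c, d[] because [I] may be unbounded, and a square integrable function
    is integrable only over a set of finite measure. *)
Lemma L2_sh_integrable H (c d : R) : L2 H ->
  (@leb12 R).-integrable setT (EFin \o (fun z => if c < z.2.2 < d then sh H z else 0)).
Proof.
move=> [mH sH iH].
have mSh := measurable_sh mH.
have mcd : measurable_fun (T := (mR * mR2)%type) setT (fun z => c < z.2.2 < d).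
  have h := measurableT_comp (@measurable_mem_itv R `]c, d[)
    (measurableT_comp (@measurable_snd _ _ mR mR) (@measurable_snd _ _ mR mR2)).
  exact: h.
pose B := (`]s, r[%classic `*` (`[0, 1[%classic `*` `]c, d[%classic) : set (mR * mR2)).
apply: (@integrable_sqr_supp _ _ _ B).
- by apply: measurableX => //; exact: measurableX.
- have E2 : (@leb2 R (`[0%R, 1%R[%classic `*` `]c, d[%classic) =
      leb R `[0%R, 1%R[%classic * leb R `]c, d[%classic)%E.
    by apply: product_measure1E; exact: measurable_itv.
  have E12 : (@leb12 R B = leb R `]s, r[%classic * @leb2 R (`[0%R, 1%R[%classic `*` `]c, d[%classic))%E.
    by apply: product_measure1E => //; exact: measurableX.
  change (@leb12 R B < +oo)%E.
  by rewrite E12 E2 !lte_mul_pinfty// ?ge0_fin_numE// ?leb_itv_fin// mule_ge0.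
- exact: measurable_fun_ifT.
- apply: le_lt_trans iH.
  rewrite -(integral_sh (F := fun x => (x ^+ 2)%:E))//.
  + apply: ge0_le_integral => //.
    * by move=> z _; rewrite lee_fin sqr_ge0.
    * by apply/measurable_EFinP; apply: measurable_funX; exact: measurable_fun_ifT.
    * by apply/measurable_EFinP; apply: measurable_funX.
    * by move=> z _; rewrite lee_fin; case: ifP => // _; rewrite expr0n sqr_ge0.
  + by move=> t q nT; apply: sH; rewrite (negbTE nT) andbF.
  + by apply/measurable_EFinP; apply: measurable_funX.
  + by rewrite expr0n.
- move=> [t q] nB /=; case: ifPn => // cqd.
  rewrite /sh /=; case: ifPn => // Tq; apply: sH; apply/negP => /and3P[str _ _].
  by apply: nB; split; rewrite /= in_itv//=; split; rewrite /= in_itv.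
Qed.

(** Weak form of [U_t + v U_x = G], tested only against [a(t) b(x - t v) c(v)]: such a function
    varies along characteristics through [a] alone, so no derivative of [b] or [c] appears. *)
Definition weak_transport (U G : R * (R * R) -> R) := forall a b c,
  smooth a -> smooth b -> smooth c -> periodic b ->
  (exists s' r' : R, [/\ s < s', r' < r & forall t, a t != 0 -> s' <= t <= r']) ->
  (exists c' d' : R, [/\ c' \in I, d' \in I & forall v, c v != 0 -> c' <= v <= d']) ->
  \int[@leb12 R]_z
    (U z * (derive1 a z.1 * b (z.2.1 - z.1 * z.2.2) * c z.2.2) +
     G z * (a z.1 * b (z.2.1 - z.1 * z.2.2) * c z.2.2)) = 0.

Lemma measurable_time a : continuous a ->
  measurable_fun (T := (mR * mR2)%type) setT (fun z => a z.1).
Proof.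
by move=> ca; exact: (measurableT_comp (continuous_measurable_fun ca) (@measurable_fst _ _ mR mR2)).
Qed.

Lemma compact_support_bounded a (s' r' : R) : continuous a -> (forall t, a t != 0 -> s' <= t <= r') ->
  exists M, forall t, `|a t| <= M.
Proof.
move=> ca sa; have [M M0 hM] := continuous_bounded_itv s' r' ca.
exists M => t; have [->|/sa/hM//] := eqVneq (a t) 0; by rewrite normr0.
Qed.

Lemma integrable_mul_time a M (F : mR * mR2 -> R) : continuous a -> (forall t, `|a t| <= M) ->
  (@leb12 R).-integrable setT (EFin \o F) ->
  (@leb12 R).-integrable setT (EFin \o (fun z => a z.1 * F z)).
Proof.
move=> ca aM iF.
have := @integrableMr _ _ _ (@leb12 R) setT measurableT (fun z => a z.1) (EFin \o F)
  (measurable_time ca) _ iF.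
apply; exists M; split; first exact: num_real.
by move=> N MN z _; exact: le_trans (aM _) (ltW MN).
Qed.

(** Letting [b] and [c] tend to indicators leaves an integral over a box of labels, tested by [a]
    alone. *)
Lemma weak_transport_box U G a (p q i j s' r' : R) : L2 U -> L2 G -> weak_transport U G ->
  0 < p -> p < q -> q < 1 -> i < j -> i \in I -> j \in I ->
  smooth a -> s < s' -> r' < r -> (forall t, a t != 0 -> s' <= t <= r') ->
  \int[@leb12 R]_z (if box p q i j z.2
    then sh U z * derive1 a z.1 + sh G z * a z.1 else 0) = 0.
Proof.
move=> LU LG W p0 pq q1 ij iI jI sma ss' r'r sa.
have ca := smooth_continuous sma.
have cda := smooth_continuous (smooth_derive1 sma).
have [M aM] := compact_support_bounded ca sa.
have [M' daM] : exists M, forall t, `|derive1 a t| <= M.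
  apply: (compact_support_bounded (s' := s') (r' := r') cda) => t.
  by apply: contraNT => /(derive1_supp sa) ->.
pose K (z : mR * mR2) := derive1 a z.1 * (if i < z.2.2 < j then sh U z else 0) +
  a z.1 * (if i < z.2.2 < j then sh G z else 0).
have iK : (@leb12 R).-integrable setT (EFin \o K).
  apply: integrableD_EFin => //.
    by apply: (integrable_mul_time cda daM); exact: L2_sh_integrable.
  by apply: (integrable_mul_time ca aM); exact: L2_sh_integrable.
pose h n (z : mR * mR2) := pbump p q n z.2.1 * bump i j n z.2.2.
pose h' (z : mR * mR2) : R := (if 0 < sin (pi * (z.2.1 - p)) * sin (pi * (q - z.2.1)) then 1 else 0)
  * (if i < z.2.2 < j then 1 else 0).
have mz1 : measurable_fun (T := (mR * mR2)%type) (U := mR) setT (fun z => z.2.1).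
  exact: (measurableT_comp (@measurable_fst _ _ mR mR) (@measurable_snd _ _ mR mR2)).
have mz2 : measurable_fun (T := (mR * mR2)%type) (U := mR) setT (fun z => z.2.2).
  exact: (measurableT_comp (@measurable_snd _ _ mR mR) (@measurable_snd _ _ mR mR2)).
have cp n := smooth_continuous (smooth_pbump p q n).
have cb n := smooth_continuous (smooth_bump i j n).
have lim : \int[@leb12 R]_z (K z * h n z) @[n --> \oo] --> \int[@leb12 R]_z (K z * h' z).
  apply: Rintegral_bounded_cvg => //.
  - move=> n; apply: measurable_funM.
      exact: (measurableT_comp (continuous_measurable_fun (cp n)) mz1).
    exact: (measurableT_comp (continuous_measurable_fun (cb n)) mz2).
  - move=> n z _; rewrite normrM -[1]mulr1 ler_pM// ?bump_le1//.
    by rewrite ger0_norm ?step_ge0// step_le1.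
  - by move=> z _; apply: cvgM; [exact: step_cvg|exact: bump_cvg].
have -> : \int[@leb12 R]_z (if box p q i j z.2
    then sh U z * derive1 a z.1 + sh G z * a z.1 else 0) = \int[@leb12 R]_z (K z * h' z).
  apply: eq_Rintegral => z _; rewrite /K /h' /box.
  have [Tz|nT] := boolP (T1 z.2.1); last first.
    by rewrite /sh (negbTE nT) !mul0r addr0; do !case: ifP; rewrite ?mulr0 ?addr0 ?mul0r.
  rewrite pbump_sign//.
  by case: (p < z.2.1 < q); case: (i < z.2.2 < j) => /=; ring.
rewrite -(cvg_lim (@Rhausdorff R) lim).
rewrite (_ : (fun n => _) = fun=> 0); first exact: (@lim_cst _ (@Rhausdorff R) _ \oo).
apply/funext => n.
have := W a (pbump p q n) (bump i j n) sma (smooth_pbump p q n) (smooth_bump i j n)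
  (@periodic_pbump p q n) (ex_intro _ s' (ex_intro _ r' (And3 ss' r'r sa))).
have sb : forall v, bump i j n v != 0 -> i <= v <= j.
  by move=> v /(bump_supp ij) /andP[/ltW -> /ltW ->].
move=> /(_ (ex_intro _ i (ex_intro _ j (And3 iI jI sb)))) <-.
have [mU sU _] := LU; have [mG sG _] := LG.
rewrite /Rintegral; congr fine.
rewrite [RHS]integral_shear12; last 2 first.
- apply/measurable_EFinP.
  have mb : measurable_fun (T := (mR * mR2)%type) (U := mR) setT
      (fun z => pbump p q n (z.2.1 - z.1 * z.2.2)).
    apply: (measurableT_comp (continuous_measurable_fun (cp n))).
    apply: measurable_funB => //; apply: measurable_funM => //; exact: measurable_fst.
  have mc : measurable_fun (T := (mR * mR2)%type) (U := mR) setT (fun z => bump i j n z.2.2).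
    exact: (measurableT_comp (continuous_measurable_fun (cb n)) mz2).
  apply: measurable_funD; apply: measurable_funM => //; apply: measurable_funM => //;
    apply: measurable_funM => //; exact: measurable_time.
- by move=> t x nT; rewrite sU ?sG ?mul0r ?addr0// (negbTE nT) andbF.
apply: eq_integral => z _; rewrite /K /h /sh /=.
case: (T1 z.2.1); last by congr EFin; do !case: ifP => _; ring.
congr EFin.
(* After the shear, [x - t v] is the label [y] up to an integer, which the periodic factor does not
   see. *)
rewrite (periodic_frac _ _ (@periodic_pbump p q n)).
have [->|/(bump_supp ij) ->] := eqVneq (bump i j n z.2.2) 0; first by rewrite !mulr0 addr0.
ring.
Qed.

End characteristics.

Section characteristics_theorem.
Variable R : realType.
Local Notation mR := (measurableTypeR R).
Local Notation mR2 := (mR * mR)%type.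

(** Used at [x0 = 0]: the boxes of labels lie in the open interval []0, 1[], so the seam of the
    torus is discarded. *)
Lemma ae_neq (x0 : R) : \forall q \ae @leb2 R, q.1 != x0.
Proof.
exists ([set x0] `*` setT); split.
- by apply: measurableX => //; exact: measurable_set1.
- have -> : (@leb2 R ([set x0] `*` setT) = @leb R [set x0] * @leb R setT)%E.
    by apply: product_measure1E => //; exact: measurable_set1.
  have -> : (@leb R [set x0] = 0)%E.
    by have := @lebesgue_measure_set1 R x0.
  by rewrite mul0e.
- by move=> [x v] /= /negP; rewrite negbK => /eqP ->.
Qed.

Lemma Rintegral_time_fubini (F : mR * mR2 -> R) (k : R -> R) M :
  (@leb12 R).-integrable setT (EFin \o F) -> continuous k -> (forall t, `|k t| <= M) ->
  \int[@leb R]_t (\int[@leb2 R]_q F (t, q) * k t) = \int[@leb12 R]_z (F z * k z.1).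
Proof.
move=> iF ck kM; have iK := integrable_mul_time ck kM iF.
have mm : measurable_fun (T := mR) setT (fun t => \int[@leb2 R]_q F (t, q)).
  by apply/measurable_EFinP; exact: measurable_int (Rfubini_integrable1 iF).
have -> : \int[@leb12 R]_z (F z * k z.1) = \int[@leb12 R]_z (k z.1 * F z).
  by apply: eq_Rintegral => z _; rewrite mulrC.
rewrite -(Rfubini1 iK) /Rintegral; congr fine; apply: ae_eq_integral => //.
- apply/measurable_EFinP; apply: measurable_funM => //.
  exact: continuous_measurable_fun.
- exact: measurable_int (Rfubini_integrable1 iK).
- apply: aeS (Rfubini_ae1 iF) => t it _ /=; congr EFin.
  by rewrite /Rintegral; rewrite -[RHS]/(Rintegral _ _ _) RintegralZl// mulrC.
Qed.

Variables (I : interval R) (s r : R).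
Hypothesis oI : open_itv I.

Let cut (c d : R) (H : R * (R * R) -> R) (z : mR * mR2) : R :=
  if c < z.2.2 < d then sh H z else 0.
Let bcut (p q c d : R) (H : R * (R * R) -> R) (z : mR * mR2) : R :=
  if box p q c d z.2 then sh H z else 0.

Lemma integrable_bcut p q c d H : L2 I s r H ->
  (@leb12 R).-integrable setT (EFin \o bcut p q c d H).
Proof.
move=> LH; have mp : measurable_fun (T := (mR * mR2)%type) setT (fun z => p < z.2.1 < q).
  have h := measurableT_comp (@measurable_mem_itv R `]p, q[)
    (measurableT_comp (@measurable_fst _ _ mR mR) (@measurable_snd _ _ mR mR2)).
  exact: h.
have := integrable_if mp (L2_sh_integrable c d LH).
by congr (integrable _ _ (EFin \o _)); apply/funext => z; rewrite /bcut /box; case: ifP.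
Qed.

(** By [weak_transport_box] the moment of [U] over a fixed box of labels has the moment of [G] as
    weak derivative in time; the du Bois-Reymond lemma then gives its continuous version. *)
Lemma weak_deriv_moment U G (p q i j : R) : L2 I s r U -> L2 I s r G ->
  weak_transport I s r U G -> 0 < p -> p < q -> q < 1 -> i < j -> i \in I -> j \in I ->
  exists2 V, primitive V (fun t => \int[@leb2 R]_z bcut p q i j G (t, z)) &
    \forall t \ae @leb R, s < t < r -> \int[@leb2 R]_z bcut p q i j U (t, z) = V t.
Proof.
move=> LU LG W p0 pq q1 ij iI jI.
have iU := integrable_bcut p q i j LU; have iG := integrable_bcut p q i j LG.
have imU := Rfubini_integrable1 iU; have imG := Rfubini_integrable1 iG.
have osr : open_itv (`]s, r[ : interval R).
  move=> v; rewrite in_itv /= => /andP[sv vr].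
  exists ((s + v) / 2), ((v + r) / 2); rewrite !in_itv /=; split; lra.
have [] := @weak_deriv_primitive R `]s, r[ (fun t => \int[@leb2 R]_z bcut p q i j U (t, z))
  (fun t => \int[@leb2 R]_z bcut p q i j G (t, z)) osr (integrable_locint imU)
  (integrable_locint imG); last by move=> V; exists V.
move=> a sma [c [d [csr dsr sa]]].
have ca := smooth_continuous sma.
have cda := smooth_continuous (smooth_derive1 sma).
have [M aM] := compact_support_bounded ca sa.
have sda t : derive1 a t != 0 -> c <= t <= d.
  by apply: contraNT => /(derive1_supp sa) ->.
have [M' daM] := compact_support_bounded cda sda.
have supp (m k : R -> R) : (forall t, k t != 0 -> c <= t <= d) ->
    (\int[@leb R]_(t in [set` `]s, r[]) (m t * k t)%:E = \int[@leb R]_t (m t * k t)%:E)%E.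
  move=> hk; rewrite [LHS]integral_mkcond; apply: eq_integral => t _; rewrite patchE.
  case: ifPn => // /negP tsr; have [->|/hk /andP[ct td]] := eqVneq (k t) 0.
    by rewrite mulr0.
  exfalso; apply: tsr; rewrite mem_setE; move: csr dsr; rewrite !in_itv /= => *; lra.
rewrite !supp//.
have eU := Rintegral_time_fubini iU cda daM.
have eG := Rintegral_time_fubini iG ca aM.
have iUa : (@leb R).-integrable setT (EFin \o (fun t => \int[@leb2 R]_z bcut p q i j U (t, z) * derive1 a t)).
  have h := @integrableMr _ _ _ (@leb R) setT measurableT (derive1 a) (EFin \o (fun t => \int[@leb2 R]_z bcut p q i j U (t, z)))
    (continuous_measurable_fun cda) _ imU.
  apply: eq_integrable (h _) => //; first by move=> t _ /=; rewrite mulrC.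
  by exists M'; split; [exact: num_real|move=> N MN z _; exact: le_trans (daM _) (ltW MN)].
have iGa : (@leb R).-integrable setT (EFin \o (fun t => \int[@leb2 R]_z bcut p q i j G (t, z) * a t)).
  have h := @integrableMr _ _ _ (@leb R) setT measurableT a (EFin \o (fun t => \int[@leb2 R]_z bcut p q i j G (t, z)))
    (continuous_measurable_fun ca) _ imG.
  apply: eq_integrable (h _) => //; first by move=> t _ /=; rewrite mulrC.
  by exists M; split; [exact: num_real|move=> N MN z _; exact: le_trans (aM _) (ltW MN)].
have fU := integrable_fin_num measurableT iUa.
have fG := integrable_fin_num measurableT iGa.
rewrite -(fineK fU) -(fineK fG) -EFinN; congr EFin.
rewrite -[LHS]/(\int[@leb R]_t (\int[@leb2 R]_z bcut p q i j U (t, z) * derive1 a t)).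
rewrite -[in RHS]/(\int[@leb R]_t (\int[@leb2 R]_z bcut p q i j G (t, z) * a t)).
rewrite eU eG; apply/eqP; rewrite -addr_eq0; apply/eqP.
have [ss' r'r] : s < c /\ d < r by move: csr dsr; rewrite !in_itv /= => /andP[? _] /andP[_ ?].
have := weak_transport_box LU LG W p0 pq q1 ij iI jI sma ss' r'r sa.
rewrite -RintegralD//.
- move=> <-; apply: eq_Rintegral => z _; rewrite /bcut; case: ifP => // _.
  by rewrite !mul0r addr0.
- apply: eq_integrable (integrable_mul_time cda daM iU) => //.
  by move=> z _ /=; rewrite mulrC.
- apply: eq_integrable (integrable_mul_time ca aM iG) => //.
  by move=> z _ /=; rewrite mulrC.
Qed.

Lemma mem_itv_convex (x y z : R) : x \in I -> y \in I -> x <= z <= y -> z \in I.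
Proof. by move=> xI yI xzy; have := @interval_is_interval R I x y xI yI z xzy. Qed.

Lemma rat_itv_mem v : v \in I -> exists i j : rat,
  [/\ ratr i < v, v < ratr j, ratr i \in I & ratr j \in I].
Proof.
move=> /oI[c [d [cv vd cI dI]]].
have [i] := rat_in_itvoo cv; rewrite in_itv /= => /andP[ci iv].
have [j] := rat_in_itvoo vd; rewrite in_itv /= => /andP[vj jd].
exists i, j; split=> //.
  by apply: (mem_itv_convex cI dI); lra.
by apply: (mem_itv_convex cI dI); lra.
Qed.

(* The moments of [U] over boxes moving with the characteristics have weak time
   derivatives; countably many rational boxes suffice to recover the transport
   equation on almost every characteristic. *)
Theorem characteristics U G : L2 I s r U -> L2 I s r G -> weak_transport I s r U G ->
  exists Th : set R, [/\ \forall t \ae @leb R, s < t < r -> Th t,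
    forall t, Th t -> s < t < r &
    forall t1 t2, Th t1 -> Th t2 -> t1 <= t2 ->
    \forall q \ae @leb2 R, T1 q.1 -> q.2 \in I ->
      (@leb R).-integrable setT (EFin \o (fun t => sh G (t, q))) /\
      sh U (t2, q) - sh U (t1, q) = \int[@leb R]_(t in `[t1, t2]%classic) sh G (t, q)].
Proof.
move=> LU LG W.
pose valid (Q : rat * rat * rat * rat) :=
  let: (p, q, i, j) := Q in [/\ (0 : R) < ratr p, (ratr p : R) < ratr q, ratr q < (1 : R) &
    (ratr i : R) < ratr j] /\ (ratr i \in I /\ ratr j \in I).
pose mom H (Q : rat * rat * rat * rat) t :=
  let: (p, q, i, j) := Q in
  \int[@leb2 R]_z bcut (ratr p) (ratr q) (ratr i) (ratr j) H (t, z).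
have exV (Q : rat * rat * rat * rat) : exists V, valid Q -> primitive V (mom G Q) /\
    \forall t \ae @leb R, s < t < r -> mom U Q t = V t.
  have [vQ|nQ] := pselect (valid Q); last by exists id.
  case: Q vQ => [[[p q] i] j] [[p0 pq q1 ij] [iI jI]].
  by have [V pV aV] := weak_deriv_moment LU LG W p0 pq q1 ij iI jI; exists V.
have [V hV] := choice exV.
have icutU (ij : rat * rat) : \forall t \ae @leb R,
    (@leb2 R).-integrable setT (EFin \o (fun q => cut (ratr ij.1) (ratr ij.2) U (t, q))).
  exact: Rfubini_ae1 (L2_sh_integrable _ _ LU).
have icutG (ij : rat * rat) : \forall q \ae @leb2 R,
    (@leb R).-integrable setT (EFin \o (fun t => cut (ratr ij.1) (ratr ij.2) G (t, q))).
  exact: Rfubini_ae2 (L2_sh_integrable _ _ LG).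
have aeV (Q : rat * rat * rat * rat) : \forall t \ae @leb R, valid Q -> s < t < r -> mom U Q t = V Q t.
  have [vQ|nQ] := pselect (valid Q); last by apply: aeW.
  by have [_] := hV Q vQ; apply: aeS => t h _.
(* Admissible times: the slices of [U] are locally integrable in [v] and every rational moment takes
   its continuous value, which excludes only countably many null sets. *)
exists [set t | [/\ s < t < r,
  forall ij : rat * rat, (@leb2 R).-integrable setT
    (EFin \o (fun q => cut (ratr ij.1) (ratr ij.2) U (t, q))) &
  forall Q, valid Q -> mom U Q t = V Q t]]; split.
- apply: aeS (aeI (ae_forall_countable icutU) (ae_forall_countable aeV)) => t [iU hQ] tsr.
  by split => // Q vQ; exact: hQ.
- by move=> t [].
move=> t1 t2 [t1sr i1 V1] [t2sr i2 V2] t12.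
(* The defect in the transport identity. Its integral over a rational box is the defect for the
   moments, which is 0 at admissible times. *)
pose D q := sh U (t2, q) - sh U (t1, q) - \int[@leb R]_t (if t1 < t < t2 then sh G (t, q) else 0).
have mt : measurable_fun (T := (mR * mR2)%type) setT (fun z => t1 < z.1 < t2).
  have h := measurableT_comp (@measurable_mem_itv R `]t1, t2[) (@measurable_fst _ _ mR mR2).
  exact: h.
have bcutD (p q i j : R) z : (if box p q i j z then D z else 0) =
    bcut p q i j U (t2, z) - bcut p q i j U (t1, z) -
    \int[@leb R]_t (if t1 < t < t2 then bcut p q i j G (t, z) else 0).
  rewrite /bcut /=; case: ifP => // _; rewrite subrr Rintegral_eq0 ?subr0//.
  by move=> t _; case: ifP.
have iGt (p q i j : R) : (@leb12 R).-integrable setT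
    (EFin \o (fun z => if t1 < z.1 < t2 then bcut p q i j G z else 0)).
  exact: integrable_if (integrable_bcut p q i j LG).
have ibU (p q : R) (i j : rat) t : (forall ij : rat * rat, (@leb2 R).-integrable setT
    (EFin \o (fun q => cut (ratr ij.1) (ratr ij.2) U (t, q)))) ->
    (@leb2 R).-integrable setT (EFin \o (fun z => bcut p q (ratr i) (ratr j) U (t, z))).
  move=> h; have mp : measurable_fun (T := mR2) setT (fun z => p < z.1 < q).
    have h' := measurableT_comp (@measurable_mem_itv R `]p, q[) (@measurable_fst _ _ mR mR).
    exact: h'.
  have := integrable_if mp (h (i, j)).
  by congr (integrable _ _ (EFin \o _)); apply/funext => z; rewrite /bcut /cut /box /=; case: ifP.
have D0 (i j : rat) : ratr i \in I -> ratr j \in I ->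
    \forall q \ae @leb2 R, box 0 1 (ratr i) (ratr j) q -> D q = 0.
  move=> iI jI; apply: box_ae0.
    have := integrableB_EFin measurableT (integrableB_EFin measurableT (ibU 0 1 i j t2 i2) (ibU 0 1 i j t1 i1))
      (Rfubini_integrable2 (iGt 0 1 (ratr i) (ratr j))).
    by congr (integrable _ _ (EFin \o _)); apply/funext => z; rewrite bcutD.
  move=> p q i' j' p0 pq q1 ii' i'j' jj'.
  have i'I : ratr i' \in I by apply: (mem_itv_convex iI jI); lra.
  have j'I : ratr j' \in I by apply: (mem_itv_convex iI jI); lra.
  have vQ : valid (p, q, i', j') by [].
  under eq_Rintegral do rewrite bcutD.
  rewrite RintegralB//; last 2 first.
  - by apply: integrableB_EFin => //; exact: ibU.
  - exact: Rfubini_integrable2 (iGt _ _ _ _).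
  rewrite RintegralB//; [|exact: ibU|exact: ibU].
  rewrite (Rfubini2 (iGt _ _ _ _)) -(Rfubini1 (iGt _ _ _ _)).
  have /= -> := V1 _ vQ; have /= -> := V2 _ vQ.
  have [pV _] := hV _ vQ; rewrite (pV _ _ t12) Rintegral_itv_if; last first.
    exact: (Rfubini_integrable1 (integrable_bcut _ _ _ _ LG)).
  apply/eqP; rewrite subr_eq0; apply/eqP/eq_Rintegral => t _ /=.
  by case: ifP => // _; rewrite Rintegral_eq0.
have D0' (ij : rat * rat) : \forall q \ae @leb2 R, ratr ij.1 \in I -> ratr ij.2 \in I ->
    box 0 1 (ratr ij.1) (ratr ij.2) q -> D q = 0.
  have [iI|iI] := boolP ((ratr ij.1 : R) \in I); last by apply: aeW.
  have [jI|jI] := boolP ((ratr ij.2 : R) \in I); last by apply: aeW.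
  by apply: aeS (D0 _ _ iI jI) => q.
apply: aeS (aeI (ae_neq 0) (aeI (ae_forall_countable icutG) (ae_forall_countable D0'))).
move=> [y v] /= [y0 [iG hD]] /andP[y_ge0 y1] vI.
have [i [j [iv vj iI jI]]] := rat_itv_mem vI.
have iGq : (@leb R).-integrable setT (EFin \o (fun t => sh G (t, (y, v)))).
  have := iG (i, j); congr (integrable _ _ (EFin \o _)); apply/funext => t.
  by rewrite /cut /= iv vj.
split => //; rewrite Rintegral_itv_if//.
have : D (y, v) = 0.
  by apply: (hD (i, j)) => //; rewrite /box /= iv vj y1 lt_neqAle eq_sym y0 y_ge0.
by rewrite /D => /eqP; rewrite subr_eq0 => /eqP.
Qed.

End characteristics_theorem.

(** * Test functions *)

Section test_functions.
Variable R : realType.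
Local Notation V3 := (R * R * R)%type.
Local Notation et := ((1, 0, 0) : V3).
Local Notation ex := ((0, 1, 0) : V3).
Local Notation ev := ((0, 0, 1) : V3).

Lemma slice_curve (Phi : V3 -> R) y v :
  (fun h : R => Phi (y, h *: (1 : R) + v)) = (fun h => Phi (h *: ev + (y, v))).
Proof.
apply/funext => h; case: y => t x.
rewrite -[RHS]/(Phi (h * 0 + t, h * 0 + x, h * 1 + v)).
by rewrite -[LHS]/(Phi (t, x, h * 1 + v)) !mulr0 !add0r.
Qed.

Lemma derive_slice (Phi : V3 -> R) y v :
  derive1 (fun v => Phi (y, v)) v = 'D_ev Phi (y, v).
Proof. by rewrite derive1E derive_curve slice_curve -derive_curve. Qed.

Lemma derivable_slice (Phi : V3 -> R) y v : derivable Phi (y, v) ev ->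
  derivable (fun v => Phi (y, v)) v 1.
Proof. by move=> /derivable1P h; apply/derivable1P; rewrite slice_curve. Qed.

Lemma Cn_slice n (Phi : V3 -> R) y : Cn n Phi -> Cn n (fun v => Phi (y, v)).
Proof.
elim: n Phi => [|n IH] Phi.
  move=> cP v; apply: continuous_comp; last exact: cP.
  have h : (y, w) @[w --> v] --> (y, v) by exact: (cvg_pair (cvg_cst y) cvg_id).
  exact: h.
move=> /CnSP[cP dP DP]; apply: Cn_derive1 => [v|]; first exact: (derivable_slice (dP _ _)).
rewrite (_ : derive1 _ = (fun v => 'D_ev Phi (y, v))); first exact: (IH ('D_ev Phi) (DP ev)).
by apply/funext => v; rewrite derive_slice.
Qed.

Lemma smooth_slice (Phi : V3 -> R) y : smooth Phi -> smooth (fun v => Phi (y, v)).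
Proof. by move=> sP n; exact: Cn_slice. Qed.

Lemma continuous_time : continuous (fun z : V3 => z.1.1).
Proof. by move=> z; apply: continuous_comp; exact: cvg_fst. Qed.

Lemma continuous_position : continuous (fun z : V3 => z.1.2).
Proof. by move=> z; apply: continuous_comp; [exact: cvg_fst|exact: cvg_snd]. Qed.

Lemma continuous_velocity : continuous (fun z : V3 => z.2).
Proof. by move=> z; exact: cvg_snd. Qed.

Variables a b c : R -> R.
Hypothesis (sa : smooth a) (sb : smooth b) (sc : smooth c).

Definition phi (z : V3) := a z.1.1 * b (z.1.2 - z.1.1 * z.2) * c z.2.

Let P (z : V3) := z.1.2 - z.1.1 * z.2.

Let p1 z w := @derive_linear R V3 (fun z => z.1.1) z w (fun _ _ _ => erefl).
Let p2 z w := @derive_linear R V3 (fun z => z.1.2) z w (fun _ _ _ => erefl).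
Let p3 z w := @derive_linear R V3 (fun z => z.2) z w (fun _ _ _ => erefl).

Lemma smooth_phase : smooth P.
Proof.
have s1 := smooth_linear (l := fun z : V3 => z.1.1) (fun _ _ _ => erefl) continuous_time.
have s2 := smooth_linear (l := fun z : V3 => z.1.2) (fun _ _ _ => erefl) continuous_position.
have s3 := smooth_linear (l := fun z : V3 => z.2) (fun _ _ _ => erefl) continuous_velocity.
rewrite (_ : P = (fun z => z.1.2 + (-1) * (z.1.1 * z.2))).
  by apply: smoothD => //; apply: smoothM; [exact: smooth_cst|exact: smoothM].
by apply/funext => z; rewrite mulN1r.
Qed.

Lemma smooth_phi : smooth phi.
Proof.
have s1 := smooth_linear (l := fun z : V3 => z.1.1) (fun _ _ _ => erefl) continuous_time.
have s3 := smooth_linear (l := fun z : V3 => z.2) (fun _ _ _ => erefl) continuous_velocity.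
apply: smoothM; last exact: (smooth_comp sc s3).
by apply: smoothM; [exact: (smooth_comp sa s1)|exact: (smooth_comp sb smooth_phase)].
Qed.

Lemma derive_phase z w : 'D_w P z = w.1.2 - (z.1.1 * w.2 + z.2 * w.1.1).
Proof.
have [d1 e1] := p1 z w; have [d2 e2] := p2 z w; have [d3 e3] := p3 z w.
have dM : derivable (fun z : V3 => z.1.1 * z.2) z w := derivableM d1 d3.
by rewrite /P (deriveB d2 dM) (deriveM d1 d3) e1 e2 e3.
Qed.

Lemma derive_phi z w : 'D_w phi z =
  w.1.1 * (derive1 a z.1.1 * b (P z) * c z.2) +
  (w.1.2 - (z.1.1 * w.2 + z.2 * w.1.1)) * (a z.1.1 * derive1 b (P z) * c z.2) +
  w.2 * (a z.1.1 * b (P z) * derive1 c z.2).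
Proof.
have [d1 e1] := p1 z w; have [d3 e3] := p3 z w.
have dP : derivable P z w by exact: smooth_derivable smooth_phase.
have [dA eA] := derive_comp d1 (smooth_derivable (z := z.1.1) (w := 1) sa).
have [dB eB] := derive_comp dP (smooth_derivable (z := (P z)) (w := 1) sb).
have [dC eC] := derive_comp d3 (smooth_derivable (z := z.2) (w := 1) sc).
have dAB : derivable (fun z : V3 => a z.1.1 * b (P z)) z w := derivableM dA dB.
rewrite /phi (deriveM dAB dC) (deriveM dA dB) eA eB eC e1 e3 derive_phase -!derive1E.
by rewrite /GRing.scale /=; ring.
Qed.

(** The label [x - t v] is annihilated by the transport operator, so only the derivative of [a]
    survives. *)
Lemma transport_phi z : 'D_et phi z + z.2 * 'D_ex phi z =
  derive1 a z.1.1 * b (P z) * c z.2.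
Proof. by rewrite !derive_phi /=; ring. Qed.

End test_functions.

(** * Weak solutions *)

Section weak_solutions.
Variable R : realType.
Local Notation mR := (measurableTypeR R).
Local Notation mR2 := (mR * mR)%type.
Local Notation mR3 := (mR * mR * mR)%type.
Local Notation V3 := (R * R * R)%type.
Local Notation et := ((1, 0, 0) : V3).
Local Notation ex := ((0, 1, 0) : V3).
Local Notation ev := ((0, 0, 1) : V3).
Variables (I : interval R) (s r : R).
Hypotheses (oI : open_itv I) (s0 : 0 < s).

Definition slab : set V3 := `[s, r]%classic `*` @torus R `*` [set` I].

Definition slab_L2 (w : V3 -> R) := measurable_fun (T := mR3) slab w /\
  exists C : R, \forall t \ae @leb R, s <= t <= r ->
    (\int[@leb2 R]_(y in @torus R `*` [set` I]) ((w (t, y.1, y.2)) ^+ 2)%:E <= C%:E)%E.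

(** Extension by zero outside the open slab, so that Fubini and the shear act on functions defined
    everywhere; [cut] is the same function in the grouping [(t, (x, v))]. *)
Definition cut3 (w : V3 -> R) (z : V3) : R :=
  if [&& s < z.1.1 < r, T1 z.1.2 & z.2 \in I] then w z else 0.

Definition cut (w : V3 -> R) (z : R * (R * R)) : R := cut3 w (assoc3 z).

Let m11 : measurable_fun (T := mR3) (U := mR) setT (fun z => z.1.1).
Proof. exact: (measurableT_comp (@measurable_fst _ _ mR mR) (@measurable_fst _ _ mR2 mR)). Qed.

Let m12 : measurable_fun (T := mR3) (U := mR) setT (fun z => z.1.2).
Proof. exact: (measurableT_comp (@measurable_snd _ _ mR mR) (@measurable_fst _ _ mR2 mR)). Qed.

Let m2 : measurable_fun (T := mR3) (U := mR) setT (fun z => z.2).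
Proof. exact: (@measurable_snd _ _ mR2 mR). Qed.

Lemma measurable_slab : measurable (slab : set mR3).
Proof. by apply: measurableX => //; apply: measurableX => //; exact: measurable_itv. Qed.

Lemma measurable_cut3 w : measurable_fun (T := mR3) slab w ->
  measurable_fun (T := mR3) setT (cut3 w).
Proof.
move=> mw; apply: measurable_fun_if => //.
  apply: measurable_and.
    exact: (measurableT_comp (@measurable_mem_itv R `]s, r[) m11).
  apply: measurable_and; first exact: (measurableT_comp (@measurable_T1 R) m12).
  exact: (measurableT_comp (@measurable_mem_itv R I) m2).
apply: measurable_funS mw.
  exact: measurable_slab.
move=> [[t x] v] [_ /= /and3P[/andP[st tr] Tx vI]].
by split => //; split => //=; rewrite /= in_itv /= ?(ltW st) ?(ltW tr).
Qed.

Lemma measurable_cut w : measurable_fun (T := mR3) slab w ->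
  measurable_fun (T := (mR * mR2)%type) setT (cut w).
Proof. by move=> /measurable_cut3 mw; exact: measurableT_comp mw (@measurable_assoc3 R). Qed.

Lemma cut_slice w t : s < t < r ->
  (\int[@leb2 R]_(y in @torus R `*` [set` I]) ((w (t, y.1, y.2)) ^+ 2)%:E =
   \int[@leb2 R]_q ((cut w (t, q)) ^+ 2)%:E)%E.
Proof.
move=> str; rewrite [LHS]integral_mkcond; apply: eq_integral => -[x v] _.
rewrite patchE /cut /cut3 /= str /=; case: ifPn => xv.
  move: xv; rewrite in_setE => -[/= xT vI]; have Tx : T1 x by move: xT; rewrite /torus /= in_itv.
  by rewrite Tx; move: vI => /= ->.
case: ifP => [/andP[Tx vI]|_]; last by rewrite expr0n.
by exfalso; move: xv; rewrite notin_setE; apply; split => //=; rewrite in_itv.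
Qed.

Lemma slab_cut_L2 w : slab_L2 w -> L2 I s r (cut w).
Proof.
move=> [mw [C hC]]; split.
- exact: measurable_cut.
- by move=> t [x v] /=; rewrite /cut /cut3 /=; case: ifP.
have mc : measurable_fun (T := (mR * mR2)%type) setT (fun z => ((cut w z) ^+ 2)%:E).
  by apply/measurable_EFinP; apply: measurable_funX; exact: measurable_cut.
rewrite /leb12 fubini_tonelli1//; last by move=> z; rewrite lee_fin sqr_ge0.
(* The bound [C] holds only for almost every time in the slab and may be negative when the slab is
   empty. *)
have C0 : (0 <= (Num.max C 0)%:E)%E by rewrite lee_fin le_max lexx orbT.
apply: (@le_lt_trans _ _ (\int[@leb R]_(t in `]s, r[%classic) (Num.max C 0)%:E)%E).
  rewrite [leRHS]integral_mkcond; apply: ae_ge0_le_integral => //.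
  - by move=> t _; apply: integral_ge0 => q _; rewrite lee_fin sqr_ge0.
  - by apply: measurable_fun_fubini_tonelli_F => // z; rewrite lee_fin sqr_ge0.
  - by move=> t _; rewrite patchE; case: ifP.
  - apply/(measurable_restrictT _ (measurable_itv _)); exact: measurable_cst.
  apply: aeS hC => t ht _; rewrite patchE /fubini_F /=.
  case: ifPn; rewrite ?inE ?notin_setE /= in_itv/= => str.
    rewrite -cut_slice//; apply: le_trans (ht _) _.
      by case/andP: str => *; rewrite !ltW.
    by rewrite lee_fin le_max lexx.
  rewrite integral0_eq// => -[x v] _; rewrite /cut /cut3 /=.
  by case: ifP => [/andP[]//|_]; rewrite expr0n.
rewrite integral_cst//; apply: lte_mul_pinfty => //; exact: leb_itv_fin.
Qed.

Lemma measurable_base : measurable (@torus R `*` [set` I] : set mR2).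
Proof. by apply: measurableX => //; exact: measurable_itv. Qed.

Lemma measurable_slab_slice (w : V3 -> R) t : measurable_fun (T := mR3) slab w ->
  s <= t <= r ->
  measurable_fun (T := mR2) (@torus R `*` [set` I]) (fun y => w (t, y.1, y.2)).
Proof.
move=> mw str.
have mg : measurable_fun (T := mR2) (U := mR3) setT (fun y => (t, y.1, y.2)).
  apply/measurable_fun_pairP; split => /=; last exact: measurable_snd.
  by apply/measurable_fun_pairP; split => /=; [exact: measurable_cst|exact: measurable_fst].
apply: (measurable_comp measurable_slab _ mw); last exact: measurable_funTS.
by move=> _ [[x v] [/= xT vI] <-]; split => //; split => //=; rewrite in_itv.
Qed.

Lemma slab_L2D w1 w2 : slab_L2 w1 -> slab_L2 w2 -> slab_L2 (fun z => w1 z + w2 z).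
Proof.
move=> [m1w [C1 h1]] [m2w [C2 h2]]; split; first exact: measurable_funD.
exists (2 * C1 + 2 * C2); apply: aeS (aeI h1 h2) => t [{}h1 {}h2] str.
have mD := measurable_base; have mt w mw := @measurable_slab_slice w t mw str.
apply: (@le_trans _ _ (\int[@leb2 R]_(y in @torus R `*` [set` I])
   ((2 * (w1 (t, y.1, y.2)) ^+ 2)%:E + (2 * (w2 (t, y.1, y.2)) ^+ 2)%:E))%E).
  apply: ge0_le_integral => //.
  - by move=> y _; rewrite lee_fin sqr_ge0.
  - by apply/measurable_EFinP/measurable_funX/measurable_funD; exact: mt.
  - by apply: emeasurable_funD; apply/measurable_EFinP; apply: measurable_funM => //;
      apply: measurable_funX; exact: mt.
  - move=> y _; rewrite -EFinD lee_fin; set x1 := w1 _; set x2 := w2 _.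
    have := sqr_ge0 (x1 - x2); nra.
rewrite ge0_integralD//; last 4 first.
- by move=> y _; rewrite lee_fin mulr_ge0// sqr_ge0.
- by apply/measurable_EFinP; apply: measurable_funM => //; apply: measurable_funX; exact: mt.
- by move=> y _; rewrite lee_fin mulr_ge0// sqr_ge0.
- by apply/measurable_EFinP; apply: measurable_funM => //; apply: measurable_funX; exact: mt.
under eq_integral do rewrite EFinM.
under [X in (_ + X <= _)%E]eq_integral do rewrite EFinM.
rewrite !ge0_integralZl//; last 4 first.
- by apply/measurable_EFinP; apply: measurable_funX; exact: mt.
- by move=> y _; rewrite lee_fin sqr_ge0.
- by apply/measurable_EFinP; apply: measurable_funX; exact: mt.
- by move=> y _; rewrite lee_fin sqr_ge0.
have -> : (2 * C1 + 2 * C2)%:E = (2%:E * C1%:E + 2%:E * C2%:E)%E by [].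
by rewrite leeD// lee_wpmul2l ?lee_fin// ?h1 ?h2.
Qed.

Lemma cut3_integrable w (c d : R) : slab_L2 w ->
  (@leb3 R).-integrable setT (EFin \o (fun z => if c < z.2 < d then cut3 w z else 0)).
Proof.
move=> lw; have [mw _] := lw; have [_ _ iw] := slab_cut_L2 lw.
have mcw := measurable_cut3 mw.
have mcd : measurable_fun (T := mR3) setT (fun z => c < z.2 < d).
  exact: (measurableT_comp (@measurable_mem_itv R `]c, d[) m2).
pose B := (`]s, r[%classic `*` `[0, 1[%classic `*` `]c, d[%classic) : set mR3.
apply: (@integrable_sqr_supp _ _ _ _ B).
- by apply: measurableX => //; exact: measurableX.
- have E2 : (@leb2 R (`]s, r[%classic `*` `[0%R, 1%R[%classic) =
      leb R `]s, r[%classic * leb R `[0%R, 1%R[%classic)%E.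
    by apply: product_measure1E; exact: measurable_itv.
  have E3 : (@leb3 R B = @leb2 R (`]s, r[%classic `*` `[0%R, 1%R[%classic) * leb R `]c, d[%classic)%E.
    by apply: product_measure1E => //; exact: measurableX.
  change (@leb3 R B < +oo)%E.
  by rewrite E3 E2 !lte_mul_pinfty// ?ge0_fin_numE// ?lte_mul_pinfty// ?ge0_fin_numE// ?leb_itv_fin// mule_ge0.
- exact: measurable_fun_ifT.
- have mc2 : measurable_fun (T := mR3) setT (fun z => ((cut3 w z) ^+ 2)%:E).
    by apply/measurable_EFinP; exact: measurable_funX.
  apply: le_lt_trans iw.
  rewrite -(ge0_integral_assoc3 mc2); last by move=> z; rewrite lee_fin sqr_ge0.
  apply: ge0_le_integral => //.
  + by move=> z _; rewrite lee_fin sqr_ge0.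
  + by apply/measurable_EFinP; apply: measurable_funX; exact: measurable_fun_ifT.
  + by move=> z _; rewrite lee_fin; case: ifP => // _; rewrite expr0n sqr_ge0.
- move=> [[t x] v] nB /=; case: ifPn => // cvd; rewrite /cut3 /=.
  case: ifP => // /and3P[str Tx _]; exfalso; apply: nB.
  by split; rewrite /= ?in_itv//=; split; rewrite /= in_itv.
Qed.

Lemma periodic_bounded (b : R -> R) : continuous b -> periodic b -> exists M, forall x, `|b x| <= M.
Proof.
move=> cb pb; have [M _ hM] := continuous_bounded_itv 0 1 cb; exists M => x.
rewrite (_ : b x = b (frac x)); last by have := periodic_frac x 0 pb; rewrite addr0 subr0.
by apply: hM; case/andP: (frac_itv x) => -> /ltW ->.
Qed.

Lemma cut3_phi_integrable w (a b c : R -> R) (s' r' c' d' : R) : slab_L2 w ->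
  continuous a -> continuous b -> continuous c -> periodic b ->
  (forall t, a t != 0 -> s' <= t <= r') -> (forall v, c v != 0 -> c' <= v <= d') ->
  (@leb3 R).-integrable setT (EFin \o (fun z => cut3 w z * phi a b c z)).
Proof.
move=> lw ca cb cc pb sa sc.
have [Ma hMa] := compact_support_bounded ca sa.
have [Mc hMc] := compact_support_bounded cc sc.
have [Mb hMb] := periodic_bounded cb pb.
have mphi : measurable_fun (T := mR3) setT (phi a b c).
  have h1 := measurableT_comp (continuous_measurable_fun ca) m11.
  have h3 := measurableT_comp (continuous_measurable_fun cc) m2.
  have h2 := measurableT_comp (continuous_measurable_fun cb)
    (measurable_funB m12 (measurable_funM m11 m2)).
  exact: (measurable_funM (measurable_funM h1 h2) h3).
have h := @integrableMr _ _ _ (@leb3 R) setT measurableT (phi a b c) _ mphi _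
  (cut3_integrable (c' - 1) (d' + 1) lw).
apply: eq_integrable (h _) => //.
  move=> z _ /=; rewrite -EFinM mulrC; congr EFin; case: ifPn => // ncd.
  rewrite /phi; have [->|/sc h'] := eqVneq (c z.2) 0; first by rewrite !mulr0.
  by exfalso; move/negP: ncd; apply; move: h' => /andP[]; lra.
exists (Ma * Mb * Mc); split; first exact: num_real.
move=> N MN z _; apply: le_trans (ltW MN); rewrite /phi !normrM.
by rewrite !ler_pM ?mulr_ge0.
Qed.

Lemma derive_phi_v (a b c : R -> R) z : smooth a -> smooth b -> smooth c ->
  'D_ev (phi a b c) z =
  phi (fun t : R => - t * a t) (derive1 b) c z + phi a b (derive1 c) z.
Proof. by move=> sa sb sc; rewrite derive_phi// /phi /=; ring. Qed.

(** The label depends on [v], so each [v]-derivative falls on [c] or brings out [-t] and a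
    derivative of [b]. Every term is again of the form [phi], with the same support bounds. *)
Lemma derive2_phi_v (a b c : R -> R) : smooth a -> smooth b -> smooth c ->
  'D_ev ('D_ev (phi a b c)) = (fun z =>
  phi (fun t : R => - t * (- t * a t)) (derive1 (derive1 b)) c z +
  phi (fun t : R => - t * a t) (derive1 b) (fun v => 2 * derive1 c v) z +
  phi a b (derive1 (derive1 c)) z).
Proof.
move=> sa sb sc.
have sta : smooth (fun t : R => - t * a t).
  rewrite (_ : (fun t : R => - t * a t) = (fun t : R => (-1 * t) * a t)).
    by apply: smoothM => //; apply: smoothM; [exact: smooth_cst|exact: smooth_id].
  by apply/funext => z; rewrite mulN1r.
have sdb := smooth_derive1 sb; have sdc := smooth_derive1 sc.
have -> : 'D_ev (phi a b c) =
    phi (fun t : R => - t * a t) (derive1 b) c + phi a b (derive1 c).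
  by apply/funext => z; rewrite derive_phi_v.
apply/funext => z.
have h1 := smooth_derivable (z := z) (w := ev) (smooth_phi sta sdb sc).
have h2 := smooth_derivable (z := z) (w := ev) (smooth_phi sa sb sdc).
transitivity ('D_ev (phi (fun t : R => - t * a t) (derive1 b) c) z +
              'D_ev (phi a b (derive1 c)) z); first exact: (deriveD h1 h2).
rewrite (derive_phi_v z sta sdb sc) (derive_phi_v z sa sb sdc).
rewrite /phi; move: (a _) (derive1 (derive1 b) _) (derive1 b _) (b _) (derive1 (derive1 c) _).
by move: (derive1 c _) (c _) => *; ring.
Qed.

Lemma weak_deriv2_slice (h0 h1 h2 psi : R -> R) (c' d' : R) :
  weak_deriv I h0 h1 -> weak_deriv I h1 h2 -> smooth psi -> c' \in I -> d' \in I ->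
  (forall v, psi v != 0 -> c' <= v <= d') ->
  (\int[@leb R]_(v in [set` I]) (h0 v * derive1 (derive1 psi) v)%:E =
   \int[@leb R]_(v in [set` I]) (h2 v * psi v)%:E)%E.
Proof.
move=> h01 h12 sp cI dI sup.
rewrite h01; first last.
- exists c', d'; split => // v; apply: contraNT => /(derive1_supp sup) ->//.
- exact: smooth_derive1.
by rewrite h12 ?oppeK//; exists c', d'.
Qed.

(** The equation is tested with [phi a b c]: the transport part reduces to the derivative of [a],
    and the diffusion is moved back onto [u], where it becomes part of the source. *)
Lemma weak_transport_cut u w1 w2 f : slab_L2 u -> slab_L2 w2 -> slab_L2 f ->
  (\forall y \ae @leb2 R, s <= y.1 <= r -> T1 y.2 ->
    weak_deriv I (fun v => u (y, v)) (fun v => w1 (y, v)) /\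
    weak_deriv I (fun v => w1 (y, v)) (fun v => w2 (y, v))) ->
  kolmogorov_eq I f u ->
  weak_transport I s r (cut u) (cut (fun z => w2 z + f z)).
Proof.
move=> lu lw lf wd ku a b c sa sb sc pb [s' [r' [ss' r'r sua]]] [c' [d' [cI dI suc]]].
have ca := smooth_continuous sa; have cb := smooth_continuous sb.
have cc := smooth_continuous sc.
have cda := smooth_continuous (smooth_derive1 sa).
have cdb := smooth_continuous (smooth_derive1 sb).
have cdc := smooth_continuous (smooth_derive1 sc).
have cddb := smooth_continuous (smooth_derive1 (smooth_derive1 sb)).
have cddc := smooth_continuous (smooth_derive1 (smooth_derive1 sc)).
have pd (g : R -> R) : periodic g -> periodic (derive1 g).
  move=> pg x; rewrite !derive1E !derive_curve; congr (derive1 _ 0).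
  by apply/funext => h; rewrite addrA pg.
have suda t : derive1 a t != 0 -> s' <= t <= r'.
  by apply: contraNT => /(derive1_supp sua) ->.
have sudc v : derive1 c v != 0 -> c' <= v <= d'.
  by apply: contraNT => /(derive1_supp suc) ->.
have suddc v : derive1 (derive1 c) v != 0 -> c' <= v <= d'.
  by apply: contraNT => /(derive1_supp sudc) ->.
have cta (g : R -> R) : continuous g -> continuous (fun t : R => - t * g t).
  move=> cg t; apply: cvgM (cg t); exact: opp_continuous.
have sta (g : R -> R) : (forall t, g t != 0 -> s' <= t <= r') ->
    forall t, - t * g t != 0 -> s' <= t <= r'.
  by move=> hg t; rewrite mulf_eq0 negb_or => /andP[_ /hg].
pose phit := phi (derive1 a) b c.
pose phivv := 'D_ev ('D_ev (phi a b c)).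
have phivvE : phivv = _ := derive2_phi_v sa sb sc.
have iphit : (@leb3 R).-integrable setT (EFin \o (fun z => cut3 u z * phit z)).
  exact: (cut3_phi_integrable lu cda cb cc pb suda suc).
have iphivv : (@leb3 R).-integrable setT (EFin \o (fun z => cut3 u z * phivv z)).
  have i1 := cut3_phi_integrable lu (cta _ (cta _ ca)) cddb cc (pd _ (pd _ pb)) (sta _ (sta _ sua)) suc.
  have c2dc : continuous (fun v => 2 * derive1 c v).
    by move=> v; apply: cvgM (cdc v); exact: cvg_cst.
  have s2dc v : 2 * derive1 c v != 0 -> c' <= v <= d'.
    by rewrite mulf_eq0 negb_or => /andP[_ /sudc].
  have i2 := cut3_phi_integrable lu (cta _ ca) cdb c2dc (pd _ pb) (sta _ sua) s2dc.
  have i3 := cut3_phi_integrable lu ca cb cddc pb sua suddc.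
  have := integrableD_EFin measurableT (integrableD_EFin measurableT i1 i2) i3.
  congr (integrable _ _ (EFin \o _)); apply/funext => z.
  by rewrite phivvE !mulrDr.
have iw2 : (@leb3 R).-integrable setT (EFin \o (fun z => cut3 w2 z * phi a b c z)).
  exact: (cut3_phi_integrable lw ca cb cc pb sua suc).
have ifp : (@leb3 R).-integrable setT (EFin \o (fun z => cut3 f z * phi a b c z)).
  exact: (cut3_phi_integrable lf ca cb cc pb sua suc).
have tphi : test_fun I (phi a b c).
  split; first exact: smooth_phi.
    by move=> t x v; rewrite /phi /= addrAC pb.
  exists s', r', c', d'; split => //; first by rewrite (lt_trans s0).
  move=> t x v; rewrite /phi /= !mulf_eq0 !negb_or -andbA => /and3P[/sua -> _ /suc ->].
  by [].
have a0 t : ~~ (s < t < r) -> a t = 0.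
  move=> nt; have [//|/sua h] := eqVneq (a t) 0; move: nt h => /negP nt /andP[h1 h2]; exfalso.
  by apply: nt; rewrite (lt_le_trans ss' h1) (le_lt_trans h2 r'r).
have da0 t : ~~ (s < t < r) -> derive1 a t = 0.
  move=> nt; have [//|/suda h] := eqVneq (derive1 a t) 0; move: nt h => /negP nt /andP[h1 h2]; exfalso.
  by apply: nt; rewrite (lt_le_trans ss' h1) (le_lt_trans h2 r'r).
(* The test functions vanish outside []s, r[], so integrals over the half-line [time] become
   integrals of functions cut to the slab. *)
have domain (h : V3 -> R) (k : V3 -> R) : (forall z, ~~ (s < z.1.1 < r) -> k z = 0) ->
    (\int[@leb3 R]_(z in @time R `*` @torus R `*` [set` I]) (h z * k z)%:E =
     \int[@leb3 R]_z (cut3 h z * k z)%:E)%E.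
  move=> k0; rewrite [LHS]integral_mkcond; apply: eq_integral => -[[t x] v] _.
  rewrite patchE /cut3 /=; have [str|nstr] := boolP (s < t < r); last first.
    by rewrite k0//= !mulr0; case: ifP.
  have -> : ((t, x, v) \in @time R `*` @torus R `*` [set` I]) = T1 x && (v \in I).
    apply/idP/idP.
      by rewrite in_setE => -[[/= _]]; rewrite /torus /= in_itv /= /T1 => -> /= ->.
    move=> /andP[Tx vI]; apply: mem_set; split => //; split => /=; last by rewrite /torus /= in_itv.
    by case/andP: str => st _; rewrite /time /= in_itv /= andbT (lt_trans s0 st).
  by rewrite /=; case: ifP => // _; rewrite mul0r.
have : (\int[@leb3 R]_(z in @time R `*` @torus R `*` [set` I]) (u z * (- phit z - phivv z))%:E =
    \int[@leb3 R]_(z in @time R `*` @torus R `*` [set` I]) (f z * phi a b c z)%:E)%E.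
  rewrite -(ku _ tphi); apply: eq_integral => z _; congr (_ * (_ - _))%:E.
  rewrite -opprD; congr (- _); symmetry; exact: transport_phi.
rewrite domain; last first.
  move=> z nz; by rewrite phivvE /phit /phi a0// da0// !(mulr0, mul0r, addr0, oppr0).
rewrite domain; last by move=> z nz; rewrite /phi a0// !mul0r.
move=> /(congr1 fine).
rewrite -[LHS]/(\int[@leb3 R]_z (cut3 u z * (- phit z - phivv z))).
rewrite -[RHS]/(\int[@leb3 R]_z (cut3 f z * phi a b c z)).
have -> : \int[@leb3 R]_z (cut3 u z * (- phit z - phivv z)) =
    - (\int[@leb3 R]_z (cut3 u z * phit z)) - (\int[@leb3 R]_z (cut3 u z * phivv z)).
  have -> : - (\int[@leb3 R]_z (cut3 u z * phit z)) = \int[@leb3 R]_z (-1 * (cut3 u z * phit z)).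
    by rewrite RintegralZl// mulN1r.
  rewrite -RintegralB//; last exact: integrableZ_EFin.
  by apply: eq_Rintegral => z _; ring.
(* Two integrations by parts in [v], carried out on almost every slice at fixed [(t, x)]. *)
have -> : \int[@leb3 R]_z (cut3 u z * phivv z) = \int[@leb3 R]_z (cut3 w2 z * phi a b c z).
  rewrite -(Rfubini1 iphivv) -(Rfubini1 iw2) /Rintegral; congr fine.
  apply: ae_eq_integral => //.
  - exact: measurable_int (Rfubini_integrable1 iphivv).
  - exact: measurable_int (Rfubini_integrable1 iw2).
  apply: aeS wd => -[t x] /= h _; congr (fine _)%:E.
  have [/andP[str Tx]|nsT] := boolP ((s < t < r) && T1 x); last first.
    apply: eq_integral => v _; rewrite /cut3 /= andbA (negbTE nsT) /=.
    by rewrite !mul0r.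
  have [|h1 h2] := h _ Tx; first by case/andP: str => *; rewrite !ltW.
  have spsi : smooth (fun v => phi a b c (t, x, v)) by apply/smooth_slice/smooth_phi.
  have supsi v : phi a b c (t, x, v) != 0 -> c' <= v <= d'.
    by rewrite /phi mulf_eq0 negb_or => /andP[_ /suc].
  have dd v : derive1 (derive1 (fun v => phi a b c (t, x, v))) v = phivv (t, x, v).
    transitivity (derive1 (fun v => 'D_ev (phi a b c) (t, x, v)) v).
      congr (derive1 _ v); apply/funext => v'.
      exact: (derive_slice (phi a b c) (t, x) v').
    exact: (derive_slice ('D_ev (phi a b c)) (t, x) v).
  have := weak_deriv2_slice h1 h2 spsi cI dI supsi.
  rewrite [X in X = _ -> _]integral_mkcond [X in _ = X -> _]integral_mkcond => E.
  transitivity (\int[@leb R]_v (((fun v => (u (t, x, v) * derive1 (derive1 (fun v => phi a b c (t, x, v))) v)%:E) \_ [set` I]) v))%E.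
    apply: eq_integral => v _; rewrite patchE /cut3 /= str Tx /= mem_setE.
    by rewrite dd; case: ifP => _ //; rewrite mul0r.
  rewrite E; apply: eq_integral => v _; rewrite patchE /cut3 /= str Tx /= mem_setE.
  by case: ifP => _ //; rewrite mul0r.
move=> E.
have -> : \int[@leb12 R]_z
    (cut u z * (derive1 a z.1 * b (z.2.1 - z.1 * z.2.2) * c z.2.2) +
     cut (fun z => w2 z + f z) z * (a z.1 * b (z.2.1 - z.1 * z.2.2) * c z.2.2)) =
   \int[@leb3 R]_z (cut3 u z * phit z + (cut3 w2 z * phi a b c z + cut3 f z * phi a b c z)).
  rewrite /Rintegral; congr fine; rewrite integral_assoc3.
    apply: eq_integral => z _; congr EFin.
    rewrite /cut /phit /phi /cut3 /=; case: ifP => _; ring.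
  by have := measurable_int _ (integrableD_EFin measurableT iphit (integrableD_EFin measurableT iw2 ifp)).
rewrite !RintegralD//; last exact: integrableD_EFin.
by move: E; set x := \int[_]_z _; set y := \int[_]_z _; set z' := \int[_]_z _; lra.
Qed.

End weak_solutions.

(** * Regular slices and transport: what a weak solution provides on a slab *)

Section package.
Variable R : realType.
Local Notation mR := (measurableTypeR R).
Local Notation mR2 := (mR * mR)%type.
Local Notation mR3 := (mR * mR * mR)%type.
Local Notation V3 := (R * R * R)%type.

Definition slice_regular (I : interval R) (h0 h1 h2 : R -> R) := exists V0 V1 V2 : R -> R,
  [/\ locint V2, primitive V1 V2, primitive V0 V1 &
    \forall v \ae @leb R, v \in I -> [/\ h0 v = V0 v, h1 v = V1 v & h2 v = V2 v]].

Definition transported (I : interval R) (s r : R) (u g : V3 -> R) :=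
  exists Th : set R, [/\ \forall t \ae @leb R, s < t < r -> Th t,
    forall t, Th t -> s < t < r &
    forall t1 t2, Th t1 -> Th t2 -> t1 <= t2 ->
    \forall q \ae @leb2 R, T1 q.1 -> q.2 \in I ->
      (@leb R).-integrable setT (EFin \o (fun t => sh (cut I s r g) (t, q))) /\
      sh (cut I s r u) (t2, q) - sh (cut I s r u) (t1, q) =
      \int[@leb R]_(t in `[t1, t2]%classic) sh (cut I s r g) (t, q)].

(** The part of [solution] that the energy argument uses, on a slab away from [t = 0]. Unlike the
    distributional equation, it is restricted to subintervals and subtracted directly. Here [w1] and
    [w2] are the first two [v]-derivatives of [u]. *)
Definition package (I : interval R) (s r : R) (u w1 w2 f : V3 -> R) :=
  [/\ [/\ slab_L2 I s r u, slab_L2 I s r w1, slab_L2 I s r w2 & slab_L2 I s r f],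
      \forall y \ae @leb2 R, s < y.1 < r -> T1 y.2 ->
        slice_regular I (fun v => u (y, v)) (fun v => w1 (y, v)) (fun v => w2 (y, v)) &
      transported I s r u (fun z => w2 z + f z)].

(** Extension by zero, since [locint] and [primitive] concern functions on the whole line. *)
Definition restrict (I : interval R) (h : R -> R) (v : R) : R := if v \in I then h v else 0.

Section restriction.
Variables (I : interval R) (oI : open_itv I).

Lemma weak_deriv_restrict h0 h1 : weak_deriv I h0 h1 ->
  weak_deriv I (restrict I h0) (restrict I h1).
Proof.
move=> h01 psi sp sup; have := h01 psi sp sup.
suff E (h k : R -> R) : (\int[@leb R]_(v in [set` I]) (restrict I h v * k v)%:E =
    \int[@leb R]_(v in [set` I]) (h v * k v)%:E)%E by rewrite !E.
by apply: eq_integral => v; rewrite mem_setE /restrict => ->.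
Qed.

Lemma weak_deriv2_regular h0 h1 h2 : weak_deriv I h0 h1 -> weak_deriv I h1 h2 ->
  locint (restrict I h0) -> locint (restrict I h1) -> locint (restrict I h2) ->
  slice_regular I h0 h1 h2.
Proof.
move=> /weak_deriv_restrict d0 /weak_deriv_restrict d1 l0 l1 l2.
have [V1 pV1 aV1] := weak_deriv_primitive oI l1 l2 d1.
have [V0' pV0' aV0'] := weak_deriv_primitive oI l0 l1 d0.
have lV1 : locint V1 by apply: locint_continuous; exact: primitive_continuous l2 pV1.
have [[v0 v0I]|nI] := pselect (exists v0, v0 \in I); last first.
  have [V0 pV0 _] := primitive_exists 0 0 lV1.
  exists V0, V1, (restrict I h2); split => //; apply: aeW => v vI.
  by exfalso; apply: nI; exists v.
(* [V0'] is a primitive of [h1] extended by zero, not of the continuous [V1]. The primitive of [V1]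
   with the same value at [v0] agrees with it on [I]. *)
have [V0 pV0 e0] := primitive_exists v0 (V0' v0) lV1.
have V0E v : v \in I -> V0' v = V0 v.
  have E a b : a <= b -> a \in I -> b \in I -> V0' b - V0' a = V0 b - V0 a.
    move=> ab aI bI; rewrite pV0// pV0'// /Rintegral; congr fine.
    apply: ae_eq_integral => //; first exact: measurable_int (l1 a b).
      exact: measurable_int (lV1 a b).
    apply: aeS aV1 => x hx; rewrite /= in_itv /= => abx; congr EFin.
    by apply: hx; exact: mem_itv_convex aI bI abx.
  move=> vI; have [vv0|v0v] := leP v v0.
    by have := E _ _ vv0 vI v0I; rewrite e0; lra.
  by have := E _ _ (ltW v0v) v0I vI; rewrite e0; lra.
exists V0, V1, (restrict I h2); split => //.
apply: aeS (aeI aV0' aV1) => v [h0' h1'] vI.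
move: (h0' vI) (h1' vI); rewrite /restrict vI => -> ->.
by rewrite V0E.
Qed.

End restriction.

Lemma sqr_integrable_locint (h : R -> R) : measurable_fun (T := mR) setT h ->
  (@leb R).-integrable setT (EFin \o (fun v => (h v) ^+ 2)) -> locint h.
Proof.
move=> mh ih a b.
pose k v := if a <= v <= b then h v else 0.
have mk : measurable_fun (T := mR) setT k.
  apply: measurable_fun_ifT => //; exact: (@measurable_mem_itv R `[a, b]).
have ik : (@leb R).-integrable setT (EFin \o k).
  apply: (@integrable_sqr_supp R _ _ (@leb R) `[a, b]%classic) => //.
  - exact: leb_itv_fin.
  - apply: le_lt_trans (integrableP _ _ _ ih).2; apply: ge0_le_integral => //.
    + by move=> v _; rewrite lee_fin sqr_ge0.
    + by apply/measurable_EFinP; exact: measurable_funX.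
    + apply: measurableT_comp => //; exact: measurable_int ih.
    + move=> v _ /=; rewrite lee_fin ger0_norm ?sqr_ge0// /k.
      by case: ifP => // _; rewrite expr0n sqr_ge0.
  - by move=> v; rewrite /= in_itv /= /k => /negP/negbTE ->.
apply: eq_integrable (integrable_locint ik a b); first exact: measurable_itv.
by move=> v; rewrite inE /= in_itv /= /k => ->.
Qed.

Lemma slab_slice (I : interval R) (s r : R) w : slab_L2 I s r w ->
  \forall y \ae @leb2 R, s < y.1 < r -> T1 y.2 ->
    (@leb R).-integrable setT (EFin \o (fun v => (restrict I (fun v => w (y, v)) v) ^+ 2)) /\
    locint (restrict I (fun v => w (y, v))).
Proof.
move=> lw; have [mw _] := lw; have [_ _ iw] := slab_cut_L2 lw.
have mcw := measurable_cut3 mw.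
have i2 : (@leb3 R).-integrable setT (EFin \o (fun z => (cut3 I s r w z) ^+ 2)).
  have mc2 : measurable_fun (T := mR3) setT (fun z => ((cut3 I s r w z) ^+ 2)%:E).
    by apply/measurable_EFinP; exact: measurable_funX.
  apply/integrableP; split => //.
  under eq_integral do rewrite /= ger0_norm ?sqr_ge0//.
  by rewrite (ge0_integral_assoc3 mc2)// => z; rewrite lee_fin sqr_ge0.
apply: aeS (Rfubini_ae1 i2) => -[t x] /= iv str Tx.
have E : restrict I (fun v => w (t, x, v)) = (fun v => cut3 I s r w (t, x, v)).
  by apply/funext => v; rewrite /restrict /cut3 /= str Tx.
rewrite E; split => //; apply: sqr_integrable_locint => //.
exact: (measurable_fun_pair2 (t, x) mcw).
Qed.

Lemma sol_package (I : interval R) (s r : R) f u0 u : open_itv I -> 0 < s ->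
  solution I f u0 u -> slab_L2 I s r f -> exists w1 w2, package I s r u w1 w2 f.
Proof.
move=> oI s0 [hu ku _] lf; have [w [w0 mw [C hC] dw]] := hu s r s0.
have lw i : (i <= 2)%N -> slab_L2 I s r (w i).
  move=> i2; split; first exact: mw.
  by exists C; apply: aeS (hC i i2) => t ht str; apply: ht; rewrite /= in_itv.
have d0 := dw 0%N isT; have d1 := dw 1%N isT.
rewrite w0 in d0.
have lu : slab_L2 I s r u by rewrite -w0; exact: lw.
have dd : \forall y \ae @leb2 R, s <= y.1 <= r -> T1 y.2 ->
    weak_deriv I (fun v => u (y, v)) (fun v => w 1%N (y, v)) /\
    weak_deriv I (fun v => w 1%N (y, v)) (fun v => w 2%N (y, v)).
  apply: aeS (aeI d0 d1) => -[t x] [h0 h1] /= str Tx.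
  by split; [apply: h0|apply: h1]; split; rewrite /= /torus /= in_itv.
exists (w 1%N), (w 2%N); split; first by split => //; exact: lw.
  apply: aeS (aeI dd (aeI (slab_slice lu) (aeI (slab_slice (lw 1%N isT)) (slab_slice (lw 2%N isT))))).
  move=> -[t x] [h [h0 [h1 h2]]] /= str Tx.
  have [|k0 k1] := h _ Tx; first by case/andP: str => *; rewrite !ltW.
  apply: weak_deriv2_regular => //; first by case: (h0 str Tx).
    by case: (h1 str Tx).
  by case: (h2 str Tx).
apply: characteristics => //; first exact: slab_cut_L2.
  by apply: slab_cut_L2; apply: slab_L2D => //; exact: lw.
exact: (weak_transport_cut s0 lu (lw 2%N isT) lf dd ku).
Qed.

End package.

(** * Restriction and difference of packages *)

Section package_operations.
Variable R : realType.
Local Notation mR := (measurableTypeR R).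
Local Notation mR2 := (mR * mR)%type.
Local Notation mR3 := (mR * mR * mR)%type.
Local Notation V3 := (R * R * R)%type.
Implicit Types (I : interval R) (s r : R).

Lemma slab_L2S I I1 s r (w : V3 -> R) : {subset I <= I1} -> slab_L2 I1 s r w -> slab_L2 I s r w.
Proof.
move=> II1 [mw [C hC]]; split.
  apply: measurable_funS mw; first exact: measurable_slab.
  by move=> [[t x] v] [/= tx vI]; split => //=; exact: II1.
exists C; apply: aeS hC => t ht str; apply: le_trans (ht str).
apply: ge0_subset_integral.
- exact: measurable_base.
- exact: measurable_base.
- by apply/measurable_EFinP/measurable_funX; exact: (measurable_slab_slice mw str).
- by move=> y _; rewrite lee_fin sqr_ge0.
- by move=> [x v] [/= xT vI]; split => //=; exact: II1.
Qed.

Lemma slab_L2B I s r (w1 w2 : V3 -> R) : slab_L2 I s r w1 -> slab_L2 I s r w2 ->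
  slab_L2 I s r (fun z => w1 z - w2 z).
Proof.
move=> l1 [mw [C hC]]; apply: slab_L2D l1 _; split.
  exact: (measurableT_comp (@oppr_measurable R setT) mw).
exists C; apply: aeS hC => t ht str; apply: le_trans (ht str).
by under eq_integral do rewrite sqrrN.
Qed.

Lemma slice_regularB I (h0 h1 h2 k0 k1 k2 : R -> R) :
  slice_regular I h0 h1 h2 -> slice_regular I k0 k1 k2 ->
  slice_regular I (fun v => h0 v - k0 v) (fun v => h1 v - k1 v) (fun v => h2 v - k2 v).
Proof.
move=> [V0 [V1 [V2 [l2 p1 p0 h]]]] [W0 [W1 [W2 [m2 q1 q0 k]]]].
have l1 : locint V1 := locint_continuous (primitive_continuous l2 p1).
have m1 : locint W1 := locint_continuous (primitive_continuous m2 q1).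
exists (fun v => V0 v - W0 v), (fun v => V1 v - W1 v), (fun v => V2 v - W2 v); split.
- exact: locintB.
- exact: primitiveB.
- exact: primitiveB.
- apply: aeS (aeI h k) => v [{}h {}k] vI.
  by have [-> -> ->] := h vI; have [-> -> ->] := k vI.
Qed.

Lemma slice_regularS I I1 (h0 h1 h2 : R -> R) : {subset I <= I1} ->
  slice_regular I1 h0 h1 h2 -> slice_regular I h0 h1 h2.
Proof.
move=> II1 [V0 [V1 [V2 [l2 p1 p0 h]]]]; exists V0, V1, V2; split => //.
by apply: aeS h => v h /II1 /h.
Qed.

Lemma sh_cutB I I1 I2 s r (g1 g2 : V3 -> R) t q : {subset I <= I1} -> {subset I <= I2} ->
  q.2 \in I -> sh (cut I s r (fun z => g1 z - g2 z)) (t, q) =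
    sh (cut I1 s r g1) (t, q) - sh (cut I2 s r g2) (t, q).
Proof.
move=> II1 II2 qI; rewrite /sh /cut /cut3 /= qI (II1 _ qI) (II2 _ qI).
by case: ifP => _; [case: ifP => _|]; rewrite ?subr0.
Qed.

Lemma transportedB I I1 I2 s r (u1 u2 g1 g2 : V3 -> R) :
  {subset I <= I1} -> {subset I <= I2} ->
  transported I1 s r u1 g1 -> transported I2 s r u2 g2 ->
  transported I s r (fun z => u1 z - u2 z) (fun z => g1 z - g2 z).
Proof.
move=> II1 II2 [Th1 [full1 sub1 h1]] [Th2 [full2 sub2 h2]].
exists (Th1 `&` Th2); split.
- by apply: aeS (aeI full1 full2) => t [? ?] ?; split; auto.
- by move=> t [/sub1].
move=> t1 t2 [t11 t12] [t21 t22] t1t2.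
apply: aeS (aeI (h1 _ _ t11 t21 t1t2) (h2 _ _ t12 t22 t1t2)) => q [k1 k2] Tq qI.
have [i1 e1] := k1 Tq (II1 _ qI); have [i2 e2] := k2 Tq (II2 _ qI).
have E : (fun t => sh (cut I s r (fun z => g1 z - g2 z)) (t, q)) =
    (fun t => sh (cut I1 s r g1) (t, q) - sh (cut I2 s r g2) (t, q)).
  by apply/funext => t; exact: sh_cutB.
rewrite E; split; first exact: integrableB_EFin.
rewrite !(sh_cutB _ _ _ _ _ II1 II2 qI) RintegralB//.
- by rewrite -e1 -e2; ring.
- exact: integrable_locint i1 _ _.
- exact: integrable_locint i2 _ _.
Qed.

Lemma packageB I I1 I2 s r (u1 v1 w1 f1 u2 v2 w2 f2 : V3 -> R) :
  {subset I <= I1} -> {subset I <= I2} ->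
  package I1 s r u1 v1 w1 f1 -> package I2 s r u2 v2 w2 f2 ->
  package I s r (fun z => u1 z - u2 z) (fun z => v1 z - v2 z) (fun z => w1 z - w2 z)
    (fun z => f1 z - f2 z).
Proof.
move=> II1 II2 [[lu1 lv1 lw1 lf1] sl1 tr1] [[lu2 lv2 lw2 lf2] sl2 tr2]; split.
- by split; [exact: slab_L2B (slab_L2S II1 lu1) (slab_L2S II2 lu2)|
    exact: slab_L2B (slab_L2S II1 lv1) (slab_L2S II2 lv2)|
    exact: slab_L2B (slab_L2S II1 lw1) (slab_L2S II2 lw2)|
    exact: slab_L2B (slab_L2S II1 lf1) (slab_L2S II2 lf2)].
- apply: aeS (aeI sl1 sl2) => y [h1 h2] yr Ty.
  apply: slice_regularB; first exact: slice_regularS II1 (h1 yr Ty).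
  exact: slice_regularS II2 (h2 yr Ty).
- rewrite (_ : (fun z => w1 z - w2 z + (f1 z - f2 z)) =
    (fun z => (w1 z + f1 z) - (w2 z + f2 z))); first exact: transportedB tr1 tr2.
  by apply/funext => z; ring.
Qed.

(** Gives [0 - U] a package through [packageB], which turns upper bounds into two-sided ones. *)
Lemma package0 I s r : package I s r (fun=> 0) (fun=> 0) (fun=> 0) (fun=> 0).
Proof.
have l0 : slab_L2 I s r (fun=> 0).
  split; first exact: measurable_cst.
  exists 0; apply: aeW => t _; rewrite integral0_eq// => y _.
  by rewrite expr0n.
have lc (c : R) : locint (fun=> c).
  by apply: locint_continuous => x; exact: cvg_cst.
have p0 : primitive (fun=> 0 : R) (fun=> 0 : R).
  by move=> a b ab; rewrite Rintegral_eq0 ?subrr.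
have c0 t q : sh (cut I s r (fun=> 0)) (t, q) = 0.
  by rewrite /sh /cut /cut3; case: ifP => //; case: ifP.
split; first by split.
  by apply: aeW => y _ _; exists (fun=> 0), (fun=> 0), (fun=> 0); split => //; apply: aeW.
exists [set t | s < t < r]; split; [exact: aeW|by []|].
move=> t1 t2 _ _ t12; apply: aeW => q Tq qI.
rewrite (_ : (fun=> 0 + 0) = (fun=> 0)); last by apply/funext => z; rewrite addr0.
rewrite !c0 subrr; split; last by rewrite Rintegral_eq0.
rewrite (_ : (fun t => _) = cst 0); last by apply/funext => t; rewrite c0.
exact: (@integrable0 _ _ _ (@leb R) setT).
Qed.

End package_operations.

(** * The diffusion term on velocity slices *)

Lemma ae_le_Rintegral d (X : measurableType d) (R : realType)
    (mu : {measure set X -> \bar R}) (f g : X -> R) :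
  mu.-integrable setT (EFin \o f) -> mu.-integrable setT (EFin \o g) ->
  (\forall x \ae mu, f x <= g x) -> \int[mu]_x f x <= \int[mu]_x g x.
Proof.
move=> fi gi fg; have di := integrableB_EFin measurableT gi fi.
rewrite -subr_ge0 -RintegralB//.
have -> : \int[mu]_x (g x - f x) = \int[mu]_x `|g x - f x|.
  rewrite /Rintegral; congr fine; apply: ae_eq_integral => //.
  - exact: measurable_int di.
  - apply/measurable_EFinP; apply: measurableT_comp => //.
    by apply/measurable_EFinP; exact: measurable_int di.
  - by apply: aeS fg => x fgx _; rewrite ger0_norm ?subr_ge0.
by apply: Rintegral_ge0 => x _; exact: normr_ge0.
Qed.

Section slice_inequality.
Variable R : realType.
Local Notation mR := (measurableTypeR R).

(** One notation for the line and both half-lines: [Some] marks a finite end, which carries a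
    boundary condition, and [None] an infinite one. *)
Definition oitv (l u : option R) : interval R :=
  Interval (if l is Some x then BRight x else -oo%O) (if u is Some x then BLeft x else +oo%O).

Definition lb (l : option R) (v : R) := if l is Some x then x < v else true.
Definition ub (u : option R) (v : R) := if u is Some x then v < x else true.

Lemma in_oitv l u v : (v \in oitv l u) = lb l v && ub u v.
Proof. by rewrite in_itv; case: l u => [x|] [y|]. Qed.

Lemma open_oitv l u : open_itv (oitv l u).
Proof.
move=> v; rewrite in_oitv => /andP[lv uv].
have [c [cv lc]] : exists c, c < v /\ lb l c.
  by case: l lv => [x|] /= lv; [exists ((x + v) / 2); split; lra|exists (v - 1); split => //; lra].
have [d [vd ud]] : exists d, v < d /\ ub u d.
  by case: u uv => [x|] /= uv; [exists ((x + v) / 2); split; lra|exists (v + 1); split => //; lra].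
exists c, d; rewrite !in_oitv lc ud andbT /=; split => //.
  by case: u uv ud => [x|] //= uv ud; rewrite (lt_trans cv uv).
by case: l lv lc => [x|] //= lv lc; rewrite (lt_trans lv vd).
Qed.

(** Otherwise the integrable [h] would be at least [e] almost everywhere on a set of infinite
    measure. *)
Lemma exists_small (g h : R -> R) (D : set mR) (e : R) : measurable D -> (@leb R D = +oo)%E ->
  (@leb R).-integrable setT (EFin \o h) -> (forall v, 0 <= h v) ->
  (\forall v \ae @leb R, D v -> g v <= h v) -> 0 < e -> exists2 b, D b & g b < e.
Proof.
move=> mD Doo ih h0 gh e0; apply: contrapT => nb.
have ge b : D b -> e <= g b.
  by move=> Db; rewrite leNgt; apply/negP => gb; apply: nb; exists b.
have mh := measurable_int _ ih.
suff : (\int[@leb R]_(v in D) e%:E < +oo)%E.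
  by rewrite integral_cst//= Doo gt0_muley ?lte_fin// ltxx.
apply: (@le_lt_trans _ _ (\int[@leb R]_v (h v)%:E)%E); last first.
  have [_] := integrableP _ _ _ ih; congr (_ < _)%E; apply: eq_integral => v _ /=.
  by rewrite ger0_norm.
apply: (@le_trans _ _ (\int[@leb R]_(v in D) (h v)%:E)%E).
  apply: ae_ge0_le_integral => //.
  - by move=> v _; rewrite lee_fin ltW.
  - by move=> v _; rewrite lee_fin.
  - exact: measurable_funTS.
  - by apply: aeS gh => v hv Dv; rewrite lee_fin (le_trans (ge _ Dv)) ?hv.
by apply: ge0_subset_integral => // v _; rewrite lee_fin.
Qed.

Lemma leb_ray_right (N : R) : (@leb R `[N, +oo[%classic = +oo)%E.
Proof. by have := @lebesgue_measure_itv R `[N, +oo[; rewrite /= ltry. Qed.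

Lemma leb_ray_left (N : R) : (@leb R `]-oo, N]%classic = +oo)%E.
Proof. by have := @lebesgue_measure_itv R `]-oo, N]; rewrite /= ltNyr. Qed.

(* The sequences [a], [b] go to the ends of [I]: an infinite end is approached along
   points where the boundary terms are small, which exist by integrability. *)
Lemma slice_limit (I : interval R) (Z Y F h : R -> R) (a b : nat -> R) :
  locint F -> primitive Y F -> primitive Z Y ->
  (@leb R).-integrable setT (EFin \o restrict I h) ->
  (\forall v \ae @leb R, v \in I -> h v <= pos (Z v) * F v) ->
  (forall n, pos (Z (b n)) * Y (b n) <= n.+1%:R^-1) ->
  (forall n, - (pos (Z (a n)) * Y (a n)) <= n.+1%:R^-1) ->
  (forall v, v \in I -> \forall n \near \oo, a n < v < b n) ->
  (forall n v, a n < v < b n -> v \in I) ->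
  \int[@leb R]_v restrict I h v <= 0.
Proof.
move=> lF pY pZ ih hF bb ba near sub.
have cY := primitive_continuous lF pY; have lY := locint_continuous cY.
have cZ := primitive_continuous lY pZ.
have cpZ : continuous (fun v => pos (Z v)).
  by move=> v; exact: continuous_comp (cZ v) (@pos_continuous _ _).
have lp : locint (fun v => pos (Z v) * F v) by exact: locintM.
pose k n (v : R) : R := if a n < v < b n then 1 else 0.
pose k' (v : R) : R := if v \in I then 1 else 0.
have mitv n : measurable_fun (T := mR) setT (fun v => a n < v < b n).
  exact: (@measurable_mem_itv R `]a n, b n[).
have lim : \int[@leb R]_v (restrict I h v * k n v) @[n --> \oo] -->
    \int[@leb R]_v (restrict I h v * k' v).
  apply: Rintegral_bounded_cvg => //.
  - by move=> n; apply: measurable_fun_ifT.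
  - by move=> n v _; rewrite /k; case: ifP => _; rewrite ?normr1 ?normr0.
  - move=> v _; rewrite /k'; case: ifPn => vI.
      apply: cvg_near_cst; apply: filterS (near v vI) => n.
      by rewrite /k => ->.
    rewrite (_ : (fun n => k n v) = fun=> 0); first exact: cvg_cst.
    apply/funext => n; rewrite /k; case: ifPn => // /sub vI'.
    by rewrite vI' in vI.
rewrite (_ : \int[@leb R]_v restrict I h v = \int[@leb R]_v (restrict I h v * k' v)); last first.
  by apply: eq_Rintegral => v _; rewrite /restrict /k'; case: ifP; rewrite ?mulr1 ?mul0r.
have bound n : \int[@leb R]_v (restrict I h v * k n v) <= 2 * n.+1%:R^-1.
  have [ab|ba'] := leP (a n) (b n); last first.
    rewrite Rintegral_eq0 ?mulr_ge0// => v _; rewrite /k.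
    by case: ifPn => [/andP[av vb]|]; [exfalso; have := lt_trans av vb; lra|rewrite mulr0].
  have ipk : (@leb R).-integrable setT (EFin \o (fun v => if a n < v < b n then pos (Z v) * F v else 0)).
    have lo : (@leb R).-integrable `]a n, b n[%classic (EFin \o (fun v => pos (Z v) * F v)).
      apply: (@integrableS _ _ _ (@leb R) `[a n, b n]%classic) (lp (a n) (b n)) => //.
      by apply: subset_itvW.
    have := (@integrable_mkcond _ _ _ (@leb R) _ (EFin \o (fun v => pos (Z v) * F v)) (measurable_itv `]a n, b n[)).1 lo.
    apply: eq_integrable => // v _; rewrite patchE mem_setE in_itv /=.
    by case: ifP.
  apply: (@le_trans _ _ (\int[@leb R]_v (if a n < v < b n then pos (Z v) * F v else 0))).
    apply: ae_le_Rintegral => //.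
      apply: eq_integrable (integrable_if (mitv n) ih) => // v _ /=.
      by rewrite /k; case: ifP; rewrite ?mulr1 ?mulr0.
    apply: aeS hF => v hv; rewrite /k; case: ifPn => [|_]; last by rewrite mulr0.
    by move=> /sub vI; rewrite mulr1 /restrict vI hv.
  have <- : \int[@leb R]_(v in `[a n, b n]%classic) (pos (Z v) * F v) =
      \int[@leb R]_v (if a n < v < b n then pos (Z v) * F v else 0).
    rewrite locint_oo; last exact: lp.
    rewrite Rintegral_mkcond; apply: eq_Rintegral => v _.
    by rewrite patchE mem_setE in_itv.
  apply: le_trans (primitive_pos_mul lF pY pZ ab) _.
  by rewrite mulr_natl mulr2n; apply: lerD; [exact: bb|exact: ba].
have lim0 : 2 * n.+1%:R^-1 @[n --> \oo] --> (0 : R).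
  by rewrite -[X in _ --> X](mulr0 2); apply: cvgM; [exact: cvg_cst|exact: cvg_harmonic].
by apply: ler_cvg_to lim lim0 _; exact: nearW.
Qed.

(* For [k = 1] or [-1] this solves [w_t + v w_x = w_vv] exactly, and for [k = 0] it
   dominates any source bounded by [M]. *)
Definition barrier (M k c t v : R) : R := M * expR (t + k * (v - c)).

Lemma barrier_ge0 M k c t v : 0 <= M -> 0 <= barrier M k c t v.
Proof. by move=> M0; rewrite mulr_ge0// expR_ge0. Qed.

Lemma primitive_expR (M k l : R) :
  primitive (fun x => M * expR (k * x + l)) (fun x => k * (M * expR (k * x + l))).
Proof.
have D x : is_derive x (1 : R) (fun x => M * expR (k * x + l)) (k * (M * expR (k * x + l))).
  apply: is_derive_eq; rewrite /GRing.scale /=; ring.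
have cF : continuous (fun x : R => M * expR (k * x + l)).
  by move=> x; apply/differentiable_continuous/derivable1_diffP; have [] := D x.
apply: primitive_derive => //.
- by move=> x; apply: cvgM (cF x); exact: cvg_cst.
- by move=> x; rewrite derive1E; have [_] := D x.
Qed.

Lemma barrier_v M k c t : primitive (barrier M k c t) (fun v => k * barrier M k c t v).
Proof.
have := primitive_expR M k (t - k * c); congr primitive.
  by apply/funext => v; rewrite /barrier; congr (_ * expR _); ring.
by apply/funext => v; rewrite /barrier; congr (_ * (_ * expR _)); ring.
Qed.

Lemma barrier_t M k c v : primitive (barrier M k c ^~ v) (barrier M k c ^~ v).
Proof.
have := primitive_expR M 1 (k * (v - c)); congr primitive.
  by apply/funext => t; rewrite /barrier mul1r.
by apply/funext => t; rewrite /barrier !mul1r.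
Qed.

Lemma locint_expR (M k l : R) : locint (fun x => M * expR (k * x + l)).
Proof.
apply: locint_continuous => x.
apply: cvgM; first exact: cvg_cst.
apply: continuous_comp; last exact: continuous_expR.
exact: smooth_continuous (smooth_affine k l) x.
Qed.

Lemma locint_barrier_v M k c t : locint (barrier M k c t).
Proof.
rewrite (_ : barrier M k c t = (fun v => M * expR (k * v + (t - k * c)))).
  exact: locint_expR.
by apply/funext => v; rewrite /barrier; congr (_ * expR _); ring.
Qed.

Lemma locint_barrier_t M k c v : locint (barrier M k c ^~ v).
Proof.
rewrite (_ : barrier M k c ^~ v = (fun t => M * expR (1 * t + k * (v - c)))).
  exact: locint_expR.
by apply/funext => t; rewrite /barrier mul1r.
Qed.

(** Where the positive part is not 0, [0 <= w < V0], so [w] can be replaced by [V0]. The bound is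
    free of [w] and hence integrable even where the barrier is not. *)
Lemma pos_mul_bound (V0 V1 w k : R) : 0 <= w -> `|k| <= 1 ->
  `|pos (V0 - w) * (V1 - k * w)| <= 2 * V0 ^+ 2 + V1 ^+ 2.
Proof.
move=> w0 k1; have [Vw|wV] := leP V0 w.
  rewrite pos_le0 ?subr_le0// mul0r normr0.
  by apply: addr_ge0; [apply: mulr_ge0 => //|]; exact: sqr_ge0.
have Vw : 0 <= V0 - w by rewrite subr_ge0 ltW.
rewrite (pos_gt0E Vw) normrM (ger0_norm Vw).
have h1 : `|V1 - k * w| <= `|V1| + V0.
  apply: le_trans (ler_normB _ _) _; rewrite lerD2l normrM (ger0_norm w0).
  by apply: le_trans (ltW wV); rewrite ler_piMl.
have h2 : (V0 - w) * `|V1 - k * w| <= V0 * (`|V1| + V0).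
  by apply: ler_pM => //; lra.
apply: le_trans h2 _; rewrite -[V1 ^+ 2]real_normK ?num_real//.
have := sqr_ge0 (V0 - `|V1|); have := sqr_ge0 V0; have := sqr_ge0 `|V1|; nra.
Qed.

(** One-sided boundary condition, quantified over continuous representatives so that it applies to
    the one supplied by [slice_regular]. *)
Definition below (I : interval R) (h0 : R -> R) (e y : R) :=
  forall h' : R -> R, continuous h' -> (\forall v \ae @leb R, v \in I -> h0 v = h' v) -> h' e <= y.

(** Integration by parts of [(h0 - w)_+ (h0 - w)_vv]. Finite ends contribute nothing because
    [(h0 - w)_+] vanishes there, infinite ends because the boundary term is dominated by an
    integrable function. Only an upper bound on [F] is asked, which is how the source is
    absorbed. *)
Lemma slice_le0 (l u : option R) (h0 h1 h2 F : R -> R) (M k c t : R) :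
  let I := oitv l u in let w := barrier M k c t in
  0 <= M -> `|k| <= 1 -> slice_regular I h0 h1 h2 ->
  (@leb R).-integrable setT (EFin \o (fun v => (restrict I h0 v) ^+ 2)) ->
  (@leb R).-integrable setT (EFin \o (fun v => (restrict I h1 v) ^+ 2)) ->
  (forall e, l = Some e \/ u = Some e -> below I h0 e (w e)) ->
  (@leb R).-integrable setT (EFin \o restrict I F) ->
  (\forall v \ae @leb R, v \in I -> F v <= pos (h0 v - w v) * (h2 v - k ^+ 2 * w v)) ->
  \int[@leb R]_v restrict I F v <= 0.
Proof.
move=> I w M0 k1 [V0 [V1 [V2 [l2 p1 p0 hV]]]] i0 i1 bd iF hF.
have [[v0 v0I]|nI] := pselect (exists v0, v0 \in I); last first.
  rewrite Rintegral_eq0// => v _; rewrite /restrict; case: ifPn => // vI.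
  by exfalso; apply: nI; exists v.
have l1 : locint V1 := locint_continuous (primitive_continuous l2 p1).
have cV0 : continuous V0 := primitive_continuous l1 p0.
have lw : locint w := locint_barrier_v M k c t.
have lkw : locint (fun v => k * w v) := locintZ k lw.
pose Z v := V0 v - w v; pose Y v := V1 v - k * w v; pose G v := V2 v - k ^+ 2 * w v.
have pw : primitive w (fun v => k * w v) := barrier_v M k c t.
have pkw : primitive (fun v => k * w v) (fun v => k ^+ 2 * w v).
  by have := primitiveZ k lkw pw; congr primitive; apply/funext => v; rewrite mulrA expr2.
have lk2w : locint (fun v => k ^+ 2 * w v) := locintZ _ lw.
have lG : locint G by exact: locintB.
have pZ : primitive Z Y by exact: primitiveB.
have pY : primitive Y G by exact: primitiveB.
pose h v := 2 * (restrict I h0 v) ^+ 2 + (restrict I h1 v) ^+ 2.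
have ih : (@leb R).-integrable setT (EFin \o h).
  by apply: integrableD_EFin => //; exact: integrableZ_EFin.
have h_ge0 v : 0 <= h v by apply: addr_ge0; [apply: mulr_ge0 => //|]; exact: sqr_ge0.
pose g v := `|pos (Z v) * Y v|.
have gh : \forall v \ae @leb R, v \in I -> g v <= h v.
  apply: aeS hV => v hv vI; have [e0 e1 _] := hv vI.
  by rewrite /h /restrict vI e0 e1; apply: pos_mul_bound => //; exact: barrier_ge0.
have far (D : set mR) n : measurable D -> (@leb R D = +oo)%E -> (forall v, D v -> v \in I) ->
    exists2 b, D b & g b < n.+1%:R^-1.
  move=> mD Doo DI; apply: (@exists_small g h D) => //.
    by apply: aeS gh => v hv Dv; exact: hv (DI _ Dv).
have V0le e : l = Some e \/ u = Some e -> pos (Z e) = 0.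
  move=> /bd hb; apply: pos_le0; rewrite subr_le0; apply: hb => //.
  by apply: aeS hV => v hv vI; have [] := hv vI.
have [b [b1 b2 b3]] : exists b : nat -> R, [/\ forall n, pos (Z (b n)) * Y (b n) <= n.+1%:R^-1,
    forall v, v \in I -> \forall n \near \oo, v < b n & forall n v, v < b n -> ub u v].
  case Eu : u => [e|].
    exists (fun=> e); split => //; first by move=> n; rewrite V0le ?mul0r//; right.
    by move=> v; rewrite in_oitv Eu => /andP[_ ve]; exact: nearW.
  (* [n <= b] sends the sequence to infinity; choosing [b] to the right of [v0] as well keeps it in
     [I]. *)
  have ex n : exists b, n%:R <= b /\ pos (Z b) * Y b <= n.+1%:R^-1.
    have [||v Dv|b Db gb] := @far `[Num.max n%:R v0, +oo[%classic n.
    - exact: measurable_itv.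
    - exact: leb_ray_right.
    - move: Dv v0I; rewrite /= in_itv /= andbT ge_max => /andP[_ v0v].
      rewrite !in_oitv Eu !andbT; case: (l) => //= x xv0; exact: lt_le_trans xv0 v0v.
    - exists b; split; last by rewrite (le_trans _ (ltW gb))// ler_norm.
      by move: Db; rewrite /= in_itv /= andbT ge_max => /andP[].
  have [b hb] := choice ex; exists b; split => //; first by move=> n; have [] := hb n.
  move=> v _; apply: filterS (nbhs_infty_gtr v) => n vn.
  by have [nb _] := hb n; exact: lt_le_trans vn nb.
have [a [a1 a2 a3]] : exists a : nat -> R, [/\ forall n, - (pos (Z (a n)) * Y (a n)) <= n.+1%:R^-1,
    forall v, v \in I -> \forall n \near \oo, a n < v & forall n v, a n < v -> lb l v].
  case El : l => [e|].
    exists (fun=> e); split => //; first by move=> n; rewrite V0le ?mul0r ?oppr0//; left.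
    by move=> v; rewrite in_oitv El => /andP[ve _]; exact: nearW.
  have ex n : exists a, a <= - n%:R /\ - (pos (Z a) * Y a) <= n.+1%:R^-1.
    have [||v Dv|a Da ga] := @far `]-oo, Num.min (- n%:R) v0]%classic n.
    - exact: measurable_itv.
    - exact: leb_ray_left.
    - move: Dv v0I; rewrite /= in_itv /= le_min => /andP[_ v0v].
      rewrite !in_oitv El /=; case: (u) => //= x xv0; exact: le_lt_trans v0v xv0.
    - exists a; split; last by apply: (le_trans _ (ltW ga)); rewrite /g -normrN ler_norm.
      by move: Da; rewrite /= in_itv /= le_min => /andP[].
  have [a ha] := choice ex; exists a; split => //; first by move=> n; have [] := ha n.
  move=> v _; apply: filterS (nbhs_infty_gtr (- v)) => n vn.
  by have [na _] := ha n; apply: le_lt_trans na _; rewrite ltrNl.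
apply: (slice_limit lG pY pZ iF _ b1 a1).
- apply: aeS (aeI hV hF) => v [hv hf] vI; have [e0 _ e2] := hv vI.
  by move: (hf vI); rewrite e0 e2.
- by move=> v vI; apply: filterS2 (a2 v vI) (b2 v vI) => n -> ->.
- by move=> n v /andP[/a3 lv /b3 uv]; rewrite in_oitv lv uv.
Qed.

End slice_inequality.

(** * The energy inequality *)

Lemma measurable_Rintegral_param d1 d2 (X : measurableType d1) (Y : measurableType d2)
    (R : realType) (m : {sigma_finite_measure set Y -> \bar R}) (K : X * Y -> R) :
  measurable_fun setT K -> measurable_fun setT (fun x => \int[m]_y K (x, y)).
Proof.
move=> mK; have mE : measurable_fun setT (EFin \o K) by exact/measurable_EFinP.
apply: measurableT_comp => //.
have E : (fun x => \int[m]_y (K (x, y))%:E)%E =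
    (fun x => fubini_F m (EFin \o K)^\+ x - fubini_F m (EFin \o K)^\- x)%E.
  apply/funext => x; rewrite integralE.
  by congr (_ - _)%E; apply: eq_integral => y _; rewrite ?funeposE ?funenegE.
rewrite E; apply: emeasurable_funB.
  exact: measurable_fun_fubini_tonelli_F (measurable_funepos mE) (fun=> funepos_ge0 _ _).
exact: measurable_fun_fubini_tonelli_F (measurable_funeneg mE) (fun=> funeneg_ge0 _ _).
Qed.

Section energy.
Variable R : realType.
Local Notation mR := (measurableTypeR R).
Local Notation mR2 := (mR * mR)%type.
Local Notation mR3 := (mR * mR * mR)%type.
Local Notation V3 := (R * R * R)%type.
Variables (l u : option R) (s r : R) (U w1 w2 f : V3 -> R) (M k c : R).
Let I := oitv l u.
Let w (z : V3) := barrier M k c z.1.1 z.2.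
Hypotheses (M0 : 0 <= M) (k1 : `|k| <= 1).
Hypothesis pkg : package I s r U w1 w2 f.
Hypothesis fw : \forall z \ae @leb3 R, s < z.1.1 < r -> T1 z.1.2 -> z.2 \in I ->
  f z <= (1 - k ^+ 2) * w z.
Hypothesis bd : \forall y \ae @leb2 R, s < y.1 < r -> T1 y.2 ->
  forall e, l = Some e \/ u = Some e -> below I (fun v => U (y, v)) e (w (y, e)).

Let g (z : V3) := w2 z + f z.
Let P (z : V3) := (pos (U z - w z)) ^+ 2.
(** Half the derivative of [P] along characteristics: [U] has derivative [g] there, and the barrier,
    independent of [x], has derivative [w]. *)
Let H (z : V3) := pos (U z - w z) * (g z - w z).

Lemma solution_slab : slab_L2 I s r U.
Proof. by have [[]] := pkg. Qed.
Lemma source_slab : slab_L2 I s r g.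
Proof. by have [[_ _ l2 l3] _ _] := pkg; exact: slab_L2D. Qed.

Lemma measurable_barrier : measurable_fun (T := mR3) setT w.
Proof.
have m11 : measurable_fun (T := mR3) (U := mR) setT (fun z => z.1.1).
  exact: (measurableT_comp (@measurable_fst _ _ mR mR) (@measurable_fst _ _ mR2 mR)).
have m2 : measurable_fun (T := mR3) (U := mR) setT (fun z => z.2).
  exact: (@measurable_snd _ _ mR2 mR).
apply: measurable_funM; first exact: measurable_cst.
apply: (measurableT_comp (@measurable_expR R)).
apply: measurable_funD => //; apply: measurable_funM; first exact: measurable_cst.
by apply: measurable_funB => //; exact: measurable_cst.
Qed.

Lemma measurable_excess : measurable_fun (T := mR3) (slab I s r) (fun z => pos (U z - w z)).
Proof.
apply: (measurableT_comp (continuous_measurable_fun (@pos_continuous R))).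
apply: measurable_funB; first by have [] := solution_slab.
exact: measurable_funTS measurable_barrier.
Qed.

Lemma measurable_sqr_excess : measurable_fun (T := mR3) (slab I s r) P.
Proof. exact: measurable_funX measurable_excess. Qed.

Lemma measurable_dissipation : measurable_fun (T := mR3) (slab I s r) H.
Proof.
apply: measurable_funM measurable_excess _; apply: measurable_funB; first by have [] := source_slab.
exact: measurable_funTS measurable_barrier.
Qed.

Lemma weight_ge0 z : 0 <= w z.
Proof. exact: barrier_ge0. Qed.

Lemma integrable_cut_sqr h : slab_L2 I s r h ->
  (@leb12 R).-integrable setT (EFin \o (fun z => (cut I s r h z) ^+ 2)).
Proof.
move=> /slab_cut_L2[mh _ ih]; apply/integrableP; split.
  by apply/measurable_EFinP; exact: measurable_funX.
by under eq_integral do rewrite /= ger0_norm ?sqr_ge0//.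
Qed.

Lemma sqr_excess_le z : P z <= U z ^+ 2.
Proof.
have := weight_ge0 z; rewrite /P; have [Uw|wU] := leP (U z) (w z).
  by rewrite pos_le0 ?subr_le0// expr0n sqr_ge0.
have Uw0 : 0 <= U z - w z by rewrite subr_ge0 ltW.
by rewrite pos_gt0E// => w0; nra.
Qed.

Lemma dissipation_le z : `|H z| <= 2 * U z ^+ 2 + g z ^+ 2.
Proof. by have := @pos_mul_bound _ (U z) (g z) (w z) 1 (weight_ge0 z); rewrite mul1r normr1; apply. Qed.

Lemma integrable_sqr_excess : (@leb12 R).-integrable setT (EFin \o cut I s r P).
Proof.
apply: le_integrable (integrable_cut_sqr solution_slab) => //.
  by apply/measurable_EFinP; exact: (measurable_cut measurable_sqr_excess).
move=> z _ /=; rewrite lee_fin /cut /cut3; case: ifP => _; last by rewrite normr0.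
by rewrite !ger0_norm ?sqr_ge0 ?sqr_excess_le.
Qed.

Lemma integrable_dissipation : (@leb12 R).-integrable setT (EFin \o cut I s r H).
Proof.
have ib := integrableD_EFin measurableT (integrableZ_EFin 2 measurableT (integrable_cut_sqr solution_slab)) (integrable_cut_sqr source_slab).
apply: le_integrable ib => //.
  by apply/measurable_EFinP; exact: (measurable_cut measurable_dissipation).
move=> z _ /=; rewrite lee_fin /cut /cut3; case: ifP => _; last by rewrite normr0.
by apply: le_trans (dissipation_le _) _; exact: ler_norm.
Qed.

Lemma integrable_dissipation3 : (@leb3 R).-integrable setT (EFin \o cut3 I s r H).
Proof.
have mcH : measurable_fun (T := mR3) setT (EFin \o cut3 I s r H).
  by apply/measurable_EFinP; exact: (measurable_cut3 measurable_dissipation).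
have [_ h] := integrableP _ _ _ integrable_dissipation.
apply/integrableP; split => //; rewrite ge0_integral_assoc3//.
exact: measurableT_comp.
Qed.

(** By [fw], [g - w <= w2 - k^2 w], and [k^2 w] is the second [v]-derivative of the barrier, so
    [slice_le0] applies at fixed [(t, x)]. *)
Lemma diffusion_le0 : \forall y \ae @leb2 R, \int[@leb R]_v cut3 I s r H (y, v) <= 0.
Proof.
have [[lU l1 l2 lf] sl _] := pkg.
have aef := ae_prod fw.
apply: aeS (aeI (Rfubini_ae1 integrable_dissipation3) (aeI aef (aeI bd (aeI sl (aeI (slab_slice lU) (slab_slice l1)))))).
move=> [t x] [iH [hf [hbd [hsl [hU h1]]]]].
have [/andP[str Tx]|nsT] := boolP ((s < t < r) && T1 x); last first.
  by rewrite Rintegral_eq0// => v _; rewrite /cut3 /= andbA (negbTE nsT).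
have E : (fun v => cut3 I s r H (t, x, v)) = restrict I (fun v => H (t, x, v)).
  by apply/funext => v; rewrite /cut3 /restrict /= str Tx.
rewrite E in iH *.
have [iU _] := hU str Tx; have [i1 _] := h1 str Tx.
apply: (slice_le0 M0 k1 (hsl str Tx) iU i1 _ iH).
  by move=> e he; exact: (hbd str Tx e he).
apply: aeS hf => v hv vI; rewrite /H; apply: ler_wpM2l; first exact: pos_ge0.
have := hv str Tx vI; rewrite mulrBl mul1r /g /w /= => hf'.
rewrite -addrA lerD2l lerBlDr addrC; exact: hf'.
Qed.

Lemma source_le0 t1 t2 : \int[@leb12 R]_z (if t1 < z.1 < t2 then cut I s r H z else 0) <= 0.
Proof.
have m12 : measurable_fun (T := mR3) setT (fun z => t1 < z.1.1 < t2).
  have h := measurableT_comp (@measurable_mem_itv R `]t1, t2[)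
    (measurableT_comp (@measurable_fst _ _ mR mR) (@measurable_fst _ _ mR2 mR)).
  exact: h.
have iH := integrable_if m12 integrable_dissipation3.
have -> : \int[@leb12 R]_z (if t1 < z.1 < t2 then cut I s r H z else 0) =
    \int[@leb3 R]_z (if t1 < z.1.1 < t2 then cut3 I s r H z else 0).
  by rewrite /Rintegral integral_assoc3//; exact: measurable_int iH.
have R0 : \int[@leb2 R]_y (0 : R) = 0 by rewrite Rintegral_eq0.
rewrite -(Rfubini1 iH) -[leRHS]R0.
apply: ae_le_Rintegral; first exact: Rfubini_integrable1 iH.
  exact: (@integrable0 _ _ _ (@leb2 R) setT).
apply: aeS diffusion_le0 => -[t x] hy /=; case: (t1 < t < t2) => //.
by rewrite Rintegral_eq0.
Qed.

Lemma sh_cut_excess t q : s < t < r -> T1 q.1 -> q.2 \in I ->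
  let A := sh (cut I s r U) (t, q) - barrier M k c t q.2 in
  sh (cut I s r P) (t, q) = (pos A) ^+ 2 /\
  sh (cut I s r H) (t, q) = pos A * (sh (cut I s r g) (t, q) - barrier M k c t q.2).
Proof.
move=> str Tq qI; rewrite /sh /= Tq /cut /cut3 /= str qI.
by rewrite /T1 frac_itv.
Qed.

(** On almost every characteristic [U] agrees, at almost every time, with a primitive [A] of [g].
    The barrier is its own primitive in time, so [primitive_pos_sqr] applies to their difference. *)
Lemma sqr_growth : exists Th : set R, [/\ \forall t \ae @leb R, s < t < r -> Th t,
    forall t, Th t -> s < t < r &
    forall t1 t2, Th t1 -> Th t2 -> t1 <= t2 -> \forall q \ae @leb2 R,
      sh (cut I s r P) (t2, q) - sh (cut I s r P) (t1, q) <=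
      \int[@leb R]_t (if t1 < t < t2 then 2 * sh (cut I s r H) (t, q) else 0)].
Proof.
have [_ _ [Th [full sub h]]] := pkg.
exists Th; split => // t1 t2 t1Th t2Th t12.
have mSU := measurable_sh (measurable_cut (proj1 solution_slab)).
have mSG := measurable_sh (measurable_cut (proj1 source_slab)).
have mSH := measurable_sh (measurable_cut measurable_dissipation).
(* For each [t] the identity [E = 0] holds for almost every [q]; the joint
   measurability of [E] gives it for almost every [t] on almost every characteristic. *)
pose E (z : R * (R * R)) := sh (cut I s r U) z - sh (cut I s r U) (t1, z.2) -
  \int[@leb R]_x (if t1 < x < z.1 then sh (cut I s r g) (x, z.2) else 0).
pose D (z : mR * mR2) := if [&& t1 < z.1 < t2, T1 z.2.1 & z.2.2 \in I] then E z else 0.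
have mK : measurable_fun (T := (mR * mR2 * mR)%type) setT
    (fun z => if t1 < z.2 < z.1.1 then sh (cut I s r g) (z.2, z.1.2) else 0).
  apply: measurable_fun_ifT => //.
    apply: measurable_and.
      by apply: measurable_fun_ltr; [exact: measurable_cst|exact: measurable_snd].
    apply: measurable_fun_ltr; first exact: measurable_snd.
    exact: (measurableT_comp measurable_fst measurable_fst).
  apply: (measurableT_comp mSG); apply/measurable_fun_pairP; split => /=.
    exact: measurable_snd.
  exact: (measurableT_comp measurable_snd measurable_fst).
have mE : measurable_fun (T := (mR * mR2)%type) setT E.
  apply: measurable_funB; last exact: (@measurable_Rintegral_param _ _ _ _ R (@leb R) _ mK).
  apply: measurable_funB => //; apply: (measurableT_comp mSU).
  by apply/measurable_fun_pairP; split => /=; [exact: measurable_cst|exact: measurable_snd].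
have mD : measurable_fun (T := (mR * mR2)%type) setT (fun z => `|(D z)%:E|%E).
  apply: measurableT_comp => //; apply/measurable_EFinP; apply: measurable_fun_ifT => //.
  apply: measurable_and.
    have h' := measurableT_comp (@measurable_mem_itv R `]t1, t2[) (@measurable_fst _ _ mR mR2).
    exact: h'.
  apply: measurable_and.
    exact: (measurableT_comp (@measurable_T1 R) (measurableT_comp (@measurable_fst _ _ mR mR) (@measurable_snd _ _ mR mR2))).
  exact: (measurableT_comp (@measurable_mem_itv R I) (measurableT_comp (@measurable_snd _ _ mR mR) (@measurable_snd _ _ mR mR2))).
have D0 : \forall z \ae @leb12 R, `|(D z)%:E|%E = 0%E.
  apply: (ae_prod_inv mD) => //.
  apply: aeS full => t htr; have [tt|ntt] := boolP (t1 < t < t2); last first.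
    by apply: aeW => q; rewrite /D /= (negbTE ntt) normr0.
  have tTh : Th t.
    apply: htr; case/andP: tt => tt1 tt2.
    case/andP: (sub _ t1Th) => st1 _; case/andP: (sub _ t2Th) => _ t2r.
    by rewrite (lt_trans st1 tt1) (lt_trans tt2 t2r).
  case/andP: (tt) => tt1 _.
  apply: aeS (h _ _ t1Th tTh (ltW tt1)) => q hq; rewrite /D /= tt /=.
  case: ifP => [/andP[Tq qI]|_]; last by rewrite normr0.
  by have [iG e] := hq Tq qI; rewrite /E /= e Rintegral_itv_if// subrr normr0.
have D0' := ae_prod_swap D0.
apply: aeS (aeI (h _ _ t1Th t2Th t12) D0') => q [hq Dq].
have [/andP[Tq qI]|nq] := boolP (T1 q.1 && (q.2 \in I)); last first.
  have z0 (h' : V3 -> R) t : sh (cut I s r h') (t, q) = 0.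
    rewrite /sh /cut /cut3 /=; case: ifP => // Tq; move: nq; rewrite Tq /= => /negbTE ->.
    by rewrite !andbF.
  rewrite !z0 subrr Rintegral_eq0// => t _; case: ifP => // _.
  by rewrite z0 mulr0.
have [iG e12] := hq Tq qI.
pose gq t := sh (cut I s r g) (t, q); pose b t := barrier M k c t q.2.
have lgq : locint gq by exact: integrable_locint iG.
have lb : locint b := locint_barrier_t M k c q.2.
have lgb : locint (fun t => gq t - b t) by exact: locintB.
(* [A] starts at the value of [U] at [t1]; it meets [U] at [t2] by the transport identity [e12], and
   at almost every time between by [Dq]. *)
have [A pA A1] := primitive_exists t1 (sh (cut I s r U) (t1, q)) lgq.
have A2 : A t2 = sh (cut I s r U) (t2, q).
  by apply: (@addIr _ (- A t1)); rewrite (pA _ _ t12) -e12 A1.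
have pB : primitive (fun t => A t - b t) (fun t => gq t - b t).
  exact: primitiveB (barrier_t M k c q.2).
have [P1 _] := sh_cut_excess (sub _ t1Th) Tq qI.
have [P2 _] := sh_cut_excess (sub _ t2Th) Tq qI.
rewrite P1 P2 -A1 -A2.
apply: le_trans (primitive_pos_sqr lgb pB t12) _.
have cB := primitive_continuous lgb pB.
have lprod : locint (fun t => 2 * pos (A t - b t) * (gq t - b t)).
  apply: locintM lgb => t; apply: cvgM; first exact: cvg_cst.
  exact: continuous_comp (cB t) (@pos_continuous _ _).
rewrite locint_oo; last exact: lprod.
have iprod : (@leb R).-integrable `]t1, t2[%classic
    (EFin \o (fun t => 2 * pos (A t - b t) * (gq t - b t))).
  apply: (@integrableS _ _ _ (@leb R) `[t1, t2]%classic) (lprod t1 t2) => //.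
  by apply: subset_itvW.
have mprod := measurable_int _ ((@integrable_mkcond _ _ _ (@leb R) _
  (EFin \o (fun t => 2 * pos (A t - b t) * (gq t - b t))) (measurable_itv `]t1, t2[)).1 iprod).
rewrite /Rintegral integral_mkcond le_eqVlt; apply/orP; left; apply/eqP; congr fine.
apply: ae_eq_integral => //.
  apply/measurable_EFinP; apply: measurable_fun_ifT => //.
    exact: (@measurable_mem_itv R `]t1, t2[).
  by apply: measurable_funM => //; exact: (measurable_fun_pair1 q mSH).
apply: aeS Dq => t Dt _; rewrite patchE mem_setE in_itv /=.
case: ifPn => // tt; congr EFin.
have tsr : s < t < r.
  case/andP: tt => tt1 tt2.
  case/andP: (sub _ t1Th) => st1 _; case/andP: (sub _ t2Th) => _ t2r.
  by rewrite (lt_trans st1 tt1) (lt_trans tt2 t2r).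
have [_ ->] := sh_cut_excess tsr Tq qI.
have -> : sh (cut I s r U) (t, q) = A t.
  move: Dt => /eqP; rewrite abse_eq0 eqe /D /= tt Tq qI /= /E /= => /eqP Et.
  case/andP: tt => tt1 _; have := pA _ _ (ltW tt1).
  rewrite A1 Rintegral_itv_if// => eA; apply: (@addIr _ (- sh (cut I s r U) (t1, q))).
  by rewrite eA; apply/eqP; rewrite -subr_eq0; apply/eqP.
by rewrite /gq /b; ring.
Qed.

(** Integrate [sqr_growth] over the labels, exchange the integrals and undo the shear: the left side
    becomes a difference of energies of time slices, the right side twice the integral in
    [source_le0]. *)
Lemma energy_decreasing : exists Th : set R, [/\ \forall t \ae @leb R, s < t < r -> Th t,
    forall t, Th t -> s < t < r /\ (@leb2 R).-integrable setT (EFin \o (fun q => cut I s r P (t, q))) &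
    forall t1 t2, Th t1 -> Th t2 -> t1 <= t2 ->
      \int[@leb2 R]_q cut I s r P (t2, q) <= \int[@leb2 R]_q cut I s r P (t1, q)].
Proof.
have [Th [full sub h]] := sqr_growth.
exists (Th `&` [set t | (@leb2 R).-integrable setT (EFin \o (fun q => cut I s r P (t, q)))]).
split; first by apply: aeS (aeI full (Rfubini_ae1 integrable_sqr_excess)) => t [h1 h2] str; split => //; exact: h1.
  by move=> t [/sub].
move=> t1 t2 [t1Th i1] [t2Th i2] t12.
have mP12 := measurable_cut measurable_sqr_excess.
have P_ge0 z : 0 <= cut I s r P z by rewrite /cut /cut3; case: ifP => // _; exact: sqr_ge0.
have sh_ge0 z : 0 <= sh (cut I s r P) z by rewrite /sh; case: ifP.
have shE t : (\int[@leb2 R]_q (sh (cut I s r P) (t, q))%:E = \int[@leb2 R]_q (cut I s r P (t, q))%:E)%E.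
  have mt : measurable_fun (T := mR2) setT (fun q => (cut I s r P (t, q))%:E).
    by apply/measurable_EFinP; exact: (measurable_fun_pair2 t mP12).
  transitivity (\int[@leb2 R]_q (if T1 q.1 then (cut I s r P (t, shear t q))%:E else 0))%E.
    by apply: eq_integral => q _; rewrite /sh /=; case: ifP.
  rewrite (ge0_integral_shear t mt); last by move=> q; rewrite lee_fin.
  apply: eq_integral => q _; case: ifPn => // nT.
  by rewrite /cut /cut3 /= (negbTE nT) andbF.
have ish t : (@leb2 R).-integrable setT (EFin \o (fun q => cut I s r P (t, q))) ->
    (@leb2 R).-integrable setT (EFin \o (fun q => sh (cut I s r P) (t, q))).
  move=> /integrableP[_ it]; apply/integrableP; split.
    by apply/measurable_EFinP; exact: (measurable_fun_pair2 t (measurable_sh mP12)).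
  rewrite (_ : (\int[_]_q _)%E = (\int[@leb2 R]_q (sh (cut I s r P) (t, q))%:E)%E); last first.
    by apply: eq_integral => q _ /=; rewrite ger0_norm.
  rewrite shE; apply: le_lt_trans it; rewrite le_eqVlt; apply/orP; left; apply/eqP.
  by apply: eq_integral => q _ /=; rewrite ger0_norm.
have mH12 := measurable_cut measurable_dissipation.
have ishH : (@leb12 R).-integrable setT (EFin \o sh (cut I s r H)).
  apply/integrableP; split; first by apply/measurable_EFinP; exact: measurable_sh.
  rewrite (_ : (\int[_]_q _)%E = (\int[@leb12 R]_z `|sh (cut I s r H) z|%:E)%E)//.
  rewrite (integral_sh (F := fun x => `|x|%:E))//.
  - by have [_] := integrableP _ _ _ integrable_dissipation.
  - by move=> t q nT; rewrite /cut /cut3 /= (negbTE nT) andbF.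
  - by apply/measurable_EFinP; exact: (@normr_measurable R setT).
  - by rewrite normr0.
have mt12 : measurable_fun (T := (mR * mR2)%type) setT (fun z => t1 < z.1 < t2).
  have h' := measurableT_comp (@measurable_mem_itv R `]t1, t2[) (@measurable_fst _ _ mR mR2).
  exact: h'.
have iK := integrable_if mt12 (integrableZ_EFin 2 measurableT ishH).
have := ae_le_Rintegral (integrableB_EFin measurableT (ish _ i2) (ish _ i1))
  (Rfubini_integrable2 iK) (h _ _ t1Th t2Th t12).
have e t : \int[@leb2 R]_q sh (cut I s r P) (t, q) = \int[@leb2 R]_q cut I s r P (t, q).
  by rewrite /Rintegral shE.
rewrite (RintegralB measurableT (ish _ i2) (ish _ i1)) (Rfubini2 iK) !e => h12.
rewrite -subr_le0; apply: le_trans h12 _.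
have iH := integrable_if mt12 integrable_dissipation.
have -> : \int[@leb12 R]_z (if t1 < z.1 < t2 then 2 * sh (cut I s r H) z else 0) =
    2 * \int[@leb12 R]_z (if t1 < z.1 < t2 then cut I s r H z else 0).
  rewrite -(RintegralZl 2 measurableT iH) /Rintegral; congr fine.
  rewrite [RHS]integral_shear12.
  - apply: eq_integral => z _; rewrite /sh /=.
    by case: (T1 z.2.1); case: (t1 < z.1 < t2); rewrite ?mulr0.
  - apply/measurable_EFinP; apply: measurable_funM; first exact: measurable_cst.
    by apply/measurable_EFinP; exact: measurable_int iH.
  - by move=> t q nT; rewrite /cut /cut3 /= (negbTE nT) !andbF; case: ifP; rewrite mulr0.
by rewrite mulr_ge0_le0// source_le0.
Qed.

End energy.

(** * The comparison principle *)

Section comparison.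
Variable R : realType.
Local Notation mR := (measurableTypeR R).
Local Notation mR2 := (mR * mR)%type.
Local Notation mR3 := (mR * mR * mR)%type.
Local Notation V3 := (R * R * R)%type.

Lemma ae_exists (P : R -> Prop) (a b : R) : a < b -> (\forall t \ae @leb R, P t) ->
  exists2 t, a < t < b & P t.
Proof.
move=> ab [N [mN N0 PN]]; apply: contrapT => nex.
have sub : `]a, b[%classic `<=` N.
  move=> t; rewrite /= in_itv /= => tab; apply: PN => Pt; apply: nex; by exists t.
have : (@leb R `]a, b[%classic <= 0)%E by rewrite -N0; apply: le_measure => //; rewrite inE.
have -> : (@leb R `]a, b[%classic = (b - a)%:E)%E.
  by have := @lebesgue_measure_itv R `]a, b[; rewrite /= lte_fin ab -EFinB.
by rewrite lee_fin; lra.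
Qed.

Lemma inv_natS_lt (x : R) : 0 < x -> exists n, n.+1%:R^-1 < x.
Proof. by move=> x0; have [n] := filter_ex (near_infty_natSinv_lt (PosNum x0)); exists n. Qed.

Variables (l u : option R) (r : R) (U f : V3 -> R) (v0 : R * R -> R) (M k c : R).
Let I := oitv l u.
Let w (z : V3) := barrier M k c z.1.1 z.2.
Hypotheses (M0 : 0 <= M) (k1 : `|k| <= 1).

Lemma comparison :
  (forall s, 0 < s -> exists w1 w2, package I s r U w1 w2 f) ->
  (\forall z \ae @leb3 R, 0 < z.1.1 < r -> T1 z.1.2 -> z.2 \in I -> f z <= (1 - k ^+ 2) * w z) ->
  (\forall y \ae @leb2 R, 0 < y.1 < r -> T1 y.2 ->
    forall e, l = Some e \/ u = Some e -> below I (fun v => U (y, v)) e (w (y, e))) ->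
  measurable_fun (T := mR2) (@torus R `*` [set` I]) v0 ->
  (\forall q \ae @leb2 R, T1 q.1 -> q.2 \in I -> v0 q <= barrier M k c 0 q.2) ->
  initial_value I v0 U ->
  \forall z \ae @leb3 R, 0 < z.1.1 < r -> T1 z.1.2 -> z.2 \in I -> U z <= w z.
Proof.
move=> pkg fw bd mv0 v0w iv.
pose P (z : V3) := (pos (U z - w z)) ^+ 2.
pose Q t (q : mR2) := if T1 q.1 && (q.2 \in I) then P (t, q.1, q.2) else 0.
(* Packages exist only on slabs with [s > 0]; this sequence exhausts []0, r[] by countably many of
   them. *)
pose s_ (n : nat) : R := n.+1%:R^-1.
have s_gt0 n : 0 < s_ n by rewrite invr_gt0.
have cutQ n t : s_ n < t < r -> (fun q => cut I (s_ n) r P (t, q)) = Q t.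
  by move=> str; apply/funext => q; rewrite /cut /cut3 /= str.
have mU n : measurable_fun (T := mR3) (slab I (s_ n) r) U.
  by have [w1 [w2 [[[+ _] _ _ _] _ _]]] := pkg _ (s_gt0 n).
have lt0 n t : s_ n < t < r -> 0 < t < r.
  by move=> /andP[st ->]; rewrite (lt_trans (s_gt0 n) st).
have dec n : exists Th : set R, [/\ \forall t \ae @leb R, s_ n < t < r -> Th t,
    forall t, Th t -> s_ n < t < r /\ (@leb2 R).-integrable setT (EFin \o Q t) &
    forall t1 t2, Th t1 -> Th t2 -> t1 <= t2 ->
      \int[@leb2 R]_q Q t2 q <= \int[@leb2 R]_q Q t1 q].
  have [w1 [w2 pk]] := pkg _ (s_gt0 n).
  have fw' : \forall z \ae @leb3 R, s_ n < z.1.1 < r -> T1 z.1.2 -> z.2 \in I ->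
      f z <= (1 - k ^+ 2) * w z.
    by apply: aeS fw => z hz /lt0; exact: hz.
  have bd' : \forall y \ae @leb2 R, s_ n < y.1 < r -> T1 y.2 ->
      forall e, l = Some e \/ u = Some e -> below I (fun v => U (y, v)) e (w (y, e)).
    by apply: aeS bd => y hy /lt0; exact: hy.
  have [Th [full sub h]] := energy_decreasing M0 k1 pk fw' bd'.
  exists Th; split; first exact: full.
    by move=> t tTh; have [str it] := sub t tTh; rewrite -(cutQ n).
  move=> t1 t2 t1Th t2Th t12; have := h _ _ t1Th t2Th t12.
  by have [str1 _] := sub _ t1Th; have [str2 _] := sub _ t2Th; rewrite -!(cutQ n).
have [Th hTh] := choice dec.
(* Since [v0 <= w(0) <= w(t)], the excess [(U - w)_+] is at most [|U - v0|], which is small in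
   square mean near [t = 0] by the initial condition. *)
have small e : 0 < e -> exists2 del, 0 < del & \forall t \ae @leb R, 0 < t < Num.min del r ->
    (\int[@leb2 R]_q (Q t q)%:E <= e%:E)%E.
  move=> e0; have [del del0 hdel] := iv e e0; exists del => //.
  apply: aeS hdel => t ht /andP[t0]; rewrite lt_min => /andP[tdel tr].
  have [n sn] := inv_natS_lt t0.
  have tb : s_ n <= t <= r by rewrite !ltW.
  have mUt := measurable_slab_slice (mU n) tb.
  apply: (@le_trans _ _ (\int[@leb2 R]_(y in @torus R `*` [set` I]) ((U (t, y.1, y.2) - v0 y) ^+ 2)%:E)%E); last first.
    by apply: ht; rewrite t0.
  rewrite [leRHS]integral_mkcond; apply: ae_ge0_le_integral => //.
  - by move=> q _; rewrite lee_fin /Q; case: ifP => // _; exact: sqr_ge0.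
  - have mcP : measurable_fun (T := mR3) (slab I (s_ n) r) P.
      apply: measurable_funX; apply: (measurableT_comp (continuous_measurable_fun (@pos_continuous R))).
      by apply: measurable_funB; [exact: mU|exact: measurable_funTS (measurable_barrier M k c)].
    apply/measurable_EFinP; rewrite -(cutQ n); last by rewrite sn.
    exact: (measurable_fun_pair2 t (measurable_cut mcP)).
  - by move=> q _; rewrite patchE; case: ifP => // _; rewrite lee_fin sqr_ge0.
  - apply/(measurable_restrictT _ (measurable_base I)).
    by apply/measurable_EFinP; apply: measurable_funX; exact: measurable_funB.
  apply: aeS v0w => -[x v] hq _; rewrite patchE /Q /=.
  have -> : ((x, v) \in @torus R `*` [set` I]) = T1 x && (v \in I).
    apply/idP/idP.
      by rewrite in_setE => -[/=]; rewrite /torus /= in_itv /= /T1 => -> /= ->.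
    by move=> /andP[Tx vI]; apply: mem_set; split => //=; rewrite /torus /= in_itv.
  case: ifP => // /andP[Tx vI]; rewrite lee_fin /P /=.
  have h := hq Tx vI.
  have h' : barrier M k c 0 v <= barrier M k c t v.
    by rewrite /barrier ler_wpM2l// ler_expR lerD2r ltW.
  rewrite /w /=; have [Uw|wU] := leP (U (t, x, v)) (barrier M k c t v).
    by rewrite pos_le0 ?subr_le0// expr0n sqr_ge0.
  have p1 : 0 <= U (t, x, v) - barrier M k c t v by rewrite subr_ge0 ltW.
  rewrite (pos_gt0E p1); apply: lerXn2r; rewrite ?nnegrE//.
    by apply: le_trans p1 _; rewrite lerD2l lerN2 (le_trans h).
  by rewrite lerD2l lerN2 (le_trans h).
have Q_ge0 t q : 0 <= Q t q by rewrite /Q; case: ifP => // _; exact: sqr_ge0.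
have zero : \forall t \ae @leb R, 0 < t < r -> (\int[@leb2 R]_q (Q t q)%:E = 0)%E.
  (* The slab [m] used below depends on [e], so [t2] is taken admissible for all [m] at once. *)
  have fullm m : \forall t \ae @leb R, s_ m < t < r -> Th m t by have [] := hTh m.
  apply: aeS (ae_forall_countable fullm) => t2 ht2 /andP[t20 t2r].
  apply/eqP; rewrite eq_le; apply/andP; split; last first.
    by apply: integral_ge0 => q _; rewrite lee_fin.
  apply/lee_addgt0Pr => e e0; rewrite add0e.
  have [del del0 hdel] := small e e0.
  have [|m sm] := @inv_natS_lt (Num.min del t2); first by rewrite lt_min del0.
  have [_ subm hm] := hTh m.
  have [t1 /andP[st1 t1m] [Th1 h1]] := ae_exists sm (aeI (fullm m) hdel).
  move: (t1m); rewrite lt_min => /andP[t1del t12].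
  have t1r : t1 < r by rewrite (lt_trans t12).
  have t1Th : Th m t1 by apply: Th1; rewrite st1.
  have t2Th : Th m t2 by apply: ht2; rewrite (lt_trans st1 t12).
  have [_ it1] := subm _ t1Th; have [_ it2] := subm _ t2Th.
  have t1m' : 0 < t1 < Num.min del r.
    by rewrite (lt_trans (s_gt0 m) st1) lt_min t1del.
  apply: le_trans (h1 t1m').
  have f1 := integrable_fin_num measurableT it1; have f2 := integrable_fin_num measurableT it2.
  rewrite -(fineK f1) -(fineK f2) lee_fin.
  exact: hm _ _ t1Th t2Th (ltW t12).
have mcP n : measurable_fun (T := mR3) (slab I (s_ n) r) P.
  apply: measurable_funX; apply: (measurableT_comp (continuous_measurable_fun (@pos_continuous R))).
  by apply: measurable_funB; [exact: mU|exact: measurable_funTS (measurable_barrier M k c)].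
have P_ge0 n z : 0 <= cut3 I (s_ n) r P z.
  by rewrite /cut3; case: ifP => // _; exact: sqr_ge0.
(* Joint measurability turns vanishing on almost every time slice into vanishing almost
   everywhere. *)
have cut0 n : \forall z \ae @leb3 R, (cut3 I (s_ n) r P z)%:E = 0%E.
  have mc3 : measurable_fun (T := mR3) setT (fun z => (cut3 I (s_ n) r P z)%:E).
    by apply/measurable_EFinP; exact: measurable_cut3 (mcP n).
  have mc : measurable_fun (T := (mR * mR2)%type) setT (fun z => (cut I (s_ n) r P z)%:E).
    by apply/measurable_EFinP; exact: measurable_cut (mcP n).
  have c3_ge0 z : (0 <= (cut3 I (s_ n) r P z)%:E)%E by rewrite lee_fin.
  have c_ge0 z : (0 <= (cut I (s_ n) r P z)%:E)%E by rewrite lee_fin; exact: (P_ge0 n (assoc3 z)).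
  apply: (ae_eq0_integral (@leb3 R) mc3 c3_ge0).1; rewrite (ge0_integral_assoc3 mc3)//.
  apply: (ae_eq0_integral (@leb12 R) mc c_ge0).2; apply: (ae_prod_inv mc) => //.
  apply: aeS zero => t ht; have mt := measurable_fun_pair2 t mc.
  apply: (ae_eq0_integral (@leb2 R) mt (fun q => c_ge0 (t, q))).1.
  have [str|nstr] := boolP (s_ n < t < r).
    by rewrite -[RHS](ht (lt0 _ _ str)); apply: eq_integral => q _; rewrite -(cutQ n).
  rewrite integral0_eq// => q _; rewrite /cut /cut3 /= (negbTE nstr)//.
apply: aeS (ae_forall_countable cut0) => z hz /andP[z0 zr] Tz zI.
have [n sn] := inv_natS_lt z0.
have := hz n; rewrite /cut3 zr sn Tz zI /= => -[/eqP].
rewrite sqrf_eq0 => /eqP p0; rewrite -subr_le0 -p0.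
exact: le_pos.
Qed.

End comparison.

(** * Errors of the Schwarz iterates *)

Section essential_bounds.
Context d (X : measurableType d) (R : realType).
Variables (mu : {measure set X -> \bar R}) (D : set X).

Lemma Linf_bound (h : X -> R) : Linf mu D h ->
  exists2 K, 0 <= K & \forall z \ae mu, D z -> `|h z| <= K.
Proof.
(* The norm is an essential supremum only if the whole space has positive measure; otherwise any
   property holds almost everywhere. *)
move=> [_]; rewrite /Linf_norm unlock; case: ifPn => [_|mu0 _]; last first.
  exists 0 => //; exists setT; split => //.
  by apply/eqP; rewrite eq_le measure_ge0 andbT leNgt.
set g := abse \o _ => goo.
pose K := fine (Order.max 0%E (ess_sup mu g)).
have fK : (Order.max 0 (ess_sup mu g))%E = K%:E.
  rewrite /K fineK// ge0_fin_numE ?le_max ?lexx//.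
  by rewrite gt_max goo ltry.
exists K; first by rewrite -lee_fin -fK le_max lexx.
apply: aeS (ess_sup_ge mu g) => z hz Dz.
rewrite -lee_fin -fK; apply: le_trans (_ : ess_sup mu g <= _)%E; last by rewrite le_max lexx orbT.
by move: hz; rewrite /g /= patchE mem_set.
Qed.

Lemma Linf_norm_le (h : X -> R) K : 0 <= K -> (\forall z \ae mu, D z -> `|h z| <= K) ->
  (Linf_norm mu D h <= K%:E)%E.
Proof.
move=> K0 hK; rewrite /Linf_norm unlock; case: ifP => _; last by rewrite lee_fin.
apply/ess_supP; apply: aeS hK => z hz /=; rewrite patchE; case: ifPn => zD.
  by rewrite /= lee_fin hz//; rewrite inE in zD.
by rewrite abse0 lee_fin.
Qed.

End essential_bounds.

(** * Traces at the ends of an interval and almost everywhere bounds *)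

Section boundary_values.
Variable R : realType.
Local Notation mR := (measurableTypeR R).

Lemma closure_itv_approx (I : interval R) (c : R) :
  (forall del, 0 < del -> exists2 v, v \in I & `|c - v| < del) -> closure [set` I] c.
Proof.
move=> h B /nbhs_ballP[del /= del0 sub]; have [v vI cv] := h _ del0.
by exists v; split => //; apply: sub.
Qed.

(** If [F c > G c], then [F > G] near [c] within the closure. As [I] is open, this region contains
    an interval of positive length, on which the almost everywhere bound is contradicted. *)
Lemma ae_le_closure (I : interval R) (F G : R -> R) c : open_itv I ->
  {within closure [set` I], continuous F} -> {within closure [set` I], continuous G} ->
  (\forall v \ae @leb R, v \in I -> F v <= G v) -> closure [set` I] c -> F c <= G c.
Proof.
move=> oI /subspace_continuousP cF /subspace_continuousP cG FG cI.
rewrite leNgt; apply/negP => GF.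
have cF' : F v @[v --> within (closure [set` I]) (nbhs c)] --> F c := cF c cI.
have cG' : G v @[v --> within (closure [set` I]) (nbhs c)] --> G c := cG c cI.
have cv : (F v - G v) @[v --> within (closure [set` I]) (nbhs c)] --> F c - G c.
  exact: cvgB cF' cG'.
have GF0 : 0 < F c - G c by rewrite subr_gt0.
have near0 : \forall v \near within (closure [set` I]) (nbhs c), 0 < F v - G v.
  exact: (cvgr_gt _ cv).
have /nbhs_ballP[del /= del0 sub] := near0.
have [v1 [/= v1I cv1]] := cI _ (nbhsx_ballx c _ del0).
have [p [q [pv vq pI qI]]] := oI _ v1I.
move: cv1; rewrite /ball /= ltr_norml => /andP[h1 h2].
have ab : Num.max p (c - del) < Num.min q (c + del).
  by rewrite gt_max !lt_min !(lt_trans pv vq) /=; apply/and3P; split; lra.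
have [v /andP[]] := ae_exists ab FG.
rewrite gt_max lt_min => /andP[pv' h3] /andP[vq' h4] hFG.
have vI : v \in I by apply: (mem_itv_convex pI qI); rewrite !ltW.
have cvd : ball c del v by rewrite /ball /= ltr_norml; apply/andP; split; lra.
have := sub _ cvd (subset_closure (vI : [set` I] v)).
by have := hFG vI; rewrite /= subr_gt0 => h5 h6; have := le_lt_trans h5 h6; rewrite ltxx.
Qed.

Lemma value_at_le (I : interval R) (h G : R -> R) c b : open_itv I -> closure [set` I] c ->
  continuous G -> value_at I h c b ->
  ((\forall v \ae @leb R, v \in I -> h v <= G v) -> b <= G c) /\
  ((\forall v \ae @leb R, v \in I -> G v <= h v) -> G c <= b).
Proof.
move=> oI cI cG [h' [ch hh <-]]; have cG' : {within closure [set` I], continuous G}.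
  exact: continuous_subspaceT.
split=> hG; apply: (ae_le_closure oI) cI => //; apply: aeS (aeI hh hG) => v [e hv] vI.
  by rewrite -e// hv.
by rewrite -e// hv.
Qed.

(** The trace of [h] is only continuous up to the closure of [I], so the continuous [U0] is moved to
    the other side and [h] is compared with [U0 + h'] or [U0 - h']. *)
Lemma below_difference (I : interval R) (h u U0 : R -> R) c b B : open_itv I ->
  closure [set` I] c -> continuous U0 -> (\forall v \ae @leb R, v \in I -> u v = U0 v) ->
  value_at I h c b -> `|b - U0 c| <= B ->
  below I (fun v => h v - u v) c B /\ below I (fun v => 0 - (h v - u v)) c B.
Proof.
move=> oI cI cU uU va; rewrite ler_norml => /andP[b1 b2]; split=> h' ch' hh'.
  have cG : continuous (fun v => h' v + U0 v) by move=> v; exact: cvgD (ch' v) (cU v).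
  have [_ hb] := value_at_le oI cI cG va.
  suff : h' c + U0 c <= b by lra.
  by apply: hb; apply: aeS (aeI uU hh') => v [e1 e2] vI; rewrite -(e2 vI) -(e1 vI); lra.
have cG : continuous (fun v => U0 v - h' v) by move=> v; exact: cvgB (cU v) (ch' v).
have [hb _] := value_at_le oI cI cG va.
suff : b <= U0 c - h' c by lra.
by apply: hb; apply: aeS (aeI uU hh') => v [e1 e2] vI; rewrite -(e2 vI) -(e1 vI); lra.
Qed.

Lemma value_at_gap (I : interval R) (h u U0 w : R -> R) c b : open_itv I -> closure [set` I] c ->
  continuous U0 -> continuous w -> (\forall v \ae @leb R, v \in I -> u v = U0 v) ->
  (\forall v \ae @leb R, v \in I -> `|h v - u v| <= w v) ->
  value_at I h c b -> `|b - U0 c| <= w c.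
Proof.
move=> oI cI cU cw uU hw va.
have cG1 : continuous (fun v => U0 v + w v) by move=> v; exact: cvgD (cU v) (cw v).
have cG2 : continuous (fun v => U0 v - w v) by move=> v; exact: cvgB (cU v) (cw v).
have [hb1 _] := value_at_le oI cI cG1 va; have [_ hb2] := value_at_le oI cI cG2 va.
have k v : v \in I -> u v = U0 v -> (`|h v - u v| <= w v) -> U0 v - w v <= h v <= U0 v + w v.
  by move=> vI ->; rewrite ler_norml => /andP[]; lra.
rewrite ler_norml; apply/andP; split.
  suff : U0 c - w c <= b by lra.
  by apply: hb2; apply: aeS (aeI uU hw) => v [e1 e2] vI; have /andP[] := k v vI (e1 vI) (e2 vI).
suff : b <= U0 c + w c by lra.
by apply: hb1; apply: aeS (aeI uU hw) => v [e1 e2] vI; have /andP[] := k v vI (e1 vI) (e2 vI).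
Qed.

Lemma continuous_barrier_v (M k c t : R) : continuous (barrier M k c t).
Proof. exact: primitive_continuous (locintZ k (locint_barrier_v M k c t)) (barrier_v M k c t). Qed.

End boundary_values.

(** * Differences of solutions and two-sided comparison *)

Section error_estimates.
Variable R : realType.
Local Notation mR := (measurableTypeR R).
Local Notation mR2 := (mR * mR)%type.
Local Notation mR3 := (mR * mR * mR)%type.
Local Notation V3 := (R * R * R)%type.
Let full := oitv (@None R) None.

Lemma source_slab_L2 (s r : R) (f : V3 -> R) : 0 < s ->
  Linf_L2_Hk 1 (@time R) `]-oo, +oo[ f -> slab_L2 full s r f.
Proof.
move=> s0 [w [w0 mw [C hC] _]]; rewrite -w0; split.
  apply: measurable_funS (mw 0%N isT).
    by apply: measurableX => //; apply: measurableX => //; exact: measurable_itv.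
  move=> [[t x] v] [[/= ts tx] _]; split => //; split => //=.
  by move: ts; rewrite /time /= !in_itv /= andbT => /andP[st _]; exact: lt_le_trans st.
exists C; apply: aeS (hC 0%N isT) => t ht /andP[st _]; apply: ht.
by rewrite /time /= in_itv /= andbT (lt_le_trans s0 st).
Qed.

Lemma initial_valueB (I I1 I2 : interval R) (u0 : R * R -> R) (u1 u2 : V3 -> R) :
  {subset I <= I1} -> {subset I <= I2} ->
  (forall s r, 0 < s -> slab_L2 I1 s r u1) -> (forall s r, 0 < s -> slab_L2 I2 s r u2) ->
  measurable_fun (T := mR2) (@torus R `*` setT) u0 ->
  initial_value I1 u0 u1 -> initial_value I2 u0 u2 ->
  initial_value I (fun=> 0) (fun z => u1 z - u2 z).
Proof.
(* [(x - y)^2 <= 2 x^2 + 2 y^2] doubles each of the two bounds, hence the quarter. *)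
move=> II1 II2 l1 l2 mu0 i1 i2 e e0; have e4 : 0 < e / 4 by lra.
have [d1 d10 h1] := i1 _ e4; have [d2 d20 h2] := i2 _ e4.
exists (Num.min d1 d2); first by rewrite lt_min d10.
apply: aeS (aeI h1 h2) => t [{}h1 {}h2] /andP[t0]; rewrite lt_min => /andP[td1 td2].
have th : 0 < t / 2 by lra.
have tt : t / 2 <= t <= t by apply/andP; split; lra.
have sub (J : interval R) (u : V3 -> R) : {subset I <= J} -> (forall s r, 0 < s -> slab_L2 J s r u) ->
    measurable_fun (T := mR2) (@torus R `*` [set` I]) (fun y => u (t, y.1, y.2) - u0 y) /\
    (\int[@leb2 R]_(y in @torus R `*` [set` I]) ((u (t, y.1, y.2) - u0 y) ^+ 2)%:E <=
     \int[@leb2 R]_(y in @torus R `*` [set` J]) ((u (t, y.1, y.2) - u0 y) ^+ 2)%:E)%E.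
  move=> IJ lu; have mD (K : interval R) :
      measurable_fun (T := mR2) (@torus R `*` [set` K]) u0.
    apply: measurable_funS mu0; last by move=> [x v] [].
    by apply: measurableX => //; exact: measurable_itv.
  split.
    have [mw _] := slab_L2S IJ (lu _ t th).
    apply: measurable_funB => //; exact: (measurable_slab_slice mw tt).
  apply: ge0_subset_integral; [exact: measurable_base|exact: measurable_base| | |].
  - have [mw _] := lu _ t th.
    apply/measurable_EFinP/measurable_funX/measurable_funB => //.
    exact: (measurable_slab_slice mw tt).
  - by move=> y _; rewrite lee_fin sqr_ge0.
  - by move=> [x v] [/= xT vI]; split => //=; exact: IJ.
have [m1 s1] := sub _ _ II1 l1; have [m2 s2] := sub _ _ II2 l2.
have b1 := le_trans s1 (h1 (introT andP (conj t0 td1))).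
have b2 := le_trans s2 (h2 (introT andP (conj t0 td2))).
have mD := measurable_base I.
apply: (@le_trans _ _ (\int[@leb2 R]_(y in @torus R `*` [set` I])
   ((2 * (u1 (t, y.1, y.2) - u0 y) ^+ 2)%:E + (2 * (u2 (t, y.1, y.2) - u0 y) ^+ 2)%:E))%E).
  apply: ge0_le_integral => //.
  - by move=> y _; rewrite lee_fin sqr_ge0.
  - apply/measurable_EFinP/measurable_funX.
    rewrite (_ : (fun y : mR2 => _) = (fun y => (u1 (t, y.1, y.2) - u0 y) - (u2 (t, y.1, y.2) - u0 y))).
      exact: measurable_funB.
    by apply/funext => y; ring.
  - by apply: emeasurable_funD; apply/measurable_EFinP; apply: measurable_funM => //;
      exact: measurable_funX.
  - move=> y _; rewrite -EFinD lee_fin; set x1 := u1 _; set x2 := u2 _.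
    have := sqr_ge0 ((x1 - u0 y) + (x2 - u0 y)); nra.
rewrite ge0_integralD//; last 4 first.
- by move=> y _; rewrite lee_fin mulr_ge0// sqr_ge0.
- by apply/measurable_EFinP; apply: measurable_funM => //; exact: measurable_funX.
- by move=> y _; rewrite lee_fin mulr_ge0// sqr_ge0.
- by apply/measurable_EFinP; apply: measurable_funM => //; exact: measurable_funX.
under eq_integral do rewrite EFinM.
under [X in (_ + X <= _)%E]eq_integral do rewrite EFinM.
rewrite !ge0_integralZl//; last 4 first.
- by apply/measurable_EFinP; exact: measurable_funX.
- by move=> y _; rewrite lee_fin sqr_ge0.
- by apply/measurable_EFinP; exact: measurable_funX.
- by move=> y _; rewrite lee_fin sqr_ge0.
have -> : e%:E = (2%:E * (e / 4)%:E + 2%:E * (e / 4)%:E)%E.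
  by rewrite -!EFinM -EFinD; congr EFin; field.
by rewrite leeD// lee_wpmul2l ?lee_fin.
Qed.

Lemma abs_comparison (l u : option R) (T : R) (U f : V3 -> R) (v0 : R * R -> R) (M k c : R) :
  let I := oitv l u in let w (z : V3) := barrier M k c z.1.1 z.2 in
  0 <= M -> `|k| <= 1 ->
  (forall s, 0 < s -> exists w1 w2, package I s T U w1 w2 f) ->
  (\forall z \ae @leb3 R, 0 < z.1.1 < T -> T1 z.1.2 -> z.2 \in I -> `|f z| <= (1 - k ^+ 2) * w z) ->
  (\forall y \ae @leb2 R, 0 < y.1 < T -> T1 y.2 -> forall e, l = Some e \/ u = Some e ->
    below I (fun v => U (y, v)) e (w (y, e)) /\ below I (fun v => 0 - U (y, v)) e (w (y, e))) ->
  measurable_fun (T := mR2) (@torus R `*` [set` I]) v0 ->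
  (\forall q \ae @leb2 R, T1 q.1 -> q.2 \in I -> `|v0 q| <= barrier M k c 0 q.2) ->
  initial_value I v0 U ->
  \forall z \ae @leb3 R, 0 < z.1.1 < T -> T1 z.1.2 -> z.2 \in I -> `|U z| <= w z.
Proof.
move=> I w M0 k1 pk hf bd mv0 hv0 iv.
have up : \forall z \ae @leb3 R, 0 < z.1.1 < T -> T1 z.1.2 -> z.2 \in I -> U z <= w z.
  apply: (comparison M0 k1 pk _ _ mv0 _ iv).
  - by apply: aeS hf => z hz zt Tz zI; apply: le_trans (ler_norm _) _; exact: hz.
  - by apply: aeS bd => y hy yt Ty e he; have [] := hy yt Ty e he.
  - by apply: aeS hv0 => q hq Tq qI; apply: le_trans (ler_norm _) _; exact: hq.
have dn : \forall z \ae @leb3 R, 0 < z.1.1 < T -> T1 z.1.2 -> z.2 \in I -> 0 - U z <= w z.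
  apply: (@comparison _ l u T (fun z => 0 - U z) (fun z => 0 - f z) (fun q => - v0 q) M k c M0 k1).
  - move=> s s0; have [w1 [w2 p]] := pk s s0.
    exists (fun z => 0 - w1 z), (fun z => 0 - w2 z).
    exact: packageB (fun _ => id) (fun _ => id) (package0 I s T) p.
  - apply: aeS hf => z hz zt Tz zI; rewrite sub0r; apply: le_trans (ler_norm _) _.
    by rewrite normrN; exact: hz.
  - by apply: aeS bd => y hy yt Ty e he; have [] := hy yt Ty e he.
  - exact: (measurableT_comp (@oppr_measurable R setT) mv0).
  - apply: aeS hv0 => q hq Tq qI; apply: le_trans (ler_norm _) _.
    by rewrite normrN; exact: hq.
  - move=> e e0; have [del del0 h] := iv e e0; exists del => //.
    apply: aeS h => t ht t0; apply: le_trans (ht t0).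
    rewrite le_eqVlt; apply/orP; left; apply/eqP; apply: eq_integral => y _.
    by rewrite sub0r -opprB opprK -sqrrN; congr ((_ ^+ 2)%:E); ring.
apply: aeS (aeI up dn) => z [h1 h2] zt Tz zI.
rewrite ler_norml h1// andbT lerNl -sub0r; exact: h2.
Qed.

End error_estimates.

(** * From one interface to the other *)

Section schwarz.
Variable R : realType.
Local Notation mR := (measurableTypeR R).
Local Notation mR2 := (mR * mR)%type.
Local Notation V3 := (R * R * R)%type.
Let full := oitv (@None R) None.

(** Supplies the representative [U0] of [u] whose value at an interface serves as the trace of [u]
    there. *)
Lemma continuous_slices (T : R) (u f : V3 -> R) :
  (forall s r, 0 < s -> exists w1 w2, package full s r u w1 w2 f) ->
  \forall y \ae @leb2 R, 0 < y.1 < T -> T1 y.2 ->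
    exists2 U0 : R -> R, continuous U0 & \forall v \ae @leb R, u (y, v) = U0 v.
Proof.
move=> pk.
have h n : \forall y \ae @leb2 R, n.+1%:R^-1 < y.1 < T -> T1 y.2 ->
    exists2 U0 : R -> R, continuous U0 & \forall v \ae @leb R, u (y, v) = U0 v.
  have s0 : 0 < (n.+1%:R^-1 : R) by rewrite invr_gt0.
  have [w1 [w2 [_ sl _]]] := pk _ T s0.
  apply: aeS sl => y hy yt Ty; have [V0 [V1 [V2 [l2 p1 p0 hV]]]] := hy yt Ty.
  exists V0; last by apply: aeS hV => v hv; have [] := hv isT.
  exact: primitive_continuous (locint_continuous (primitive_continuous l2 p1)) p0.
apply: aeS (ae_forall_countable h) => y hy /andP[y0 yT] Ty.
by have [n yn] := inv_natS_lt y0; apply: (hy n) => //; rewrite yn.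
Qed.

(** Reads an almost everywhere error bound at a single velocity [c], by continuity in [v]. In the
    iteration [c] is the interface of the other subdomain, which is interior to [J]. *)
Lemma trace_gap (l u : option R) (k m c' c T : R) (U w : V3 -> R) :
  let J := oitv l u in c \in J ->
  (\forall z \ae @leb3 R, 0 < z.1.1 < T -> T1 z.1.2 -> z.2 \in J ->
    `|U z - w z| <= barrier m k c' z.1.1 z.2) ->
  \forall y \ae @leb2 R, 0 < y.1 < T -> T1 y.2 ->
    forall U0 : R -> R, continuous U0 -> (\forall v \ae @leb R, w (y, v) = U0 v) ->
    forall b, value_at J (fun v => U (y, v)) c b -> `|b - U0 c| <= barrier m k c' y.1 c.
Proof.
move=> J cJ bound; apply: aeS (ae_prod bound) => y hy yt Ty U0 cU wU b vb.
apply: (@value_at_gap R J (fun v => U (y, v)) (fun v => w (y, v)) U0 (barrier m k c' y.1)) => //.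
- exact: open_oitv.
- exact: subset_closure.
- exact: continuous_barrier_v.
- by apply: aeS wU => v e _.
- by apply: aeS hy => v hv vI; exact: hv.
Qed.

(** The difference solves the homogeneous problem with zero initial value. Since [k^2 = 1] the
    barrier solves the same equation, so the bound on the interface, where the barrier is
    [m exp(t)], decides everything. *)
Lemma error_step (l u : option R) (c k m T : R) (f U w : V3 -> R) (u0 : R * R -> R) :
  let I := oitv l u in
  0 <= m -> `|k| = 1 -> (forall e, l = Some e \/ u = Some e -> e = c) ->
  closure [set` I] c ->
  (forall s r, 0 < s -> exists w1 w2, package I s r U w1 w2 f) ->
  (forall s r, 0 < s -> exists w1 w2, package full s r w w1 w2 f) ->
  measurable_fun (T := mR2) (@torus R `*` setT) u0 ->
  initial_value I u0 U -> initial_value full u0 w ->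
  (\forall y \ae @leb2 R, 0 < y.1 < T -> T1 y.2 ->
    forall U0 : R -> R, continuous U0 -> (\forall v \ae @leb R, w (y, v) = U0 v) ->
    exists2 b, value_at I (fun v => U (y, v)) c b & `|b - U0 c| <= m * expR y.1) ->
  \forall z \ae @leb3 R, 0 < z.1.1 < T -> T1 z.1.2 -> z.2 \in I ->
    `|U z - w z| <= barrier m k c z.1.1 z.2.
Proof.
move=> I m0 k1 ends cI pU pw mu0 iU iw tr.
have II : {subset I <= I} by [].
have If : {subset I <= full} by move=> v _; rewrite in_oitv.
have k2 : 1 - k ^+ 2 = 0 by rewrite -real_normK ?num_real// k1 expr1n subrr.
apply: (@abs_comparison R l u T (fun z => U z - w z) (fun z => f z - f z) (fun=> 0)).
- exact: m0.
- by rewrite k1.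
- move=> s s0; have [a1 [a2 pa]] := pU s T s0; have [b1 [b2 pb]] := pw s T s0.
  exists (fun z => a1 z - b1 z), (fun z => a2 z - b2 z); exact: packageB II If pa pb.
- by apply: aeW => z _ _ _; rewrite subrr normr0 k2 mul0r.
- apply: aeS (aeI tr (continuous_slices T pw)) => y [htr hsl] yt Ty e /ends ->.
  have [U0 cU wU] := hsl yt Ty; have [b vb hb] := htr yt Ty U0 cU wU.
  rewrite {1 2}/barrier subrr mulr0 addr0 /=.
  have wU' : \forall v \ae @leb R, v \in I -> w (y, v) = U0 v by apply: aeS wU => v ev _.
  exact: (@below_difference R I (fun v => U (y, v)) (fun v => w (y, v)) U0 c b _
    (@open_oitv R l u) cI cU wU' vb hb).
- exact: measurable_cst.
- by apply: aeW => q _ _; rewrite normr0; exact: barrier_ge0.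
- apply: (initial_valueB II If _ _ mu0 iU iw) => s r s0.
    by have [a1 [a2 [[]]]] := pU s r s0.
  by have [a1 [a2 [[]]]] := pw s r s0.
Qed.

Lemma closure_below (c : R) : closure [set` oitv None (Some c)] c.
Proof.
apply: closure_itv_approx => del del0; exists (c - del / 2).
  by rewrite in_oitv /=; lra.
by rewrite opprB addrC subrK ger0_norm; lra.
Qed.

Lemma closure_above (c : R) : closure [set` oitv (Some c) None] c.
Proof.
apply: closure_itv_approx => del del0; exists (c + del / 2).
  by rewrite in_oitv /= andbT; lra.
by rewrite opprD addrA subrr sub0r normrN ger0_norm; lra.
Qed.

Lemma geometric_cvg0 (h : nat -> \bar R) (M q : R) : 0 <= q < 1 ->
  (forall n, 0 <= h n)%E -> (forall n, h n.+1 <= (M * q ^+ n)%:E)%E ->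
  h n @[n --> \oo] --> 0%E.
Proof.
move=> /andP[q0 q1] h0 hM; rewrite -(cvg_shiftS h).
have lim : h n.+1 @[n --> \oo] --> 0%E; last exact: lim.
apply: (squeeze_cvge (f := fun=> 0%E) (h := fun n => (M * q ^+ n)%:E)).
- by apply: nearW => n; rewrite h0 hM.
- exact: cvg_cst.
- apply: cvg_EFin; first exact: nearW.
  by apply: cvg_geometric; rewrite ger0_norm.
Qed.

Lemma norm_error_le (I : interval R) (T C : R) (e b : V3 -> R) : 0 <= C ->
  (\forall z \ae @leb3 R, 0 < z.1.1 < T -> T1 z.1.2 -> z.2 \in I -> `|e z| <= b z) ->
  (forall z, 0 < z.1.1 < T -> z.2 \in I -> b z <= C) ->
  (Linf_norm (@leb3 R) (`]0%R, T[%classic `*` @torus R `*` [set` I]) e <= C%:E)%E.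
Proof.
move=> C0 he hb; apply: Linf_norm_le => //; apply: aeS he => -[[t x] v] hz [[/= tT xT] vI].
move: tT xT; rewrite /torus /= !in_itv /= => tT xT.
by apply: le_trans (hz tT xT vI) _; exact: hb.
Qed.

End schwarz.

Theorem theorem4p1 (R : realType) (L1 L2 : R)
    (f : R * R * R -> R) (u0 : R * R -> R) (g2 g1 : R * R -> R)
    (u : R * R * R -> R) (u1 u2 : nat -> R * R * R -> R) :
  L1 < L2 ->
  Linf_L2_Hk 1 (@time R) `]-oo, +oo[ f ->
  Linf (@leb3 R) (@time R `*` @torus R `*` setT) f ->
  L2_Hk 1 `]-oo, +oo[ u0 ->
  Linf (@leb2 R) (@torus R `*` setT) u0 ->
  Linf (@leb2 R) (@time R `*` @torus R) g2 ->
  Linf (@leb2 R) (@time R `*` @torus R) g1 ->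
  compatible L2 u0 g2 ->
  compatible L1 u0 g1 ->
  solution `]-oo, +oo[ f u0 u ->
  schwarz_iterates L1 L2 f u0 g2 g1 u1 u2 ->
  forall T : R, 0 < T ->
    Linf_norm (@leb3 R)
      (`]0, T[%classic `*` @torus R `*` `]-oo, L2[%classic) (u1 n \- u)
      @[n --> \oo] --> 0%E /\
    Linf_norm (@leb3 R)
      (`]0, T[%classic `*` @torus R `*` `]L1, +oo[%classic) (u2 n \- u)
      @[n --> \oo] --> 0%E.
Proof.
move=> L12 fH1 fLinf u0H1 u0Linf g2Linf g1Linf _ _ su [sol tr2 tr1 st] T T0.
pose full := oitv (@None R) None; pose I1 := oitv None (Some L2); pose I2 := oitv (Some L1) None.
have pkg (I : interval R) (w : R * R * R -> R) : open_itv I -> {subset I <= full} ->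
    solution I f u0 w -> forall s r, 0 < s -> exists w1 w2, package I s r w w1 w2 f.
  move=> oI If sw s r s0; apply: (sol_package oI s0 sw).
  exact: slab_L2S If (source_slab_L2 r s0 fH1).
have If (I : interval R) : {subset I <= full} by move=> v _; rewrite in_oitv.
have pu := pkg full u (@open_oitv R None None) (If _) su.
have p1 n (n1 : (1 <= n)%N) := pkg I1 (u1 n) (@open_oitv R None (Some L2)) (If _) (proj1 (sol n n1)).
have p2 n (n1 : (1 <= n)%N) := pkg I2 (u2 n) (@open_oitv R (Some L1) None) (If _) (proj2 (sol n n1)).
have iv (I : interval R) (w : R * R * R -> R) : solution I f u0 w -> initial_value I u0 w by case.
have mu0 := proj1 u0Linf.
have [Kf Kf0 hf] := Linf_bound fLinf; have [Ku Ku0 hu0] := Linf_bound u0Linf.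
have [K2 K20 hg2] := Linf_bound g2Linf; have [K1 K10 hg1] := Linf_bound g1Linf.
(* [M exp(t)] dominates the source by [Kf] and the initial value by [Ku]. *)
pose M := Kf + Ku; have M0 : 0 <= M by rewrite addr_ge0.
have ge1 (t : R) : 0 < t -> 1 <= expR t by move=> t0; rewrite ltW// expR_gt1.
have inT (x : R) : T1 x -> torus x by rewrite /torus /= in_itv.
have inD (t : R) : 0 < t < T -> time t.
  by move=> /andP[t0 _]; rewrite /time /= in_itv /= t0.
have bu : \forall z \ae @leb3 R, 0 < z.1.1 < T -> T1 z.1.2 -> z.2 \in full ->
    `|u z| <= barrier M 0 0 z.1.1 z.2.
  apply: (@abs_comparison R None None T u f u0 M 0 0 M0).
  - by rewrite normr0.
  - by move=> s s0; exact: pu.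
  - apply: aeS hf => -[[t x] v] hz /= tT Tx _.
    rewrite expr0n /= subr0 mul1r /barrier mul0r addr0.
    have t1 : 1 <= expR t by apply: ge1; case/andP: tT.
    apply: (@le_trans _ _ Kf); first by apply: hz; split => //; split; [exact: inD|exact: inT].
    by apply: (@le_trans _ _ M); [rewrite lerDl|rewrite ler_peMr].
  - by apply: aeW => y _ _ e [].
  - apply: measurable_funS mu0; last by move=> [x v] [].
    by apply: measurableX => //; exact: measurable_itv.
  - apply: aeS hu0 => -[x v] hq /= Tx _.
    rewrite /barrier mul0r addr0 expR0 mulr1.
    apply: (@le_trans _ _ Ku); last by rewrite lerDr.
    by apply: hq; split => //; exact: inT.
  - exact: iv.
(* [trace_gap] is applied to the zero function, whose trace is 0, to bound the representative of [u]
   at the point [c] itself. *)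
have gap c : \forall y \ae @leb2 R, 0 < y.1 < T -> T1 y.2 ->
    forall U0 : R -> R, continuous U0 -> (\forall v \ae @leb R, u (y, v) = U0 v) ->
    `|U0 c| <= M * expR y.1.
  have bu' : \forall z \ae @leb3 R, 0 < z.1.1 < T -> T1 z.1.2 -> z.2 \in full ->
      `|0 - u z| <= barrier M 0 0 z.1.1 z.2.
    by apply: aeS bu => z hz zt Tz zI; rewrite sub0r normrN; exact: hz.
  have c_full : c \in full by rewrite in_oitv.
  have tg := @trace_gap R None None 0 M 0 c T (fun=> 0) u c_full bu'.
  apply: aeS tg => y hy yt Ty U0 cU uU.
  have v0 : value_at full (fun=> 0) c (0 : R).
    exists (fun=> 0); split => //; last exact: aeW.
    by apply: continuous_subspaceT => x; exact: cvg_cst.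
  by have := hy yt Ty U0 cU uU 0 v0; rewrite sub0r normrN /barrier mul0r addr0.
pose q := expR (- (L2 - L1)); have q0 : 0 <= q by exact: expR_ge0.
have q1 : q < 1 by rewrite expR_lt1 oppr_lt0 subr_gt0.
(* [A exp(t)] covers both first interface errors: a guess bounded by [K1] or [K2], against a trace
   of [u] bounded by [M exp(t)]. *)
pose A := M + K1 + K2; have A0 : 0 <= A by rewrite !addr_ge0.
have An n : 0 <= A * q ^+ n by rewrite mulr_ge0// exprn_ge0.
have guess (l r : option R) c K (g : R * R -> R) (w : R * R * R -> R) : 0 <= K -> M + K <= A ->
    (\forall y \ae @leb2 R, (@time R `*` @torus R) y -> `|g y| <= K) ->
    trace_eq (oitv l r) c w g ->
    \forall y \ae @leb2 R, 0 < y.1 < T -> T1 y.2 ->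
    forall U0 : R -> R, continuous U0 -> (\forall v \ae @leb R, u (y, v) = U0 v) ->
    exists2 b, value_at (oitv l r) (fun v => w (y, v)) c b &
      `|b - U0 c| <= A * q ^+ 0 * expR y.1.
  move=> K0 KA hg tr; apply: aeS (aeI (aeI hg tr) (gap c)) => -[t x] [[hgy htr] hgap] tT Tx U0 cU uU.
  have D : (@time R `*` @torus R) (t, x) by split; [exact: inD|exact: inT].
  exists (g (t, x)); first exact: htr.
  have t1 : 1 <= expR t by apply: ge1; case/andP: tT.
  have h1 := hgap tT Tx U0 cU uU; have h2 := hgy D; rewrite expr0 mulr1 /=.
  apply: le_trans (ler_normB _ _) _; apply: (@le_trans _ _ ((M + K) * expR t)).
    rewrite mulrDl addrC; apply: lerD => //; apply: le_trans h2 _.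
    by rewrite ler_peMr.
  by rewrite ler_wpM2r// expR_ge0.
(* Iterate [n + 1] carries the power [q^n]: the first iterates take the guesses as data and gain no
   factor. Both errors are needed together, as each feeds the other. *)
have main n : (\forall z \ae @leb3 R, 0 < z.1.1 < T -> T1 z.1.2 -> z.2 \in I1 ->
      `|u1 n.+1 z - u z| <= barrier (A * q ^+ n) 1 L2 z.1.1 z.2) /\
    (\forall z \ae @leb3 R, 0 < z.1.1 < T -> T1 z.1.2 -> z.2 \in I2 ->
      `|u2 n.+1 z - u z| <= barrier (A * q ^+ n) (-1) L1 z.1.1 z.2).
  have step1 m : (\forall y \ae @leb2 R, 0 < y.1 < T -> T1 y.2 ->
      forall U0 : R -> R, continuous U0 -> (\forall v \ae @leb R, u (y, v) = U0 v) ->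
      exists2 b, value_at I1 (fun v => u1 m.+1 (y, v)) L2 b &
        `|b - U0 L2| <= A * q ^+ m * expR y.1) ->
      \forall z \ae @leb3 R, 0 < z.1.1 < T -> T1 z.1.2 -> z.2 \in I1 ->
      `|u1 m.+1 z - u z| <= barrier (A * q ^+ m) 1 L2 z.1.1 z.2.
    apply: (@error_step R None (Some L2) L2 1 (A * q ^+ m) T f (u1 m.+1) u u0) => //.
    - by rewrite normr1.
    - by move=> e [//|[]].
    - exact: closure_below.
    - by move=> s r s0; exact: p1.
    - exact: iv (proj1 (sol m.+1 isT)).
    - exact: iv.
  have step2 m : (\forall y \ae @leb2 R, 0 < y.1 < T -> T1 y.2 ->
      forall U0 : R -> R, continuous U0 -> (\forall v \ae @leb R, u (y, v) = U0 v) ->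
      exists2 b, value_at I2 (fun v => u2 m.+1 (y, v)) L1 b &
        `|b - U0 L1| <= A * q ^+ m * expR y.1) ->
      \forall z \ae @leb3 R, 0 < z.1.1 < T -> T1 z.1.2 -> z.2 \in I2 ->
      `|u2 m.+1 z - u z| <= barrier (A * q ^+ m) (-1) L1 z.1.1 z.2.
    apply: (@error_step R (Some L1) None L1 (-1) (A * q ^+ m) T f (u2 m.+1) u u0) => //.
    - by rewrite normrN1.
    - by move=> e [[]|//].
    - exact: closure_above.
    - by move=> s r s0; exact: p2.
    - exact: iv (proj2 (sol m.+1 isT)).
    - exact: iv.
  elim: n => [|n [IH1 IH2]].
    have MK2 : M + K2 <= A by rewrite /A; lra.
    have MK1 : M + K1 <= A by rewrite /A; lra.
    split; first exact: step1 (guess None (Some L2) L2 K2 g2 (u1 1%N) K20 MK2 hg2 tr2).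
    exact: step2 (guess (Some L1) None L1 K1 g1 (u2 1%N) K10 MK1 hg1 tr1).
  have [st1 st2] := st n.+1 isT.
  have L2I2 : L2 \in I2 by rewrite in_oitv /= L12.
  have L1I1 : L1 \in I1 by rewrite in_oitv /= L12.
  split.
    (* At [v = L2] the barrier for [u2 - u] is [A q^n exp(t - (L2 - L1)) = A q^(n+1) exp(t)], and
       the transmission condition passes this bound to the next [u1]. *)
    apply: step1; apply: aeS (aeI st1 (@trace_gap R (Some L1) None _ _ _ _ _ _ _ L2I2 IH2)) => -[t x] [hst hgap] tT Tx U0 cU uU.
    have [b [b1 b2]] := hst (conj (inD _ tT) (inT _ Tx)); exists b => //.
    have := hgap tT Tx U0 cU uU b b2; rewrite /barrier mulN1r expRD /= -/q.
    by rewrite exprSr !mulrA (mulrAC _ (expR t)).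
  apply: step2; apply: aeS (aeI st2 (@trace_gap R None (Some L2) _ _ _ _ _ _ _ L1I1 IH1)) => -[t x] [hst hgap] tT Tx U0 cU uU.
  have [b [b1 b2]] := hst (conj (inD _ tT) (inT _ Tx)); exists b => //.
  have := hgap tT Tx U0 cU uU b b2; rewrite /barrier mul1r -(opprB L2 L1) expRD /= -/q.
  by rewrite exprSr !mulrA (mulrAC _ (expR t)).
have Te : 0 <= A * expR T by rewrite mulr_ge0// expR_ge0.
(* On each subdomain the exponent [k (v - c)] is at most 0, so the barrier is bounded by its value
   on the interface at time [T]. *)
have bar n (k c : R) (z : R * R * R) : 0 < z.1.1 < T -> k * (z.2 - c) <= 0 ->
    barrier (A * q ^+ n) k c z.1.1 z.2 <= A * expR T * q ^+ n.
  move=> /andP[_ tT] kv; rewrite /barrier mulrAC ler_wpM2r ?exprn_ge0// ler_wpM2l// ler_expR.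
  by rewrite -[leRHS]addr0 lerD// ltW.
split; apply: (@geometric_cvg0 R _ (A * expR T) q); rewrite ?q0 ?q1//.
- by move=> n; exact: Lnorm_ge0.
- move=> n; have [h _] := main n.
  apply: (@norm_error_le R I1 T _ (u1 n.+1 \- u)
    (fun z => barrier (A * q ^+ n) 1 L2 z.1.1 z.2) _ h); first by rewrite mulr_ge0// exprn_ge0.
  move=> z zt; rewrite in_oitv /= => vL; apply: bar => //.
  by rewrite mul1r subr_le0 ltW.
- by move=> n; exact: Lnorm_ge0.
- move=> n; have [_ h] := main n.
  apply: (@norm_error_le R I2 T _ (u2 n.+1 \- u)
    (fun z => barrier (A * q ^+ n) (-1) L1 z.1.1 z.2) _ h); first by rewrite mulr_ge0// exprn_ge0.
  move=> z zt; rewrite in_oitv /= andbT => vL; apply: bar => //.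
  by rewrite mulN1r oppr_le0 subr_ge0 ltW.
Qed.
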